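(* Let $\epsilon,\delta$ be nonnegative real numbers and let $n$ be a positive integer such that $$12 \leq n - 12 n\sqrt{36\delta + \frac{198\delta}{n} + \frac{5346\,\epsilon}{n} + \frac{1518}{100\cdot n} + 10956\,\epsilon^2} - 12\epsilon n.$$ Then every $\epsilon$-dense partial Latin square $P$ of order $n$ containing no more than $\delta n^2$ filled cells in total is completable.
   Context: A Latin square of order $n$ is an $n\times n$ array filled with symbols from $\{1,\dots,n\}$ such that no symbol is repeated in any row or column. A partial Latin square of order $n$ is an $n\times n$ array in which each cell is either blank or contains one symbol from $\{1,\dots,n\}$, such that no symbol is repeated in any row or column. It is completable if its blank cells can be filled so that the resulting array is a Latin square. A partial Latin square of order $n$ is $\epsilon$-dense if each row contains at most $\epsilon n$ filled (nonblank) cells, each column contains at most $\epsilon n$ filled cells, and each symbol occurs in at most $\epsilon n$ cells. *)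

(* Defs.v *)
From mathcomp Require Import all_boot all_order all_algebra.
From mathcomp Require Import reals.

Set Implicit Arguments.
Unset Strict Implicit.
Unset Printing Implicit Defensive.

Import Order.TTheory GRing.Theory Num.Theory.

Local Open Scope ring_scope.

(* Rows, columns and symbols are all indexed by 'I_n, that is by
   {0, ..., n - 1} instead of {1, ..., n}. *)
Definition latin_square (n : nat) (L : 'M['I_n]_n) : Prop :=
  (forall i j1 j2, L i j1 = L i j2 -> j1 = j2) /\
  (forall j i1 i2, L i1 j = L i2 j -> i1 = i2).

(* A blank cell contains None. A cell used as a boolean stands, through the
   isSome coercion, for "this cell is filled". *)
Definition partial_latin_square (n : nat) (P : 'M[option 'I_n]_n) : Prop :=
  (forall i j1 j2, P i j1 -> P i j1 = P i j2 -> j1 = j2) /\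
  (forall j i1 i2, P i1 j -> P i1 j = P i2 j -> i1 = i2).

Definition completable (n : nat) (P : 'M[option 'I_n]_n) : Prop :=
  exists L : 'M['I_n]_n,
    latin_square L /\ forall i j, P i j -> P i j = Some (L i j).

Definition filled_cells (n : nat) (P : 'M[option 'I_n]_n) :
    {set 'I_n * 'I_n} :=
  [set c | P c.1 c.2].

Definition eps_dense (R : realType) (eps : R) (n : nat)
    (P : 'M[option 'I_n]_n) : Prop :=
  [/\ forall i, #|[set j | P i j]|%:R <= eps * n%:R,
      forall j, #|[set i | P i j]|%:R <= eps * n%:R
    & forall s, #|[set c in filled_cells P | P c.1 c.2 == Some s]|%:R
                  <= eps * n%:R].

(* Main.v *)
Require Import Defs.
From mathcomp Require Import all_boot all_order all_fingroup all_algebra.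
From mathcomp Require Import reals zify ring lra.

Set Implicit Arguments.
Unset Strict Implicit.
Unset Printing Implicit Defensive.

Import Order.TTheory GRing.Theory Num.Theory.

(* Even order.  Start from an isotopic copy of the Cayley table of a dihedral
   group: its rows are of two types, and each cell lies in an intercalate with
   every row of the other type.  A random isotopism keeps the number of already
   correct prescribed entries small on every line.  For each other prescribed
   entry (r, c, s), choose an intercalate at each of its three bases, namely the
   cell (r, c), the cell of row r holding s and the cell of column c holding s;
   if a fourth, induced, intercalate is also switched, then one last switch puts
   s in (r, c).  All switches are independent as soon as the intercalates are
   pairwise disjoint, and such a choice exists by Rosenfeld's counting argument:
   adding one more base multiplies the number of good choices by at least m / 2,
   where the order is 2 m.

   Odd order q + 1.  Single out a row, a column and a symbol.  Complete in order
   q the entries off these lines, together with a transversal and two auxiliary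
   entries for each entry on a singled out line; prolong along the transversal,
   and switch the intercalates that the auxiliary entries create. *)

Local Open Scope ring_scope.

(** * Rosenfeld's counting argument *)

(** In a group table, two rows [r] and [r'] form intercalates exactly when [r^-1 r'] is an
    involution. In a dihedral group this holds for every rotation and reflection; in a group of odd
    order it never holds, which is why odd order is reduced to even order. The types split the cells
    into four classes. Each intercalate in use has one cell in every class, so disjointness can be
    tested class by class. What shapes the counting is the price of a conflict. If a base [v] is in
    conflict and [k] further bases are rechosen with it, the conflict costs its number of bad
    choices divided by [(m / 2) ^ k], and all costs at [v] together must fit into [m / 2] minus the
    few values excluded beforehand. Conflicts between entries close to [v] are boundedly many and
    may cost a constant each. An induced intercalate anywhere in the square may be hit by the one at
    [v]; there are up to [4 * #|PT|] such conflicts, of quadratic order, so two bases of the distant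
    entry have to be rechosen in order to bring the price down to [4 / m]. *)

Lemma sum_le_indicator (F : realFieldType) (I : finType) (A : {set I})
    (w : I -> F) (c : F) (N : nat) : 0 <= c -> (#|A| <= N)%N ->
  (forall i, w i <= if i \in A then c else 0) -> \sum_i w i <= c *+ N.
Proof.
move=> c0 AN wc; apply: le_trans (_ : \sum_(i in A) c <= _).
  by rewrite [leRHS]big_mkcond; apply: ler_sum => i _; apply: wc.
by rewrite sumr_const ler_wpMn2l.
Qed.

(* The functions that are good on [S] and bad at [v] for the reason [j] are
   mapped to solutions on [S :\: res v j] with fibres of size at most [M v j],
   and by induction there are at most [#|sols S| / beta ^+ #|res v j|] such
   solutions. *)
Section SolutionCounting.

Variables (F : realFieldType) (V A J : finType) (a0 : A).
Variables (D : V -> {set A}) (good : {set V} -> {ffun V -> A} -> bool).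
Variables (V0 : {set V}) (bad : {set V} -> V -> J -> {ffun V -> A} -> bool).
Variables (res : V -> J -> {set V}) (M : V -> J -> F) (beta : F).

Hypothesis beta_gt0 : 0 < beta.
Hypothesis good0 : forall f, good set0 f.
Hypothesis good_ext : forall (S : {set V}) (f g : {ffun V -> A}),
  {in S, f =1 g} -> good S f -> good S g.
Hypothesis good_sub : forall (S' S : {set V}) f,
  S' \subset S -> good S f -> good S' f.
Hypothesis badP : forall (S : {set V}) v f, v |: S \subset V0 -> v \notin S ->
  good S f -> {in v |: S, forall u, f u \in D u} -> ~~ good (v |: S) f ->
  exists2 j, bad S v j f & res v j \subset S.
Hypothesis bad_count : forall (S : {set V}) v j (f : {ffun V -> A}),
  v |: S \subset V0 -> v \notin S -> res v j \subset S ->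
  #|[set g : {ffun V -> A} | [&& [forall u in v |: S, g u \in D u],
      [forall u in ~: (v |: res v j), g u == f u] & bad S v j g]]|%:R <= M v j.
Hypothesis M_ge0 : forall v j, 0 <= M v j.
Hypothesis budget : forall v, v \in V0 ->
  beta + \sum_j M v j / beta ^+ #|res v j| <= #|D v|%:R.

(** A partial assignment is encoded as a total function with the default value [a0] off [S], so that
    assignments on different sets are counted inside one finite type. *)
Definition sols (S : {set V}) : {set {ffun V -> A}} :=
  [set f : {ffun V -> A} | [&& [forall u in S, f u \in D u],
     [forall u in ~: S, f u == a0] & good S f]].

Let reset (R : {set V}) (h : {ffun V -> A}) : {ffun V -> A} :=
  [ffun u => if u \in R then a0 else h u].

Lemma card_sols_ge (S : {set V}) v : v \notin S -> v |: S \subset V0 ->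
  (forall R : {set V}, R \subset S ->
     beta ^+ #|R| * #|sols (S :\: R)|%:R <= #|sols S|%:R) ->
  beta * #|sols S|%:R <= #|sols (v |: S)|%:R.
Proof.
move=> vS vSV0 IH.
pose H := [set h : {ffun V -> A} | [&& [forall u in v |: S, h u \in D u],
     [forall u in ~: (v |: S), h u == a0] & good S h]].
pose B j := [set h in H | bad S v j h && (res v j \subset S)].
have cardH : (#|D v| * #|sols S| <= #|H|)%N.
  pose up (x : A * {ffun V -> A}) : {ffun V -> A} :=
    [ffun u => if u == v then x.1 else x.2 u].
  rewrite -cardsX -(@card_in_imset _ _ up).
    apply/subset_leq_card/subsetP => _ /imsetP[[a f] + ->].
    rewrite in_setX !inE /= => /andP[aD /and3P[/forall_inP fD /forall_inP f0 fg]].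
    apply/and3P; split.
    - apply/forall_inP => u; rewrite in_setU1 ffunE /=.
      by case: eqP => [->//|_] /= /fD.
    - apply/forall_inP => u; rewrite in_setC in_setU1 negb_or ffunE /=.
      by case: eqP => //= _ uS; apply: f0; rewrite in_setC.
    apply: good_ext fg => u uS; rewrite ffunE; case: eqP => // uv.
    by rewrite -uv uS in vS.
  move=> [a f] [b g]; rewrite !in_setX !inE /=.
  move=> /andP[_ /and3P[_ /forall_inP f0 _]].
  move=> /andP[_ /and3P[_ /forall_inP g0 _]] /ffunP E.
  congr pair; first by have:= E v; rewrite !ffunE eqxx.
  apply/ffunP => u; case: (eqVneq u v) => [->|uv].
    by rewrite (eqP (f0 v _)) ?(eqP (g0 v _)) // in_setC.
  by have := E u; rewrite !ffunE (negPf uv).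
have HU : H \subset sols (v |: S) :|: \bigcup_j B j.
  apply/subsetP => h hH; rewrite in_setU.
  have := hH; rewrite inE => /and3P[hD h0 hg].
  case: (boolP (good (v |: S) h)) => hg'.
    by rewrite inE hD h0 hg'.
  have [|j bj rj] := badP vSV0 vS hg _ hg'; first exact/forall_inP.
  by apply/orP; right; apply/bigcupP; exists j => //; rewrite inE hH bj rj.
have cardB j : #|B j|%:R * beta ^+ #|res v j| <= M v j * #|sols S|%:R.
  case: (boolP (res v j \subset S)) => rS; last first.
    rewrite (_ : B j = set0) ?cards0 ?mul0r; last first.
      by apply/setP => h; rewrite !inE (negPf rS) !andbF.
    by rewrite mulr_ge0.
  pose T := sols (S :\: res v j).
  have mapT h : h \in B j -> reset (v |: res v j) h \in T.
    rewrite !inE => /andP[/and3P[/forall_inP hD /forall_inP h0 hg] _].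
    apply/and3P; split.
    - apply/forall_inP => u; rewrite inE => /andP[uR uS].
      have uv : u != v by apply: contraNneq vS => <-.
      rewrite ffunE in_setU1 (negPf uv) (negPf uR) /=.
      by apply: hD; rewrite in_setU1 uS orbT.
    - apply/forall_inP => u; rewrite in_setC in_setD negb_and negbK ffunE in_setU1.
      case: (eqVneq u v) => //= uv; case: (boolP (u \in res v j)) => //= _ uS.
      by apply: h0; rewrite in_setC in_setU1 negb_or uv.
    have : good (S :\: res v j) h by apply: good_sub hg; exact: subsetDl.
    apply: good_ext => u; rewrite inE => /andP[uR uS].
    have uv : u != v by apply: contraNneq vS => <-.
    by rewrite ffunE in_setU1 (negPf uv) (negPf uR).
  have fiber : #|B j|%:R <= M v j * #|T|%:R.
    rewrite -sum1_card (partition_big (reset (v |: res v j)) (mem T)) //=.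
    rewrite natr_sum -sum1_card natr_sum mulr_sumr; apply: ler_sum => t tT.
    rewrite mulr1 sum1_card; apply: le_trans (bad_count t vSV0 vS rS).
    rewrite ler_nat; apply/subset_leq_card/subsetP => h.
    case/andP=> hB /eqP <-; move: hB; rewrite !inE => /andP[/and3P[hD _ _]].
    case/andP=> hb _.
    rewrite hD hb andbT /=; apply/forall_inP => u; rewrite in_setC => uR.
    by rewrite ffunE (negPf uR).
  apply: le_trans (_ : M v j * #|T|%:R * beta ^+ #|res v j| <= _).
    by rewrite ler_wpM2r // exprn_ge0 // ltW.
  by rewrite -mulrA ler_wpM2l // mulrC IH.
have cardU : #|H|%:R <= #|sols (v |: S)|%:R + \sum_j #|B j|%:R :> F.
  rewrite -natr_sum -natrD ler_nat; apply: leq_trans (subset_leq_card HU) _.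
  apply: leq_trans (leq_card_setU _ _) _; rewrite leq_add2l.
  elim/big_rec2: _ => [|j n U _ IHn]; first by rewrite cards0.
  by apply: leq_trans (leq_card_setU _ _) _; rewrite leq_add2l.
have sumB : \sum_j #|B j|%:R <=
    (\sum_j M v j / beta ^+ #|res v j|) * #|sols S|%:R.
  rewrite mulr_suml; apply: ler_sum => j _.
  by rewrite mulrAC ler_pdivlMr ?exprn_gt0 // cardB.
have vV0 : v \in V0 by rewrite (subsetP vSV0) // setU11.
have := ler_wpM2r (ler0n F #|sols S|) (budget vV0).
have : #|D v|%:R * #|sols S|%:R <= #|H|%:R :> F by rewrite -natrM ler_nat.
rewrite mulrDl; move: cardU sumB; set a := _ * _; set b := \sum_j _; lra.
Qed.

(** The elements of [R] are deleted one at a time, each at the price of a factor [beta]. The claim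
    for all [R] at a smaller set is what [card_sols_ge] assumes, hence the induction on a bound for
    [#|S|]. *)
Lemma card_sols_res n (S : {set V}) : (#|S| <= n)%N -> S \subset V0 ->
  forall R : {set V}, R \subset S ->
  beta ^+ #|R| * #|sols (S :\: R)|%:R <= #|sols S|%:R.
Proof.
elim: n S => [|n IHn] S Sn SV0 R RS.
  have /eqP R0 : R == set0.
    by rewrite -cards_eq0 -leqn0 (leq_trans _ Sn) // subset_leq_card.
  by rewrite R0 cards0 setD0 mul1r.
case: (set_0Vmem R) => [->|[v vR]]; first by rewrite cards0 setD0 mul1r.
have vS := subsetP RS v vR.
have SE : v |: (S :\ v) = S by rewrite setD1K.
have cSv : (#|S :\ v| <= n)%N by move: Sn; rewrite (cardsD1 v) vS.
have sub : S :\ v \subset V0 by apply: subset_trans SV0; exact: subsetDl.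
have vSv : v \notin S :\ v by rewrite setD11.
have step := card_sols_ge vSv.
rewrite SE in step; move/(_ SV0 (IHn _ cSv sub)): step; apply: le_trans.
rewrite (cardsD1 v R) vR add1n exprS -mulrA ler_wpM2l ?(ltW beta_gt0) //.
have -> : S :\: R = (S :\ v) :\: (R :\ v).
  apply/setP => u; rewrite !inE; case: (eqVneq u v) => [->|] //=.
  by rewrite vR.
by apply: IHn => //; apply: setSD.
Qed.

Lemma exists_solution :
  exists2 f, good V0 f & {in V0, forall v, f v \in D v}.
Proof.
have := card_sols_res (leqnn _) (subxx V0) (subxx V0).
rewrite setDv => ge.
have : 0 < #|sols V0|%:R :> F.
  apply: lt_le_trans ge; rewrite mulr_gt0 ?exprn_gt0 // ltr0n card_gt0.
  apply/set0Pn; exists [ffun => a0]; rewrite inE good0 andbT.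
  apply/andP; split; apply/forall_inP => u; first by rewrite inE.
  by rewrite ffunE.
rewrite ltr0n card_gt0 => /set0Pn[f]; rewrite inE => /and3P[/forall_inP fD _ fg].
by exists f.
Qed.

End SolutionCounting.

(** The budget for [beta = m / 2]. The four summands after [m / 2] are the costs of the four kinds
    of reasons, as bounded in [exists_placement], and [m - 3 * b] is the bound of [card_D].
    Multiplied by [m], the difference of the two sides is [m ^ 2 / 2 - 21 * b * m - 88 * T - 144 *
    m]. *)
Lemma placement_budget (F : realFieldType) (m b T : nat) : (0 < m)%N ->
  (42 * b * m + 176 * T + 288 * m <= m * m)%N ->
  m%:R / 2 + (18%:R * b%:R + (((4 * T + 2 * m)%:R / (m%:R / 2)) *+ 9
    + ((m%:R / (m%:R / 2) ^+ 2) *+ (4 * T) + 2 *+ 54))) <= m%:R - 3 * b%:R :> F.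
Proof.
move=> m0 le; have mpos : 0 < m%:R :> F by rewrite ltr0n.
have le' : 42 * b%:R * m%:R + 176 * T%:R + 288 * m%:R <= m%:R * m%:R :> F.
  by rewrite -!natrM -!natrD ler_nat.
rewrite -subr_ge0 -(pmulr_rge0 _ mpos) -(mulr_natr (_ / _) 9) -(mulr_natr 2 54).
rewrite -(mulr_natr (_ / _) (4 * T)).
have -> : (4 * T + 2 * m)%:R = 4 * T%:R + 2 * m%:R :> F by rewrite natrD !natrM.
have -> : (4 * T)%:R = 4 * T%:R :> F by rewrite natrM.
move: mpos le'; move: (m%:R) (b%:R) (T%:R) => M B t mpos le'.
rewrite [leRHS](_ : _ = M * M / 2 - 21 * B * M - 88 * t - 144 * M); first by lra.
by field; rewrite lt0r_neq0.
Qed.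

Local Close Scope ring_scope.

Lemma card_bigcup_leq (I T : finType) (P : {pred I}) (B : I -> {set T}) :
  #|\bigcup_(i in P) B i| <= \sum_(i in P) #|B i|.
Proof.
elim/big_rec2: _ => [|i n U _ IHn]; first by rewrite cards0.
by apply: leq_trans (leq_card_setU _ _) _; rewrite leq_add2l.
Qed.

(** * Permutations of low load and permutations avoiding a relation *)

Section Permutations.

(** Composed with the inverse of one permutation through [K], all the others fix the first
    coordinates of [K]. *)
Lemma card_perm_through n (K : {set 'I_n * 'I_n}) :
  #|[set p : 'S_n | [forall e in K, p e.1 == e.2]]| <= (n - #|K|)`!.
Proof.
case: (set_0Vmem [set p : 'S_n | [forall e in K, p e.1 == e.2]]) => [->|[p0]].
  by rewrite cards0.
rewrite inE => /forall_inP p0K.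
pose Y := [set e.1 | e in K].
have cY : #|Y| = #|K|.
  apply: card_in_imset => -[a b] [a' b'] abK ab'K /= aa'.
  have /= /eqP := p0K _ abK; have /= /eqP := p0K _ ab'K.
  by rewrite -aa' => -> ->.
have cC : #|~: Y| = n - #|K| by rewrite cardsCs setCK cY card_ord.
rewrite -cC -card_perm -(card_imset _ (mulIg p0^-1)%g).
apply/subset_leq_card/subsetP => _ /imsetP[p pK ->]; rewrite inE in pK.
apply/subsetP => x; rewrite !inE permM; apply: contraNN => /imsetP[e eK ->].
by rewrite (eqP (forall_inP pK _ eK)) -(eqP (p0K _ eK)) permK.
Qed.

(** Union bound: a permutation of high load passes through some [k]-subset of some [E i], and these
    events are too few to cover all permutations. *)
Lemma exists_perm_low_load n k T (I : finType) (E : I -> {set 'I_n * 'I_n}) :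
  (forall i, #|E i| <= T) -> #|I| * 'C(T, k) * (n - k)`! < n`! ->
  exists p : 'S_n, forall i, #|[set e in E i | p e.1 == e.2]| < k.
Proof.
move=> ET lt.
pose Z (K : {set 'I_n * 'I_n}) := [set p : 'S_n | [forall e in K, p e.1 == e.2]].
pose U := \bigcup_i \bigcup_(K in [set K : {set _} | K \subset E i & #|K| == k]) Z K.
have cU : #|U| < #|[set: 'S_n]|.
  have -> : #|[set: 'S_n]| = n`!.
    have <- : #|perm_on [set: 'I_n]| = #|[set: 'S_n]|.
      by rewrite cardsT; apply: eq_card => p; rewrite !inE; apply/subsetP => x.
    by rewrite card_perm cardsT card_ord.
  apply: leq_ltn_trans lt; apply: leq_trans (card_bigcup_leq _ _) _.
  rewrite -mulnA -sum_nat_const; apply: leq_sum => i _.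
  apply: leq_trans (card_bigcup_leq _ _) _.
  apply: leq_trans (_ : 'C(#|E i|, k) * (n - k)`! <= _); last first.
    by rewrite leq_mul2r leq_bin2l ?orbT.
  rewrite -cards_draws -sum_nat_const; apply: leq_sum => K.
  by rewrite inE => /andP[_ /eqP <-]; apply: card_perm_through.
have /properP[_ [p _ pU]] : U \proper setT by rewrite properEcard subsetT.
exists p => i; rewrite ltnNge; apply: contraNN pU => /card_geqP[s [us ss sE]].
apply/bigcupP; exists i => //; apply/bigcupP; exists [set x in s].
  rewrite inE cardsE (card_uniqP us) ss eqxx andbT.
  by apply/subsetP => x; rewrite inE => /sE; rewrite inE => /andP[].
by rewrite inE; apply/forall_inP => x; rewrite inE => /sE; rewrite inE => /andP[].
Qed.

(** Among the permutations that agree with [p0] on [Fx], one with the fewest bad positions has none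
    outside [Fx]: a bad [i] could exchange its value with a suitable [j]. *)
Lemma perm_avoid q d d' (Fx : {set 'I_q}) (p0 : 'S_q) (bad : rel 'I_q) :
  (forall i, #|[set x | bad i x]| <= d) ->
  (forall x, #|[set i | bad i x]| <= d') -> #|Fx| + d + d' < q ->
  exists2 p : 'S_q, {in Fx, p =1 p0} & forall i, i \notin Fx -> ~~ bad i (p i).
Proof.
move=> rd cd lt.
pose agree (p : 'S_q) := [forall i in Fx, p i == p0 i].
pose B (p : 'S_q) := [set i | (i \notin Fx) && bad i (p i)].
have p0a : agree p0 by apply/forall_inP.
case: (arg_minnP (fun p => #|B p|) p0a) => p pa pmin.
have pF : {in Fx, p =1 p0} by move=> i iF; apply/eqP; apply: (forall_inP pa).
exists p => // i iF; apply/negP => bi.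
(* Outside [W], the value of [j] is free to move, suits [i], and can be replaced by the value of
   [i]. Since [i] is bad, it lies in [W] itself. *)
pose W := Fx :|: [set j | bad i (p j)] :|: [set j | bad j (p i)].
have /subsetPn[j _ jW] : ~~ ([set: 'I_q] \subset W).
  apply: contraTN lt => /subset_leq_card; rewrite cardsT card_ord -leqNgt.
  move=> /leq_trans; apply; apply: leq_trans (leq_card_setU _ _) _.
  apply: leq_add (cd _); apply: leq_trans (leq_card_setU _ _) _.
  rewrite leq_add2l; apply: leq_trans (rd i).
  have -> : [set j | bad i (p j)] = (p^-1)%g @: [set x | bad i x].
    by apply/setP => x; rewrite (can_imset_pre _ (permK _)) invgK !inE.
  by rewrite card_imset //; apply: perm_inj.
move: jW; rewrite !inE !negb_or => /andP[/andP[jF bij] bji].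
have ij : i != j by apply: contraNneq bij => <-.
pose p' := (tperm i j * p)%g.
have p'a : agree p'.
  apply/forall_inP => x xF; rewrite permM tpermD ?pF //.
    by apply: contraNneq iF => ->.
  by apply: contraNneq jF => ->.
have := pmin _ p'a; rewrite leqNgt => /negP; apply.
have BiP : i \in B p by rewrite inE iF bi.
rewrite (cardsD1 i (B p)) BiP add1n ltnS; apply/subset_leq_card/subsetP => x.
rewrite !inE permM; case: tpermP => [->|->|/eqP xi /eqP xj].
- by rewrite (negPf bij) andbF.
- by rewrite (negPf bji) andbF.
by move=> ->; rewrite xi.
Qed.

End Permutations.

(** * Latin squares rich in intercalates *)

Definition latin q (L : 'I_q -> 'I_q -> 'I_q) : Prop :=
  (forall r, injective (L r)) /\ (forall c, injective (L^~ c)).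

Definition colof q (L : 'I_q -> 'I_q -> 'I_q) (r s : 'I_q) : 'I_q :=
  odflt s [pick c | L r c == s].

Definition rowof q (L : 'I_q -> 'I_q -> 'I_q) (c s : 'I_q) : 'I_q :=
  odflt s [pick r | L r c == s].

Section LatinTheory.
Variables (q : nat) (L : 'I_q -> 'I_q -> 'I_q).
Hypothesis latL : latin L.

Lemma colofK r s : L r (colof L r s) = s.
Proof.
rewrite /colof; case: pickP => [c /eqP//|no].
have /codomP[c cs] := injF_onto (latL.1 r) s.
by have := no c; rewrite cs eqxx.
Qed.

Lemma rowofK c s : L (rowof L c s) c = s.
Proof.
rewrite /rowof; case: pickP => [r /eqP//|no].
have /codomP[r cs] := injF_onto (latL.2 c) s.
by have := no r; rewrite cs eqxx.
Qed.

Lemma colof_inj r : injective (colof L r).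
Proof. by move=> s s' /(congr1 (L r)); rewrite !colofK. Qed.

Lemma rowof_inj c : injective (rowof L c).
Proof. by move=> s s' /(congr1 (L^~ c)) /=; rewrite !rowofK. Qed.

Lemma colof_injl s : injective (colof L ^~ s).
Proof.
move=> r r' /= E; apply: (latL.2 (colof L r s)).
by rewrite /= colofK E colofK.
Qed.

Lemma rowof_injl s : injective (rowof L ^~ s).
Proof.
move=> c c' /= E; apply: (latL.1 (rowof L c s)).
by rewrite /= rowofK E rowofK.
Qed.

End LatinTheory.

(* [rich L tR tC tS]: any two rows of different types differ by an involution
   of the columns, so every cell lies in an intercalate with every row of the
   other type.  The Cayley table of a dihedral group is of this kind. *)
Definition rich q (L : 'I_q -> 'I_q -> 'I_q) (tR tC tS : 'I_q -> bool) : Prop :=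
  [/\ latin L,
      forall r c, tS (L r c) = tR r (+) tC c
    & forall r r' c c', tR r != tR r' -> L r c' = L r' c -> L r' c' = L r c].

Lemma exists_rich m : 0 < m ->
  exists L : 'I_m.*2 -> 'I_m.*2 -> 'I_m.*2, exists tR, exists tC, exists tS,
    rich L tR tC tS /\ forall b, #|[set r | tR r == b]| = m.
Proof.
case: m => // m _; set T := (bool * 'I_m.+1)%type.
have e : #|{: bool * 'I_m.+1}| = m.+1.*2 by rewrite card_prod card_bool card_ord mul2n.
pose h (i : 'I_m.+1.*2) : T := enum_val (cast_ord (esym e) i).
pose g (x : T) : 'I_m.+1.*2 := cast_ord e (enum_rank x).
have gK : cancel g h by move=> x; rewrite /h /g cast_ordK enum_rankK.
have hK : cancel h g by move=> x; rewrite /h /g enum_valK cast_ordKV.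
have gI := can_inj gK; have hI := can_inj hK.
(* Dihedral multiplication, with [(false, i)] a rotation and [(true, i)] a reflection. The Boolean
   component is a homomorphism, which gives the equation between types. *)
pose op (x y : T) : T :=
  (x.1 (+) y.1, if x.1 then (x.2 - y.2)%R else (x.2 + y.2)%R).
exists (fun r c => g (op (h r) (h c))).
do 3!exists (fun r => (h r).1); split; last first.
  move=> b; have -> : [set r | (h r).1 == b] = g @: [set x : bool * 'I_m.+1 | x.1 == b].
    apply/setP => r; rewrite inE; apply/idP/imsetP => [hr|[x + ->]].
      by exists (h r); rewrite ?hK // inE.
    by rewrite inE gK.
  rewrite card_imset // (_ : [set x | _] = setX [set b] setT).
    by rewrite cardsX cards1 cardsT card_ord mul1n.
  by apply/setP => x; rewrite !inE andbT.
split.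
- split.
    move=> r c c' /gI [] /addbI E1; case: (h r).1 => E2; apply/hI;
      apply: injective_projections => //.
      exact: GRing.oppr_inj (GRing.addrI _ E2).
    exact: GRing.addrI E2.
  move=> c r r' /gI [] /addIb E1; rewrite E1 => E2; apply/hI.
  apply: injective_projections => //.
  by case: (h r').1 E2 => /GRing.addIr.
- by move=> r c; rewrite gK.
move=> r r' c c' + /gI [].
have sol (a b x y : 'I_m.+1) : (a - x = b + y -> b + x = a - y)%R.
  move=> /(congr1 (fun z => z + x - y)%R); rewrite GRing.subrK => ->.
  by rewrite [(b + y + x)%R]GRing.addrAC GRing.addrK.
case: (h r) (h r') (h c) (h c') => [[] i] [[] i'] [[] j] [[] j'] //= _ _ E;
  congr (g (_, _)); rewrite /=; [exact: sol|exact: sol| |];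
  by apply/esym/sol.
Qed.

Notation cell q := ('I_q * 'I_q)%type.
Notation triple q := ('I_q * 'I_q * 'I_q)%type.

Definition pls q (PT : {set triple q}) : Prop :=
  [/\ {in PT &, forall t u, t.1.1 = u.1.1 -> t.1.2 = u.1.2 -> t = u},
      {in PT &, forall t u, t.1.1 = u.1.1 -> t.2 = u.2 -> t = u}
    & {in PT &, forall t u, t.1.2 = u.1.2 -> t.2 = u.2 -> t = u}].

Definition line_load q (PT : {set triple q}) (l : nat) : Prop :=
  [/\ forall x, #|[set t in PT | t.1.1 == x]| <= l,
      forall x, #|[set t in PT | t.1.2 == x]| <= l
    & forall x, #|[set t in PT | t.2 == x]| <= l].

(* For a random isotopic copy of a rich square, all three kinds of load below
   are stochastically dominated by a Poisson variable; a union bound over the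
   [3 q] lines suffices. *)
Lemma exists_rich_low_load m k (PT : {set triple m.*2}) : 0 < m -> pls PT ->
  m.*2.*2 * 'C(#|PT|, k) * (m.*2 - k)`! < m.*2`! ->
  exists L tR tC tS, [/\ rich L tR tC tS, forall b, #|[set r | tR r == b]| = m &
    [/\ forall r, #|[set t in PT | L r t.1.2 == t.2]| < k,
        forall c, #|[set t in PT | L t.1.1 c == t.2]| < k
      & forall s, #|[set t in PT | L t.1.1 t.1.2 == s]| < k]].
Proof.
move=> m0 [prc prs pcs] lt.
have [L0 [tR [tC [tS [[latL Ltype Linv] cR]]]]] := exists_rich m0.
(* The column permutation [sg] settles the first load, for all rows of [L0]. The other two loads are
   settled by the row permutation [pi], chosen after [sg]; it only renames the rows in the first
   bound. *)
pose E1 (y : 'I_m.*2) := [set (t.1.2, colof L0 y t.2) | t in PT].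
have [||sg sgP] := @exists_perm_low_load _ k #|PT| _ E1.
- by move=> y; apply: leq_imset_card.
- apply: leq_ltn_trans lt; rewrite card_ord -!mulnA leq_mul2r -[m.*2.*2]addnn.
  by rewrite leq_addr orbT.
pose E2 (y : 'I_m.*2 + 'I_m.*2) := match y with
  | inl x => [set (t.1.1, rowof L0 x t.2) | t in PT]
  | inr a => [set (t.1.1, rowof L0 (sg t.1.2) a) | t in PT] end.
have [||pi piP] := @exists_perm_low_load _ k #|PT| _ E2.
- by move=> [] y; apply: leq_imset_card.
- by apply: leq_ltn_trans lt; rewrite card_sum card_ord addnn.
exists (fun r c => L0 (pi r) (sg c)), (tR \o pi), (tC \o sg), tS; split.
- split=> [|r c|r r' c c']; last exact: Linv; last exact: Ltype.
  split=> [r c c' /(latL.1 _) /perm_inj //|c r r' /(latL.2 (sg c)) /perm_inj //].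
- move=> b; apply: etrans (cR b); rewrite -(card_imset _ (@perm_inj _ pi)).
  apply: eq_card => r; rewrite inE; apply/imsetP/idP => [[x + ->]|rb].
    by rewrite inE.
  by exists (pi^-1%g r); rewrite ?inE /= permKV.
split=> x.
- apply: leq_ltn_trans (sgP (pi x)).
  rewrite -(@card_in_imset _ _ (fun t => (t.1.2, colof L0 (pi x) t.2))).
    apply/subset_leq_card/subsetP => _ /imsetP[t + ->]; rewrite inE => /andP[tP /eqP e].
    rewrite inE imset_f //= -(inj_eq (latL.1 (pi x))) colofK // e; exact/eqP.
  move=> t u; rewrite !inE => /andP[tP _] /andP[uP _] [] e1 /(colof_inj latL) e2.
  exact: pcs.
- apply: leq_ltn_trans (piP (inl (sg x))).
  rewrite -(@card_in_imset _ _ (fun t => (t.1.1, rowof L0 (sg x) t.2))).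
    apply/subset_leq_card/subsetP => _ /imsetP[t + ->]; rewrite inE => /andP[tP /eqP e].
    rewrite inE imset_f //= -(inj_eq (latL.2 (sg x))) /= rowofK // e; exact/eqP.
  move=> t u; rewrite !inE => /andP[tP _] /andP[uP _] [] e1 /(rowof_inj latL) e2.
  exact: prs.
- apply: leq_ltn_trans (piP (inr x)).
  rewrite -(@card_in_imset _ _ (fun t => (t.1.1, rowof L0 (sg t.1.2) x))).
    apply/subset_leq_card/subsetP => _ /imsetP[t + ->]; rewrite inE => /andP[tP /eqP e].
    rewrite inE imset_f //= -(inj_eq (latL.2 (sg t.1.2))) /= rowofK // e; exact/eqP.
  move=> t u; rewrite !inE => /andP[tP _] /andP[uP _] [] e1.
  by move=> /(rowof_injl latL) /perm_inj e2; apply: prc.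
Qed.

(** * Switching disjoint intercalates *)

Definition intercalate q (L : 'I_q -> 'I_q -> 'I_q) (R C : cell q) : Prop :=
  [/\ R.1 != R.2, C.1 != C.2, L R.1 C.1 = L R.2 C.2 & L R.1 C.2 = L R.2 C.1].

Definition block q (R C : cell q) : {set cell q} :=
  setX [set R.1; R.2] [set C.1; C.2].

Definition switched q (L L' : 'I_q -> 'I_q -> 'I_q) (R C : cell q) : Prop :=
  [/\ L' R.1 C.1 = L R.1 C.2, L' R.1 C.2 = L R.1 C.1,
      L' R.2 C.1 = L R.2 C.2 & L' R.2 C.2 = L R.2 C.1].

(** The switch exchanges two columns inside two rows and, equally, two rows inside two columns. The
    first form shows that rows remain injective, the second that columns do. *)
Lemma switch_intercalate q (L : 'I_q -> 'I_q -> 'I_q) (R C : cell q) :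
  latin L -> intercalate L R C -> exists L', [/\ latin L', switched L L' R C
    & forall x y, (x, y) \notin block R C -> L' x y = L x y].
Proof.
move=> latL [Rne Cne e1 e2].
pose L' x y := if x \in [set R.1; R.2] then L x (tperm C.1 C.2 y) else L x y.
have L'E x y : L' x y =
    if y \in [set C.1; C.2] then L (tperm R.1 R.2 x) y else L x y.
  rewrite /L' !inE; case: tpermP => [->|->|/eqP y1 /eqP y2].
  - by rewrite eqxx /=; case: tpermP => [->|->|/eqP/negPf-> /eqP/negPf->] //;
      rewrite eqxx ?orbT.
  - by rewrite eqxx orbT /=; case: tpermP => [->|->|/eqP/negPf-> /eqP/negPf->] //;
      rewrite eqxx ?orbT.
  by rewrite (negPf y1) (negPf y2) if_same.
exists L'; split.
- split=> [x y y'|y x x'].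
    by rewrite /L'; case: ifP => _ /(latL.1 x) // /perm_inj.
  by rewrite /= !L'E; case: ifP => _ /(latL.2 y) // /perm_inj.
- by rewrite /switched /L' !inE !eqxx !orbT /= tpermL tpermR.
move=> x y; rewrite in_setX /= negb_and => /orP[xR|yC].
  by rewrite /L' (negPf xR).
by rewrite L'E (negPf yC).
Qed.

Lemma switch_disjoint q (J : eqType) (s : seq J) (R C : J -> cell q)
    (L : 'I_q -> 'I_q -> 'I_q) :
  latin L -> uniq s -> {in s, forall j, intercalate L (R j) (C j)} ->
  {in s &, forall i j, i != j -> [disjoint block (R i) (C i) & block (R j) (C j)]} ->
  exists L', [/\ latin L', {in s, forall j, switched L L' (R j) (C j)}
    & forall x y, (forall j, j \in s -> (x, y) \notin block (R j) (C j)) ->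
       L' x y = L x y].
Proof.
elim: s L => [|j s IHs] L latL; first by move=> *; exists L; split=> // x y _.
move=> /= /andP[js us] int dis.
have [L1 [latL1 sw1 same1]] := switch_intercalate latL (int j (mem_head _ _)).
have djs i : i \in s -> [disjoint block (R j) (C j) & block (R i) (C i)].
  move=> si; apply: dis; rewrite ?mem_head ?in_cons ?si ?orbT //.
  by apply: contraNneq js => ->.
have out i : i \in s -> {in block (R i) (C i), forall x, L1 x.1 x.2 = L x.1 x.2}.
  move=> si [x y] xy; apply: same1.
  by rewrite (disjointFl (djs i si)).
have corner i : [/\ ((R i).1, (C i).1) \in block (R i) (C i),
     ((R i).1, (C i).2) \in block (R i) (C i),
     ((R i).2, (C i).1) \in block (R i) (C i)
   & ((R i).2, (C i).2) \in block (R i) (C i)].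
  by rewrite /block !in_setX !inE /= !eqxx !orbT.
have agree i : i \in s -> [/\ L1 (R i).1 (C i).1 = L (R i).1 (C i).1,
    L1 (R i).1 (C i).2 = L (R i).1 (C i).2,
    L1 (R i).2 (C i).1 = L (R i).2 (C i).1
  & L1 (R i).2 (C i).2 = L (R i).2 (C i).2].
  by move=> si; have [c1 c2 c3 c4] := corner i; split;
    [exact: (out i si _ c1)|exact: (out i si _ c2)
    |exact: (out i si _ c3)|exact: (out i si _ c4)].
have [||i si|i i' si si'|L2 [latL2 sw2 same2]] := IHs L1 => //.
- have [a1 a2 a3 a4] := agree i si; rewrite /intercalate a1 a2 a3 a4.
  by apply: int; rewrite in_cons si orbT.
- by apply: dis; rewrite in_cons ?si ?si' orbT.
exists L2; split=> // [i|x y xy].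
  rewrite in_cons => /orP[/eqP ->|si].
    have fresh x : x \in block (R j) (C j) -> L2 x.1 x.2 = L1 x.1 x.2.
      case: x => x y xj; apply: same2 => i' si'.
      by rewrite (disjointFr (djs i' si')).
    have [c1 c2 c3 c4] := corner j; case: sw1 => s1 s2 s3 s4.
    by split; [rewrite (fresh _ c1)|rewrite (fresh _ c2)|rewrite (fresh _ c3)|rewrite (fresh _ c4)].
  case: (sw2 i si) (agree i si) => s1 s2 s3 s4 [a1 a2 a3 a4].
  by split; rewrite ?s1 ?s2 ?s3 ?s4.
rewrite same2; last by move=> i si; apply: xy; rewrite in_cons si orbT.
by apply: same1; apply: xy; rewrite mem_head.
Qed.

Lemma negb_eqb_self (x : bool) : (~~ x == x) = false.
Proof. by case: x. Qed.

(** * Even order *)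

Section Gadgets.

Variables (q m : nat) (L : 'I_q -> 'I_q -> 'I_q) (tR tC tS : 'I_q -> bool).
Hypothesis richL : rich L tR tC tS.
Hypothesis cardR : forall b, #|[set r | tR r == b]| = m.

Let latL : latin L. Proof. by case: richL. Qed.
Let typeL r c : tS (L r c) = tR r (+) tC c. Proof. by case: richL. Qed.

Implicit Types (p : triple q) (e v w : cell q) (t : bool * bool).

(* A value [f e] of the choice function is the second row of the intercalate at
   the base [e]; [newS] and [newC] are the other symbol in its first row and
   its second column. *)
Definition bA p : cell q := p.1.
Definition bX p : cell q := (p.1.1, colof L p.1.1 p.2).
Definition bY p : cell q := (rowof L p.1.2 p.2, p.1.2).
Definition bases p : {set cell q} := [set bA p; bX p; bY p].

Definition newS e (a : 'I_q) := L a e.2.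
Definition newC e (a : 'I_q) := colof L e.1 (newS e a).

Definition ctype e := (tR e.1, tC e.2).

(* The intercalate through the cell [e] and the row [a], where [tR a] differs
   from [tR e.1], has exactly one cell of each of the four types [t]. *)
Definition cI e t (a : 'I_q) : cell q :=
  (if t.1 == tR e.1 then e.1 else a, if t.2 == tC e.2 then e.2 else newC e a).

Lemma tC_newC e a : tR a != tR e.1 -> tC (newC e a) = ~~ tC e.2.
Proof.
move=> ta; have := typeL e.1 (newC e a); rewrite colofK // /newS typeL.
by move: ta; case: (tR a) (tR e.1) (tC e.2) (tC (newC e a)) => [] [] [] [].
Qed.

Lemma newS_inj e : injective (newS e).
Proof. exact: latL.2. Qed.

Lemma newC_inj e : injective (newC e).
Proof. by move=> a b /(colof_inj latL) /newS_inj. Qed.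

Lemma L_newC e a : L e.1 (newC e a) = newS e a.
Proof. exact: colofK. Qed.

Lemma L_newRC e a : tR a != tR e.1 -> L a (newC e a) = L e.1 e.2.
Proof.
move=> ta; case: richL => _ _; apply; first by rewrite eq_sym.
exact: L_newC.
Qed.

(** Consequently two such intercalates are disjoint as soon as their cells of equal type differ,
    which is how [good] expresses disjointness. *)
Lemma ctype_cI e t a : tR a != tR e.1 -> ctype (cI e t a) = t.
Proof.
move=> ta; rewrite /ctype /cI /=; case: t => t1 t2 /=.
congr pair.
  by case: eqP => [->//|]; move: ta; case: t1 (tR a) (tR e.1) => [] [] [].
case: eqP => [->//|]; rewrite tC_newC //.
by case: t2 (tC e.2) => [] [].
Qed.

Lemma cI_self e a : cI e (ctype e) a = e.
Proof. by rewrite /cI /ctype /= !eqxx; case: e. Qed.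

Lemma cI_neq e t a : tR a != tR e.1 -> (cI e t a != e) = (t != ctype e).
Proof.
move=> ta; apply/idP/idP; apply: contraNneq => E; first by rewrite E cI_self.
by rewrite -(ctype_cI t ta) E.
Qed.

Lemma cI_inj e t : t != ctype e -> injective (cI e t).
Proof.
case: t => t1 t2; rewrite /cI /ctype xpair_eqE negb_and /= => h a b [].
by move: h; case: (t1 == _) => //= /negPf-> _ /newC_inj.
Qed.

(** The cells of an intercalate through [e] share with [e] its row, its column or, diagonally, its
    symbol. Hence the bases whose intercalates can reach a given cell lie on three lines. *)
Definition collinear e e' :=
  [|| e.1 == e'.1, e.2 == e'.2 | L e.1 e.2 == L e'.1 e'.2].

Lemma cI_collinear e t a : tR a != tR e.1 -> collinear e (cI e t a).
Proof.
move=> ta; rewrite /collinear /cI /=.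
case: (t.1 == _); rewrite ?eqxx //; case: (t.2 == _); rewrite ?eqxx ?orbT //.
by rewrite L_newRC // eqxx !orbT.
Qed.

(** * Bases of the prescribed entries and their loads *)

Section Placement.

Variables (l k : nat) (PT : {set triple q}).
Hypothesis plsPT : pls PT.
Hypothesis loadPT : line_load PT l.
Hypothesis loadY : forall r, #|[set p in PT | L r p.1.2 == p.2]| <= k.
Hypothesis loadX : forall c, #|[set p in PT | L p.1.1 c == p.2]| <= k.
Hypothesis loadA : forall s, #|[set p in PT | L p.1.1 p.1.2 == s]| <= k.

Definition Pu := [set p in PT | L p.1.1 p.1.2 != p.2].
(** Entries that [L] already satisfies are included. Their three bases coincide with their cell, so
    keeping the switches away from [Ball] leaves them intact. *)
Definition Ball := \bigcup_(p in PT) bases p.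
Definition V0 := \bigcup_(p in Pu) bases p.

Lemma PuP p : p \in Pu -> p \in PT.
Proof. by rewrite inE => /andP[]. Qed.

Lemma V0_Ball : V0 \subset Ball.
Proof.
by apply/bigcupsP => p pu; apply: (bigcup_sup p (PuP pu)).
Qed.

Lemma basesP p e : reflect [\/ e = bA p, e = bX p | e = bY p] (e \in bases p).
Proof.
rewrite !inE -orbA; apply: (iffP or3P) => -[] /eqP;
  by [constructor 1|constructor 2|constructor 3].
Qed.

Lemma bases_neq p : p \in Pu -> [/\ bA p != bX p, bA p != bY p & bX p != bY p].
Proof.
rewrite inE => /andP[_ ne]; split; apply: contraNneq ne.
- by case: p => [[r c] s] /= [] {1}->; rewrite colofK.
- by case: p => [[r c] s] /= [] {1}->; rewrite rowofK.
by case: p => [[r c] s] /= [] _ <-; rewrite colofK.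
Qed.

Lemma bA_inj : {in PT &, injective bA}.
Proof. by case: plsPT => h _ _ p p' pP pP'; rewrite /bA => e; apply: h; rewrite ?e. Qed.

Lemma bX_inj : {in PT &, injective bX}.
Proof.
case: plsPT => _ h _ p p' pP pP' [e1 e2]; apply: h => //.
by have := colofK latL p.1.1 p.2; rewrite e2 e1 colofK.
Qed.

Lemma bY_inj : {in PT &, injective bY}.
Proof.
case: plsPT => _ _ h p p' pP pP' [e1 e2]; apply: h => //.
by have := rowofK latL p.1.2 p.2; rewrite e1 e2 rowofK.
Qed.

Lemma card_fiber_le1 (b : triple q -> cell q) e : {in PT &, injective b} ->
  #|[set p in PT | b p == e]| <= 1.
Proof.
move=> bI; apply/card_le1P => p; rewrite inE => /andP[pP /eqP bp] p'.
rewrite !inE; apply/andP/eqP => [[pP' /eqP bp']|->]; last by rewrite pP bp.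
by apply: bI => //; rewrite bp.
Qed.

Lemma card_roles e : #|[set p in PT | e \in bases p]| <= 3.
Proof.
have -> : [set p in PT | e \in bases p] = [set p in PT | bA p == e]
    :|: [set p in PT | bX p == e] :|: [set p in PT | bY p == e].
  apply/setP => p; rewrite !inE ![e == _]eq_sym.
  by case: (p \in PT).
apply: leq_trans (leq_card_setU _ _) _.
rewrite -[3]/(1 + 1 + 1) leq_add ?(card_fiber_le1 _ bY_inj) //.
apply: leq_trans (leq_card_setU _ _) _.
by rewrite leq_add ?(card_fiber_le1 _ bX_inj) ?(card_fiber_le1 _ bA_inj).
Qed.

Lemma card_Ball : #|Ball| <= 3 * #|PT|.
Proof.
apply: leq_trans (card_bigcup_leq _ _) _; rewrite mulnC -sum_nat_const.
apply: leq_sum => p _; rewrite /bases.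
apply: leq_trans (leq_card_setU _ _) _; rewrite cards1 addn1 ltnS.
by rewrite cards2; case: (_ != _).
Qed.

Lemma card_Ball_sub (Z : pred (cell q)) :
  #|[set e in Ball | Z e]| <= #|[set p in PT | Z (bA p)]| +
    #|[set p in PT | Z (bX p)]| + #|[set p in PT | Z (bY p)]|.
Proof.
apply: leq_trans (_ : #|bA @: [set p in PT | Z (bA p)] :|:
   bX @: [set p in PT | Z (bX p)] :|: bY @: [set p in PT | Z (bY p)]| <= _).
  apply/subset_leq_card/subsetP => e; rewrite inE => /andP[/bigcupP[p pP]].
  by case/basesP => -> Zp; rewrite !in_setU; apply/orP;
    [left; apply/orP; left|left; apply/orP; right|right]; apply/imsetP;
    exists p => //; rewrite inE pP.
apply: leq_trans (leq_card_setU _ _) _; apply: leq_add; last exact: leq_imset_card.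
apply: leq_trans (leq_card_setU _ _) _.
by apply: leq_add; apply: leq_imset_card.
Qed.

Notation b := (l.*2 + k).

(** Two of the three bases of an entry stay in its row, whence [l] twice; the bases [bY] can
    accumulate elsewhere, and [loadY] bounds them. For columns and symbols this role falls to [bX]
    and [bA]. *)
Lemma card_Ball_row x : #|[set e in Ball | e.1 == x]| <= b.
Proof.
case: loadPT => lr _ _; apply: leq_trans (card_Ball_sub _) _.
rewrite -addnn !leq_add //=; apply: leq_trans (loadY x).
apply/subset_leq_card/subsetP => p; rewrite !inE => /andP[-> /eqP <-] /=.
by rewrite rowofK.
Qed.

Lemma card_Ball_col x : #|[set e in Ball | e.2 == x]| <= b.
Proof.
case: loadPT => _ lc _; apply: leq_trans (card_Ball_sub _) _.
rewrite addnAC -addnn !leq_add //=; apply: leq_trans (loadX x).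
apply/subset_leq_card/subsetP => p; rewrite !inE => /andP[-> /eqP <-] /=.
by rewrite colofK.
Qed.

Lemma card_Ball_sym x : #|[set e in Ball | L e.1 e.2 == x]| <= b.
Proof.
case: loadPT => _ _ ls; apply: leq_trans (card_Ball_sub _) _.
rewrite -addnA addnC -addnn !leq_add //=.
  apply: leq_trans (ls x); apply/subset_leq_card/subsetP => p.
  by rewrite !inE colofK.
apply: leq_trans (ls x); apply/subset_leq_card/subsetP => p.
by rewrite !inE rowofK.
Qed.

Lemma card_Ball_collinear e : #|[set e' in Ball | collinear e' e]| <= 3 * b.
Proof.
have -> : [set e' in Ball | collinear e' e] = [set e' in Ball | e'.1 == e.1]
   :|: [set e' in Ball | e'.2 == e.2] :|: [set e' in Ball | L e'.1 e'.2 == L e.1 e.2].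
  by apply/setP => e'; rewrite !inE /collinear; case: (e' \in Ball); rewrite //= orbA.
apply: leq_trans (leq_card_setU _ _) _; rewrite mulSnr leq_add ?card_Ball_sym //.
apply: leq_trans (leq_card_setU _ _) _.
by rewrite mulSnr mul1n leq_add ?card_Ball_row ?card_Ball_col.
Qed.

Definition D e := [set a | (tR a != tR e.1) &&
  [forall t, (cI e t a == e) || (cI e t a \notin Ball)]].

Lemma D_type e a : a \in D e -> tR a != tR e.1.
Proof. by rewrite inE => /andP[]. Qed.

Lemma card_opp e : #|[set a | tR a != tR e.1]| = m.
Proof.
rewrite -(cardR (~~ tR e.1)); apply: eq_card => a; rewrite !inE.
by case: (tR a) (tR e.1) => [] [].
Qed.

Lemma card_D_le e : #|D e| <= m.
Proof.
rewrite -(card_opp e); apply/subset_leq_card/subsetP => a /D_type.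
by rewrite inE.
Qed.

(** As [a] varies, the three cells other than [e] run injectively through the row, the column and
    the symbol of [e], so each excludes at most [b] values. *)
Lemma card_D e : m <= #|D e| + 3 * b.
Proof.
rewrite -(card_opp e) -(cardsID (D e)).
have -> : [set a | tR a != tR e.1] :&: D e = D e.
  by apply/setP => a; rewrite !inE; case: (tR a != _).
rewrite leq_add2l; set O := [set a | _].
pose H t := [set a in O | (t != ctype e) && (cI e t a \in Ball)].
have HS : O :\: D e \subset H (tR e.1, ~~ tC e.2) :|: H (~~ tR e.1, tC e.2)
     :|: H (~~ tR e.1, ~~ tC e.2).
  apply/subsetP => a; rewrite inE => /andP[aD aO].
  move: aD; rewrite inE; move: (aO); rewrite inE => ta; rewrite ta /= negb_forall.
  case/existsP => t; rewrite negb_or negbK cI_neq // => /andP[te tB].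
  have : a \in H t by rewrite inE aO te tB.
  rewrite !in_setU; move: te; case: t {tB} => t1 t2; rewrite xpair_eqE.
  by case: t1 t2 (tR e.1) (tC e.2) => [] [] [] [] //= _ ->; rewrite ?orbT.
apply: leq_trans (subset_leq_card HS) _.
apply: leq_trans (leq_card_setU _ _) _; rewrite mulSnr leq_add //; last first.
  rewrite -(card_imset _ (@cI_inj e (~~ tR e.1, ~~ tC e.2) _)); last first.
    by rewrite /ctype xpair_eqE; case: (tR _).
  apply: leq_trans (card_Ball_sym (L e.1 e.2)); apply/subset_leq_card/subsetP => y.
  case/imsetP => a + ->; rewrite !inE => /and3P[ta _ aB]; rewrite aB /=.
  by rewrite /cI /= !negb_eqb_self L_newRC.
apply: leq_trans (leq_card_setU _ _) _; rewrite mulSnr mul1n leq_add //.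
  rewrite -(card_imset _ (@cI_inj e (tR e.1, ~~ tC e.2) _)); last first.
    by rewrite /ctype xpair_eqE; case: (tC _); rewrite andbF.
  apply: leq_trans (card_Ball_row e.1); apply/subset_leq_card/subsetP => y.
  by case/imsetP => a + ->; rewrite !inE => /and3P[ta _ aB]; rewrite aB /= /cI /= eqxx.
rewrite -(card_imset _ (@cI_inj e (~~ tR e.1, tC e.2) _)); last first.
  by rewrite /ctype xpair_eqE; case: (tR _).
apply: leq_trans (card_Ball_col e.2); apply/subset_leq_card/subsetP => y.
by case/imsetP => a + ->; rewrite !inE => /and3P[ta _ aB]; rewrite aB /= /cI /= eqxx.
Qed.

(** * Induced intercalates and good choices *)

Implicit Types (f g h : {ffun cell q -> 'I_q}) (S : {set cell q}).

Definition y1 f p := f (bY p).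
Definition x1 f p := newC (bX p) (f (bX p)).
Definition a1 f p := newS (bA p) (f (bA p)).

Definition hY p t := t.1 == ~~ tR (bY p).1.
Definition hX p t := t.2 == ~~ tC (bX p).2.

(* Once the intercalates at the three bases of [p] are switched, [p] can be
   inserted by a further switch provided the cell [(y1 f p, x1 f p)] holds
   [a1 f p].  The cells [cF f p t] form the intercalate whose switch achieves
   this. *)
Definition cF f p t : cell q :=
  (if hY p t then y1 f p else rowof L (x1 f p) (a1 f p),
   if hX p t then x1 f p else colof L (y1 f p) (a1 f p)).

(** The bases whose values determine the induced cell of type [t]: the corner [(y1 f p, x1 f p)] and
    its two neighbours depend on two bases each, the opposite corner on all three. *)
Definition vars p t : {set cell q} :=
  if hY p t then if hX p t then [set bX p; bY p] else [set bA p; bY p]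
  else if hX p t then [set bA p; bX p] else bases p.

Lemma vars_bases p t : vars p t \subset bases p.
Proof.
apply/subsetP => e; rewrite /vars; case: (hY p t) (hX p t) => [] [];
  rewrite !inE // => /orP[]->; by rewrite ?orbT.
Qed.

Lemma vars_base p t : p \in Pu -> [/\ bA p \in vars p t = ~~ (hY p t && hX p t),
  bX p \in vars p t = ~~ (hY p t && ~~ hX p t)
  & bY p \in vars p t = ~~ (~~ hY p t && hX p t)].
Proof.
move/bases_neq => [n1 n2 n3].
by rewrite /vars; case: (hY p t) (hX p t) => [] []; rewrite /= !inE ?eqxx
  ?(negPf n1) ?(negPf n2) ?(negPf n3) ?(eq_sym _ (bA p)) ?(eq_sym (bY p))
  ?(negPf n1) ?(negPf n2) ?(negPf n3) ?orbT.
Qed.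

Lemma cF_ext f g p t : p \in Pu -> {in vars p t, f =1 g} -> cF f p t = cF g p t.
Proof.
move=> pP fg; have [vA vX vY] := vars_base t pP.
have eA : ~~ (hY p t && hX p t) -> a1 f p = a1 g p.
  by rewrite -vA /a1 => /fg->.
have eX : ~~ (hY p t && ~~ hX p t) -> x1 f p = x1 g p.
  by rewrite -vX /x1 => /fg->.
have eY : ~~ (~~ hY p t && hX p t) -> y1 f p = y1 g p.
  by rewrite -vY /y1 => /fg->.
rewrite /cF; move: eA eX eY; case: (hY p t) (hX p t) => [] [] /= eA eX eY;
  by rewrite ?eA ?eX ?eY.
Qed.

(** The corner opposite to [(y1 f p, x1 f p)] gives two equations for the three unknowns [a1], [x1],
    [y1]; a base where [f] and [g] agree supplies the third. *)
Lemma cF_inj f g p t : p \in Pu -> (exists2 e, e \in bases p & f e = g e) ->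
  cF f p t = cF g p t -> {in vars p t, f =1 g}.
Proof.
move=> pP [e0 e0b fg0]; rewrite /cF /vars.
have iA : a1 f p = a1 g p -> f (bA p) = g (bA p) by move/newS_inj.
have iX : x1 f p = x1 g p -> f (bX p) = g (bX p) by move/newC_inj.
case: (hY p t) (hX p t) => [] [] [E1 E2].
- by move=> z; rewrite !inE => /orP[]/eqP->; rewrite ?iX.
- move: E2; rewrite -[y1 g p]E1 => /(colof_inj latL)/iA E2 z.
  by rewrite !inE => /orP[]/eqP->.
- move: E1; rewrite -[x1 g p]E2 => /(rowof_inj latL)/iA E1 z.
  by rewrite !inE => /orP[]/eqP->; rewrite ?iX.
suff [eA [eX eY]] : a1 f p = a1 g p /\ x1 f p = x1 g p /\ y1 f p = y1 g p.
  move=> z /basesP[] ->; [exact: iA|exact: iX|exact: eY].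
have fromA : a1 f p = a1 g p -> a1 f p = a1 g p /\ x1 f p = x1 g p /\ y1 f p = y1 g p.
  move=> eA; split=> //; move: E1 E2; rewrite eA.
  by move=> /(rowof_injl latL) -> /(colof_injl latL) ->.
case/basesP: e0b fg0 => -> e0E.
- by apply: fromA; rewrite /a1 e0E.
- apply: fromA; have eX : x1 f p = x1 g p by rewrite /x1 e0E.
  by apply: (rowof_inj latL (c := x1 f p)); rewrite E1 eX.
apply: fromA; have eY : y1 f p = y1 g p by rewrite /y1 e0E.
by apply: (colof_inj latL (r := y1 f p)); rewrite E2 eY.
Qed.

(** A parity argument: the type of the symbol [p.2], read off at [bX p] and at [bY p], ties the
    types of these bases together, and each choice flips the type of the symbol, column or row that
    it replaces. *)
Lemma ctype_cF f p t : p \in Pu -> {in vars p t, forall e, f e \in D e} ->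
  ctype (cF f p t) = t.
Proof.
move=> pP fD; have [vA vX vY] := vars_base t pP.
have sX : tS p.2 = tR p.1.1 (+) tC (bX p).2 by rewrite -typeL colofK.
have sY : tS p.2 = tR (bY p).1 (+) tC p.1.2 by rewrite -typeL rowofK.
have tx : bX p \in vars p t -> tC (x1 f p) = ~~ tC (bX p).2.
  by move=> /fD/D_type dX; rewrite tC_newC.
have ta : bA p \in vars p t -> tS (a1 f p) = ~~ (tR p.1.1 (+) tC p.1.2).
  move=> /fD/D_type; rewrite typeL.
  by case: (tR (f _)) (tR p.1.1) (tC _) => [] [] [].
have ty : bY p \in vars p t -> tR (y1 f p) = ~~ tR (bY p).1.
  by move=> /fD/D_type; rewrite /y1; case: (tR (f _)) (tR (bY p).1) => [] [].
have tv : bX p \in vars p t -> bA p \in vars p t ->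
    tR (rowof L (x1 f p) (a1 f p)) = tR (bY p).1.
  move=> /tx ex /ta ea; have := typeL (rowof L (x1 f p) (a1 f p)) (x1 f p).
  rewrite rowofK // ea ex; move: sX; rewrite sY.
  by case: (tR (bY p).1) (tR p.1.1) (tC p.1.2) (tC (bX p).2)
    (tR (rowof _ _ _)) => [] [] [] [] [].
have tw : bY p \in vars p t -> bA p \in vars p t ->
    tC (colof L (y1 f p) (a1 f p)) = tC (bX p).2.
  move=> /ty ey /ta ea; have := typeL (y1 f p) (colof L (y1 f p) (a1 f p)).
  rewrite colofK // ea ey; move: sX; rewrite sY.
  by case: (tR (bY p).1) (tR p.1.1) (tC p.1.2) (tC (bX p).2)
    (tC (colof _ _ _)) => [] [] [] [] [].
rewrite /ctype [LHS]surjective_pairing [RHS]surjective_pairing /cF /=.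
congr pair.
  case: (boolP (hY p t)) vA vX vY => [/eqP-> _ _ vY|n1 vA vX _] /=.
    by rewrite ty ?vY.
  by rewrite tv ?vA ?vX //; move: n1; rewrite /hY; case: (t.1) (tR (bY p).1) => [] [].
case: (boolP (hX p t)) vA vX vY => [/eqP-> _ vX _|n2 vA _ vY] /=.
  by rewrite tx ?vX ?andbF.
rewrite tw ?vA ?vY ?andbF //=.
by move: n2; rewrite /hX; case: (t.2) (tC (bX p).2) => [] [].
Qed.

(** An induced cell is constrained only when [S] contains all the bases that determine it; this
    makes the predicate depend on [f] on [S] alone and pass to subsets of [S]. *)
Definition good S f :=
  [&& [forall e in S, forall e' in S, (e != e') ==>
         [forall t, cI e t (f e) != cI e' t (f e')]],
      [forall p in Pu, forall t, (vars p t \subset S) ==> (cF f p t \notin Ball)],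
      [forall p in Pu, forall t, forall e in S, (vars p t \subset S) ==>
         (cF f p t != cI e t (f e))]
    & [forall p in Pu, forall p' in Pu, forall t, (p != p') ==>
         (vars p t :|: vars p' t \subset S) ==> (cF f p t != cF f p' t)]].

Lemma goodP S f : reflect
  [/\ forall e e' t, e \in S -> e' \in S -> e != e' ->
        cI e t (f e) != cI e' t (f e'),
      forall p t, p \in Pu -> vars p t \subset S -> cF f p t \notin Ball,
      forall p t e, p \in Pu -> e \in S -> vars p t \subset S ->
        cF f p t != cI e t (f e)
    & forall p p' t, p \in Pu -> p' \in Pu -> p != p' -> vars p t \subset S ->
        vars p' t \subset S -> cF f p t != cF f p' t] (good S f).
Proof.
apply: (iffP and4P) => [] [h1 h2 h3 h4]; split.
- move=> e e' t eS e'S ne.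
  by have /forall_inP/(_ _ e'S)/implyP/(_ ne)/forallP := forall_inP h1 e eS.
- by move=> p t pP vS; have /forallP/(_ t)/implyP/(_ vS) := forall_inP h2 p pP.
- move=> p t e pP eS vS.
  by have /forallP/(_ t)/forall_inP/(_ e eS)/implyP/(_ vS) := forall_inP h3 p pP.
- move=> p p' t pP pP' ne vS vS'.
  have /forall_inP/(_ _ pP')/forallP/(_ t)/implyP/(_ ne) := forall_inP h4 p pP.
  by rewrite subUset vS vS'.
- apply/forall_inP => e eS; apply/forall_inP => e' e'S; apply/implyP => ne.
  by apply/forallP => t; apply: h1.
- by apply/forall_inP => p pP; apply/forallP => t; apply/implyP; apply: h2.
- apply/forall_inP => p pP; apply/forallP => t; apply/forall_inP => e eS.
  by apply/implyP; apply: h3.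
apply/forall_inP => p pP; apply/forall_inP => p' pP'; apply/forallP => t.
apply/implyP => ne; apply/implyP; rewrite subUset => /andP[vS vS'].
exact: h4.
Qed.

Lemma vars_neq0 p t : vars p t != set0.
Proof.
apply/set0Pn; rewrite /vars /bases; case: (hY p t) (hX p t) => [] [];
  by [exists (bX p); rewrite !inE eqxx|exists (bA p); rewrite !inE eqxx].
Qed.

Lemma good_set0 f : good set0 f.
Proof.
have no p t : vars p t \subset set0 = false.
  by rewrite subset0 (negPf (vars_neq0 p t)).
by apply/goodP; split=> [e e' t|p t _|p t e _|p p' t _ _ _]; rewrite ?no ?inE.
Qed.

Lemma good_eq_in S f g : {in S, f =1 g} -> good S f -> good S g.
Proof.
move=> fg /goodP[h1 h2 h3 h4].
have cFE p t : p \in Pu -> vars p t \subset S -> cF g p t = cF f p t.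
  by move=> pP /subsetP vS; apply/esym/cF_ext => // u /vS/fg.
apply/goodP; split.
- by move=> e e' t eS e'S ne; rewrite -!fg ?h1.
- by move=> p t pP vS; rewrite cFE ?h2.
- by move=> p t e pP eS vS; rewrite cFE // -fg // h3.
by move=> p p' t pP pP' ne vS vS'; rewrite !cFE ?h4.
Qed.

Lemma good_subset S' S f : S' \subset S -> good S f -> good S' f.
Proof.
move=> SS /goodP[h1 h2 h3 h4]; have sub := subset_trans _ SS.
apply/goodP; split.
- by move=> e e' t eS e'S; apply: h1; apply: (subsetP SS).
- by move=> p t pP vS; apply: h2; rewrite ?sub.
- by move=> p t e pP eS vS; apply: h3; rewrite ?sub ?(subsetP SS).
by move=> p p' t pP pP' ne vS vS'; apply: h4; rewrite ?sub.
Qed.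

Lemma card_bases p : p \in Pu -> #|bases p| = 3.
Proof.
move=> /bases_neq [n1 n2 n3]; rewrite /bases setUC cardsU1 !inE cards2 n1.
by rewrite !(eq_sym (bY p)) (negPf n2) (negPf n3).
Qed.

Lemma third_base p v w : p \in Pu -> exists2 e, e \in bases p & e \notin [set v; w].
Proof.
move=> pP; have /subsetPn[e] : ~~ (bases p \subset [set v; w]); last by exists e.
apply/negP => /subset_leq_card; rewrite card_bases // cards2.
by case: (_ != _).
Qed.

Lemma card_vars_ge2 p t : p \in Pu -> 2 <= #|vars p t|.
Proof.
move=> pP; have [n1 n2 n3] := bases_neq pP; rewrite /vars.
by case: (hY p t) (hX p t) => [] []; rewrite ?cards2 ?n1 ?n2 ?n3 ?card_bases.
Qed.

(** * Reasons for a choice to fail *)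

Definition share p p' := ~~ [disjoint bases p & bases p'].

Definition other p t v := odflt v [pick w in vars p t :\ v].

Lemma otherP p t v : p \in Pu -> v \in vars p t -> other p t v \in vars p t :\ v.
Proof.
move=> pP vv; rewrite /other; case: pickP => // no.
have := card_vars_ge2 t pP; rewrite (cardsD1 v) vv.
by rewrite (eq_card0 (A := vars p t :\ v) no).
Qed.

(** Rechosen when the induced cell does not depend on [v]. There can be [4 * #|PT|] such reasons
    with [m] bad choices each, so one rechosen base would not be enough. *)
Definition pair2 p t : {set cell q} :=
  if hY p t then if hX p t then [set bX p; bY p] else [set bA p; bY p]
  else [set bA p; bX p].

Lemma pair2_vars p t : pair2 p t \subset vars p t.
Proof.
rewrite /pair2 /vars; case: (hY p t) (hX p t) => [] [] //.
by rewrite /bases subsetUl.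
Qed.

Lemma card_pair2 p t : p \in Pu -> #|pair2 p t| = 2.
Proof.
move=> /bases_neq[n1 n2 n3]; rewrite /pair2.
by case: (hY p t) (hX p t) => [] []; rewrite cards2 ?n1 ?n2 ?n3.
Qed.

(** When two entries share a base, both induced cells may move together, so the rechosen base must
    be recoverable from their collision. A base of just one of the two cells is. If there is none
    besides [v] and both cells depend on [v], they depend on the same bases, and [swap_det] applies;
    if the second does not depend on [v], the collision already forces the value at [v]. *)
Definition link v (a a' : {set cell q}) : {set cell q} :=
  if [pick u in (a :\: a') :\ v] is Some u then [set u] else
  if [pick u in (a' :\: a) :\ v] is Some u then [set u] else
  if v \in a' then if [pick u in a :\ v] is Some u then [set u] else set0
  else set0.

Lemma link_sub v a a' : link v a a' \subset (a :|: a') :\ v.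
Proof.
rewrite /link; do 2?[case: pickP => [u|_]].
- by rewrite !inE sub1set !inE => /and3P[-> _ ->].
- by rewrite !inE sub1set !inE => /and3P[-> _ ->]; rewrite orbT.
case: ifP => _; last exact: sub0set.
case: pickP => [u|_]; last exact: sub0set.
by rewrite !inE sub1set !inE => /andP[-> ->].
Qed.

Notation reason := (cell q + (triple q * (bool * bool) +
  (triple q * (bool * bool) + triple q * (bool * bool) * triple q)))%type.

Definition res v (j : reason) : {set cell q} :=
  match j with
  | inl e => [set e]
  | inr (inl (p, t)) => [set other p t v]
  | inr (inr (inl (p, t))) => pair2 p t
  | inr (inr (inr (p, t, p'))) => link v (vars p t) (vars p' t)
  end.

(** Collisions with an entry [p'] that shares no base with [p] are part of the second reason,
    because the cell of [p'] stays in place while bases of [p] are rechosen. Entries sharing a base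
    have a reason of their own. *)
Definition bad S v (j : reason) g : bool :=
  match j with
  | inl e => [&& e \in V0, e != v & [exists t, cI v t (g v) == cI e t (g e)]]
  | inr (inl (p, t)) => [&& p \in Pu, v \in vars p t, vars p t \subset v |: S &
      [|| cF g p t \in Ball, [exists e in v |: S, cF g p t == cI e t (g e)]
        | [exists p' in Pu, [&& ~~ share p p', vars p' t \subset v |: S &
             cF g p t == cF g p' t]]]]
  | inr (inr (inl (p, t))) =>
      [&& p \in Pu, v \notin vars p t & cF g p t == cI v t (g v)]
  | inr (inr (inr (p, t, p'))) => [&& p \in Pu, p' \in Pu, p != p', share p p',
      v \in vars p t & cF g p t == cF g p' t]
  end.

Lemma badP S v f : v |: S \subset V0 -> v \notin S -> good S f ->
  {in v |: S, forall u, f u \in D u} -> ~~ good (v |: S) f ->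
  exists2 j, bad S v j f & res v j \subset S.
Proof.
move=> vSV0 vS /goodP[h1 h2 h3 h4] fD.
have sub p t : vars p t \subset v |: S -> v \notin vars p t -> vars p t \subset S.
  move=> sv vn; apply/subsetP => u uv; have := subsetP sv u uv.
  by rewrite in_setU1 => /orP[/eqP E|//]; rewrite -E uv in vn.
have subO p t : p \in Pu -> vars p t \subset v |: S -> v \in vars p t ->
    [set other p t v] \subset S.
  move=> pP sv vv; have := otherP pP vv; rewrite in_setD1 => /andP[ne /(subsetP sv)].
  by rewrite in_setU1 (negPf ne) sub1set.
have J1 e t : e \in S -> cI v t (f v) == cI e t (f e) ->
    exists2 j, bad S v j f & res v j \subset S.
  move=> eS E; exists (inl e); rewrite /= ?sub1set //.
  rewrite (subsetP vSV0) ?in_setU1 ?eS ?orbT //=; apply/andP; split.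
    by apply: contraNneq vS => <-.
  by apply/existsP; exists t.
have J4 p p' t : p \in Pu -> p' \in Pu -> p != p' -> vars p t \subset v |: S ->
    vars p' t \subset v |: S -> cF f p t == cF f p' t -> v \in vars p t ->
    exists2 j, bad S v j f & res v j \subset S.
  move=> pP pP' ne sv sv' E vv; case: (boolP (share p p')) => sh.
    exists (inr (inr (inr (p, t, p')))); first by rewrite /= pP pP' ne sh vv.
    apply: subset_trans (link_sub _ _ _) _; apply/subsetP => u.
    rewrite in_setD1 in_setU => /andP[uv].
    by case/orP => [/(subsetP sv)|/(subsetP sv')]; rewrite in_setU1 (negPf uv).
  exists (inr (inl (p, t))); last exact: subO.
  rewrite /= pP vv sv /=; apply/or3P/Or33/exists_inP; exists p' => //.
  by rewrite sh sv' E.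
rewrite /good !negb_and => /or4P[].
- case/forall_inPn => e eS; case/forall_inPn => e' e'S; rewrite negb_imply.
  case/andP=> ne /forallPn[t]; rewrite negbK => E.
  move: eS e'S; rewrite !in_setU1 => /orP[/eqP Ee|eS] /orP[/eqP Ee'|e'S].
  + by rewrite Ee Ee' eqxx in ne.
  + by subst e; apply: (J1 e' t).
  + by subst e'; apply: (J1 e t); rewrite // eq_sym.
  by move: (h1 e e' t eS e'S ne); rewrite E.
- case/forall_inPn => p pP /forallPn[t]; rewrite negb_imply negbK => /andP[sv B].
  case: (boolP (v \in vars p t)) => vv.
    by exists (inr (inl (p, t))); [rewrite /= pP vv sv B|exact: subO].
  by have := h2 p t pP (sub _ _ sv vv); rewrite B.
- case/forall_inPn => p pP /forallPn[t]; case/forall_inPn => e eS.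
  rewrite negb_imply negbK => /andP[sv E].
  case: (boolP (v \in vars p t)) => vv.
    exists (inr (inl (p, t))); last exact: subO.
    rewrite /= pP vv sv; apply/or3P/Or32/exists_inP; by exists e.
  move: eS; rewrite in_setU1 => /orP[/eqP Ee|eS].
    subst e; exists (inr (inr (inl (p, t)))); first by rewrite /= pP vv E.
    exact: subset_trans (pair2_vars _ _) (sub _ _ sv vv).
  by have := h3 p t e pP eS (sub _ _ sv vv); rewrite E.
case/forall_inPn => p pP; case/forall_inPn => p' pP' /forallPn[t].
rewrite 2!negb_imply negbK subUset => /andP[ne /andP[/andP[sv sv'] E]].
case: (boolP (v \in vars p t)) => vv; first exact: (J4 p p' t).
case: (boolP (v \in vars p' t)) => vv'.
  by apply: (J4 p' p t); rewrite // eq_sym.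
by have := h4 p p' t pP pP' ne (sub _ _ sv vv) (sub _ _ sv' vv'); rewrite E.
Qed.

(** A common base in the same role would identify the entries, and so would two common bases that
    force equality in two coordinates. Only an exchange of two roles is left. *)
Lemma share_two p p' v w : p \in Pu -> p' \in Pu -> p != p' -> v != w ->
  v \in bases p -> w \in bases p -> v \in bases p' -> w \in bases p' ->
  [\/ bX p = bY p' /\ bY p = bX p', bA p = bX p' /\ bX p = bA p'
    | bA p = bY p' /\ bY p = bA p'].
Proof.
move=> /PuP pP /PuP pP' ne vw.
have [prc prs pcs] := plsPT.
have sA : bA p <> bA p' by move/(bA_inj pP pP')/eqP; rewrite (negPf ne).
have sX : bX p <> bX p' by move/(bX_inj pP pP')/eqP; rewrite (negPf ne).
have sY : bY p <> bY p' by move/(bY_inj pP pP')/eqP; rewrite (negPf ne).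
have AX : bA p = bX p' -> p.1.1 = p'.1.1 by rewrite /bA => ->.
have XA : bX p = bA p' -> p.1.1 = p'.1.1 by rewrite /bA => <-.
have AY : bA p = bY p' -> p.1.2 = p'.1.2 by rewrite /bA => ->.
have YA : bY p = bA p' -> p.1.2 = p'.1.2 by rewrite /bA => <-.
have XY : bX p = bY p' -> p.2 = p'.2.
  by move=> [e1 e2]; rewrite -(colofK latL p.1.1 p.2) e2 e1 rowofK.
have YX : bY p = bX p' -> p.2 = p'.2.
  by move=> [e1 e2]; rewrite -(rowofK latL p.1.2 p.2) e1 e2 colofK.
have N12 : p.1.1 = p'.1.1 -> p.1.2 = p'.1.2 -> False.
  by move=> e1 e2; move/eqP: ne; apply; apply: prc.
have N13 : p.1.1 = p'.1.1 -> p.2 = p'.2 -> False.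
  by move=> e1 e2; move/eqP: ne; apply; apply: prs.
have N23 : p.1.2 = p'.1.2 -> p.2 = p'.2 -> False.
  by move=> e1 e2; move/eqP: ne; apply; apply: pcs.
move=> /basesP + /basesP + /basesP + /basesP.
case=> v1 [] w1 [] v2 [] w2; rewrite v1 in v2; rewrite w1 in w2;
  by [case/eqP: vw; rewrite v1 w1 | case: (sA v2) | case: (sX v2) | case: (sY v2)
    | case: (sA w2) | case: (sX w2) | case: (sY w2)
    | constructor 1 | constructor 2 | constructor 3
    | case: N12; auto | case: N13; auto | case: N23; auto].
Qed.

Definition meets v e : {set cell q} :=
  [set x in setX (D v) (D e) | [exists t, cI v t x.1 == cI e t x.2]].

Definition weight v (j : reason) : nat :=
  match j with
  | inl e => if (e \in V0) && (e != v) then #|meets v e| else 0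
  | inr (inl (p, t)) =>
      if (p \in Pu) && (v \in vars p t) then #|Ball| + 2 * m + #|Pu| else 0
  | inr (inr (inl (p, t))) => if p \in Pu then m else 0
  | inr (inr (inr (p, t, p'))) =>
      if [&& p \in Pu, p' \in Pu, p != p', share p p' & v \in vars p t]
      then if link v (vars p t) (vars p' t) == set0 then 1 else m else 0
  end.

(** * Counting the bad choices for each reason *)

Lemma card_key_leq (X : {set {ffun cell q -> 'I_q}}) (T : finType)
    (key : {ffun cell q -> 'I_q} -> T) (K : {set T}) :
  {in X, forall g, key g \in K} -> {in X &, injective key} -> #|X| <= #|K|.
Proof.
move=> kK kI; rewrite -(card_in_imset kI); apply/subset_leq_card/subsetP => y.
by case/imsetP => g gX ->; apply: kK.
Qed.

Definition frame S v (R : {set cell q}) f : {set {ffun cell q -> 'I_q}} :=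
  [set g : {ffun cell q -> 'I_q} | [forall u in v |: S, g u \in D u] &
           [forall u in ~: (v |: R), g u == f u]].

Lemma frame_D S v R f g u : g \in frame S v R f -> u \in v |: S -> g u \in D u.
Proof. by rewrite inE => /andP[/forall_inP h _] uS; apply: h. Qed.

Lemma frame_off S v R f g h u : g \in frame S v R f -> h \in frame S v R f ->
  u \notin v |: R -> g u = h u.
Proof.
rewrite ![_ \in frame _ _ _ _]inE.
move=> /andP[_ /forall_inP hg] /andP[_ /forall_inP hh] uR.
by rewrite (eqP (hg u _)) ?(eqP (hh u _)) // in_setC.
Qed.

Lemma frame_inj S v R f g h p t : g \in frame S v R f -> h \in frame S v R f ->
  p \in Pu -> v |: R \subset vars p t -> cF g p t = cF h p t ->
  (exists2 e, e \in bases p & g e = h e) -> g = h.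
Proof.
move=> gX hX' pP sv E ex; apply/ffunP => u.
case: (boolP (u \in v |: R)) => uR; last exact: (frame_off gX hX' uR).
exact: cF_inj pP ex E u (subsetP sv u uR).
Qed.

(** Some base of [p] keeps its value, so by [cF_inj] the induced cell determines the choice. It
    remains to count its possible targets: one for each base and each independent entry, except that
    the two rechosen bases offer up to [m] targets each. *)
Lemma count_other S v p t f : v |: S \subset V0 -> other p t v \in S ->
  #|[set g in frame S v [set other p t v] f | bad S v (inr (inl (p, t))) g]| <=
    weight v (inr (inl (p, t))).
Proof.
move=> vSV0 wS; rewrite /bad /weight.
case: (boolP (p \in Pu)) => pP; last first.
  by rewrite (eq_card0 (A := [set _ in _ | _])) // => g; rewrite inE andbF.
case: (boolP (v \in vars p t)) => vv; last first.
  by rewrite (eq_card0 (A := [set _ in _ | _])) // => g; rewrite inE andbF.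
case: (boolP (vars p t \subset v |: S)) => sv; last first.
  by rewrite (eq_card0 (A := [set _ in _ | _])) // => g; rewrite inE andbF.
have := otherP pP vv; set w := other p t v; rewrite in_setD1 => /andP[wv wvars].
pose X := frame S v [set w] f.
have sw : v |: [set w] \subset vars p t by rewrite subUset !sub1set vv wvars.
have XI g h : g \in X -> h \in X -> cF g p t = cF h p t -> g = h.
  move=> gX hX' E; apply: (frame_inj gX hX' pP sw E).
  have [e eb en] := third_base v w pP; exists e => //.
  exact: (frame_off gX hX' en).
(* If the induced cell is itself a base [e], then [e] has type [t] and [cI e t (g e)] is [e]. One
   target per base thus covers hitting the base and hitting its intercalate. *)
pose tgt e g := if e \in v |: S then cI e t (g e) else e.
pose X1 e := [set g in X | cF g p t == tgt e g].
pose X2 p' := [set g in X | cF g p t == cF g p' t].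
pose P2 := [set p' in Pu | ~~ share p p'].
set Y := [set g in _ | _].
have YS : Y \subset (\bigcup_(e in Ball) X1 e) :|: (\bigcup_(p' in P2) X2 p').
  apply/subsetP => g; rewrite inE /= => /andP[gX gb].
  have tE : ctype (cF g p t) = t.
    by apply: ctype_cF => // e /(subsetP sv) eS; apply: frame_D gX eS.
  have toX1 e : e \in Ball -> cF g p t == tgt e g -> g \in
      (\bigcup_(e in Ball) X1 e) :|: (\bigcup_(p' in P2) X2 p').
    by move=> eB E; rewrite in_setU; apply/orP; left; apply/bigcupP; exists e;
      rewrite // inE gX.
  case/or3P: gb => [gB|/exists_inP[e eS E]|/exists_inP[p' pP' /and3P[sh _ E]]].
  - apply: (toX1 _ gB); rewrite /tgt; case: ifP => // _.
    have := cI_self (cF g p t) (g (cF g p t)); rewrite tE => ->; exact: eqxx.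
  - apply: (toX1 e); last by rewrite /tgt eS.
    exact: subsetP (subset_trans vSV0 V0_Ball) e eS.
  rewrite in_setU; apply/orP; right; apply/bigcupP; exists p'.
    by rewrite inE pP' sh.
  by rewrite inE gX E.
apply: leq_trans (subset_leq_card YS) _; apply: leq_trans (leq_card_setU _ _) _.
apply: leq_add.
  apply: leq_trans (card_bigcup_leq _ _) _.
  apply: leq_trans (_ : \sum_(e in Ball) (1 + (e \in [set v; w]) * m) <= _).
    apply: leq_sum => e eB.
    have inj : {in X1 e &, injective (fun g => g e)}.
      move=> g h /setIdP[gX /eqP gE] /setIdP[hX' /eqP hE] E.
      by apply: XI => //; rewrite gE hE /tgt E.
    case: (boolP (e \in [set v; w])) => evw; rewrite ?mul1n ?mul0n ?addn0.
      apply: leq_trans (_ : m <= _); last by rewrite leq_addl.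
      apply: leq_trans (card_D_le e); apply: card_key_leq inj => g.
      move=> /setIdP[gX _]; apply: frame_D gX _.
      by move: evw; rewrite !inE => /orP[]/eqP->; rewrite ?eqxx // wS orbT.
    apply: leq_trans (_ : #|[set f e]| <= _); last by rewrite cards1.
    apply: card_key_leq inj => g /setIdP[gX _]; rewrite inE.
    by move: gX; rewrite inE => /andP[_ /forall_inP]; apply; rewrite in_setC.
  rewrite big_split /= sum1_card leq_add2l -big_distrl /= leq_mul2r.
  apply/orP; right; rewrite -big_mkcondr /= sum1_card.
  apply: leq_trans (_ : #|[set v; w]| <= _); last by rewrite cards2; case: (_ != _).
  by apply/subset_leq_card/subsetP => e /andP[].
apply: leq_trans (card_bigcup_leq _ _) _.
apply: leq_trans (_ : \sum_(p' in P2) 1 <= _); last first.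
  by rewrite sum1_card; apply/subset_leq_card/subsetP => p'; rewrite inE => /andP[].
apply: leq_sum => p'; rewrite inE => /andP[pP' /negPn sh].
apply: leq_trans (_ : #|[set tt]| <= _); last by rewrite cards1.
apply: (card_key_leq (key := fun=> tt)) => [g _|g h]; first by rewrite inE.
move=> /setIdP[gX /eqP gE] /setIdP[hX' /eqP hE] _; apply: XI => //; rewrite gE hE.
apply: cF_ext => // u uv; apply: (frame_off gX hX').
apply: contraL (subsetP (vars_bases p' t) u uv) => uvw.
rewrite (disjointFr sh) //; apply: (subsetP (vars_bases p t)).
exact: subsetP sw u uvw.
Qed.

(** The value at [v] determines the common cell and thereby, through [cF_inj], the rechosen pair: a
    base of [p] outside the pair is either [v] or unchanged. *)
Lemma count_pair S v p t f :
  #|[set g in frame S v (pair2 p t) f | bad S v (inr (inr (inl (p, t)))) g]| <=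
    weight v (inr (inr (inl (p, t)))).
Proof.
rewrite /bad /weight.
case: (boolP (p \in Pu)) => pP; last first.
  by rewrite (eq_card0 (A := [set _ in _ | _])) // => g; rewrite inE andbF.
case: (boolP (v \in vars p t)) => vv.
  by rewrite (eq_card0 (A := [set _ in _ | _])) // => g; rewrite inE andbF.
apply: leq_trans (card_D_le v); apply: (card_key_leq (key := fun g => g v)).
  by move=> g /setIdP[gX _]; apply: frame_D gX (setU11 _ _).
move=> g h /setIdP[gX /= /eqP gE] /setIdP[hX' /= /eqP hE] E.
have cE : cF g p t = cF h p t by rewrite gE hE E.
have [e eb en] : exists2 e, e \in bases p & e \notin pair2 p t.
  have /subsetPn[e] : ~~ (bases p \subset pair2 p t); last by exists e.
  by apply/negP => /subset_leq_card; rewrite card_bases // card_pair2.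
have ge : g e = h e.
  case: (eqVneq e v) => [->//|ev]; apply: (frame_off gX hX').
  by rewrite in_setU1 negb_or ev.
have gh := cF_inj pP (ex_intro2 _ _ e eb ge) cE.
apply/ffunP => u; case: (boolP (u \in v |: pair2 p t)) => uR.
  move: uR; rewrite in_setU1 => /orP[/eqP->//|uR].
  exact: gh (subsetP (pair2_vars p t) u uR).
exact: (frame_off gX hX' uR).
Qed.

Lemma count_meet S v e f : v |: S \subset V0 -> e \in S ->
  #|[set g in frame S v [set e] f | bad S v (inl e) g]| <= weight v (inl e).
Proof.
move=> vSV0 eS; rewrite /bad /weight.
case: (boolP (e \in V0)) => eV; last first.
  by rewrite (eq_card0 (A := [set _ in _ | _])) // => g; rewrite inE andbF.
case: (boolP (e != v)) => ev; last first.
  by rewrite (eq_card0 (A := [set _ in _ | _])) // => g; rewrite inE andbF.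
apply: (card_key_leq (key := fun g => (g v, g e))).
  move=> g /setIdP[gX /= gb]; rewrite inE gb andbT in_setX.
  apply/andP; split; apply: (frame_D gX); rewrite ?setU11 //.
  by rewrite in_setU1 eS orbT.
move=> g h /setIdP[gX _] /setIdP[hX' _] [E1 E2].
apply/ffunP => u; case: (boolP (u \in v |: [set e])) => uR.
  by move: uR; rewrite !inE => /orP[]/eqP->.
exact: (frame_off gX hX' uR).
Qed.

(** By [share_two] the entries exchange the roles of [v] and [w]. Equality of the two cells then
    equates the row or the column obtained from [v] with the one obtained from [w]; for instance
    [y1 f p = y1 f p'] relates the values of [f] at [bY p] and at [bX p = bY p']. *)
Lemma swap_det p p' v w t f g : p \in Pu -> p' \in Pu -> p != p' ->
  vars p t = vars p' t -> v \in vars p t -> w \in vars p t -> v != w ->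
  f v = g v -> cF f p t = cF f p' t -> cF g p t = cF g p' t -> f w = g w.
Proof.
move=> pP pP' ne vE vv wv vw fg Ef Eg.
have vb := subsetP (vars_bases p t); have vb' := subsetP (vars_bases p' t).
have [n1 n2 n3] := bases_neq pP; have [n1' n2' n3'] := bases_neq pP'.
have [vA vX vY] := vars_base t pP; have [vA' vX' vY'] := vars_base t pP'.
have sA : bA p != bA p'.
  by apply: contraNneq ne => /(bA_inj (PuP pP) (PuP pP'))->.
have sX : bX p != bX p'.
  by apply: contraNneq ne => /(bX_inj (PuP pP) (PuP pP'))->.
have sY : bY p != bY p'.
  by apply: contraNneq ne => /(bY_inj (PuP pP) (PuP pP'))->.
have vv' : v \in vars p' t by rewrite -vE.
have wv' : w \in vars p' t by rewrite -vE.
have out x (y : cell q) : x \in bases p' -> bA p' != y -> bX p' != y -> bY p' != y ->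
    x != y.
  by move=> /basesP[] ->.
have [[e1 e2]|[e1 e2]|[e1 e2]] :=
  share_two pP pP' ne vw (vb v vv) (vb w wv) (vb' v vv') (vb' w wv').
- have nA : bA p \notin vars p t.
    rewrite vE; apply/negP => /vb' /out /(_ _ _ _)/eqP; apply => //.
    + by rewrite eq_sym.
    + by rewrite -e2 eq_sym.
    by rewrite -e1 eq_sym.
  have nA' : bA p' \notin vars p' t.
    rewrite -vE; apply/negP => /vb; case/basesP => /eqP.
    + by rewrite eq_sym (negPf sA).
    + by rewrite e1 (negPf n2').
    by rewrite e2 (negPf n1').
  move: nA nA'; rewrite vA vA' !negbK => /andP[hy hx] /andP[hy' hx'].
  move: Ef Eg; rewrite /cF hy hy' /y1 -e1 => -[Ef _] [Eg _].
  move: vv wv; rewrite /vars hy hx !inE => /orP[]/eqP ve /orP[]/eqP we; subst v w.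
  + by rewrite eqxx in vw.
  + by rewrite Ef fg Eg.
  + by rewrite -Ef fg -Eg.
  by rewrite eqxx in vw.
- have nY : bY p \notin vars p t.
    rewrite vE; apply/negP => /vb'; case/basesP => /eqP.
    + by rewrite -e2 eq_sym (negPf n3).
    + by rewrite -e1 eq_sym (negPf n2).
    by rewrite (negPf sY).
  have nY' : bY p' \notin vars p' t.
    rewrite -vE; apply/negP => /vb; case/basesP => /eqP.
    + by rewrite e1 eq_sym (negPf n3').
    + by rewrite e2 eq_sym (negPf n2').
    by rewrite eq_sym (negPf sY).
  move: nY nY'; rewrite vY vY' !negbK => /andP[hy hx] /andP[hy' hx'].
  move: Ef Eg; rewrite /cF hx hx' /x1 -e1 => -[_ Ef] [_ Eg].
  move: vv wv; rewrite /vars (negPf hy) hx !inE => /orP[]/eqP ve /orP[]/eqP we; subst v w.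
  + by rewrite eqxx in vw.
  + by move: Ef; rewrite fg -Eg => /newC_inj.
  + by move: Ef; rewrite fg Eg => /esym/newC_inj.
  by rewrite eqxx in vw.
have nX : bX p \notin vars p t.
  rewrite vE; apply/negP => /vb'; case/basesP => /eqP.
  + by rewrite -e2 (negPf n3).
  + by rewrite (negPf sX).
  by rewrite -e1 eq_sym (negPf n1).
have nX' : bX p' \notin vars p' t.
  rewrite -vE; apply/negP => /vb; case/basesP => /eqP.
  + by rewrite e1 (negPf n3').
  + by rewrite eq_sym (negPf sX).
  by rewrite e2 eq_sym (negPf n1').
move: nX nX'; rewrite vX vX' !negbK => /andP[hy hx] /andP[hy' hx'].
move: Ef Eg; rewrite /cF hy hy' /y1 -e1 => -[Ef _] [Eg _].
move: vv wv; rewrite /vars hy (negPf hx) !inE => /orP[]/eqP ve /orP[]/eqP we; subst v w.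
+ by rewrite eqxx in vw.
+ by rewrite Ef fg Eg.
+ by rewrite -Ef fg -Eg.
by rewrite eqxx in vw.
Qed.

(** Given the value at [v], a cell that does not depend on the rechosen base is known, hence so is
    the cell colliding with it, and [cF_inj] recovers the base. If both cells depend on it,
    [swap_det] does so. With nothing else rechosen, the cell of [p'] is fixed and determines the
    value at [v]. *)
Lemma count_link S v p t p' f : v |: S \subset V0 ->
  link v (vars p t) (vars p' t) \subset S ->
  #|[set g in frame S v (link v (vars p t) (vars p' t)) f |
       bad S v (inr (inr (inr (p, t, p')))) g]| <=
    weight v (inr (inr (inr (p, t, p')))).
Proof.
move=> vSV0 lS; rewrite /bad /weight.
set c := [&& _, _, _, _ & v \in vars p t].
case: (boolP c) => [/and5P[pP pP' ne sh vv]|nc]; last first.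
  rewrite (eq_card0 (A := [set _ in _ | _])) // => g; rewrite inE; apply/andP => -[_].
  by case/and5P=> c1 c2 c3 c4 /andP[c5 _]; move: nc; rewrite /c c1 c2 c3 c4 c5.
set R := link _ _ _ in lS *; set Y := [set g in _ | _].
have YP g : g \in Y -> g \in frame S v R f /\ cF g p t = cF g p' t.
  by move=> /setIdP[gX /and5P[_ _ _ _ /andP[_ /eqP]]].
have byv : {in Y &, injective (fun g : {ffun cell q -> 'I_q} => g v)} -> #|Y| <= m.
  move=> inj; apply: leq_trans (card_D_le v); apply: card_key_leq inj => g /YP[gX _].
  exact: frame_D gX (setU11 _ _).
have Yeq g h u : g \in Y -> h \in Y -> (R = [set u] \/ R = set0) -> g v = h v ->
    (R = [set u] -> g u = h u) -> g = h.
  move=> /YP[gX _] /YP[hX' _] RE E1 E2; apply/ffunP => x.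
  case: (boolP (x \in v |: R)) => xR; last exact: frame_off gX hX' xR.
  move: xR; rewrite in_setU1 => /orP[/eqP->//|].
  by case: RE => RE; rewrite RE inE // => /eqP->; apply: E2.
have third u : exists2 e, e \in bases p & e \notin [set v; u] := third_base v u pP.
have third' u : exists2 e, e \in bases p' & e \notin [set v; u] := third_base v u pP'.
have offE u g h e : g \in Y -> h \in Y -> R \subset [set u] -> e \notin [set v; u] ->
    g e = h e.
  move=> /YP[gX _] /YP[hX' _] Ru en; apply: (frame_off gX hX').
  by apply: contra en; rewrite !inE => /orP[->//|/(subsetP Ru)]; rewrite inE orbC => ->.
have fixE u g h p0 : p0 \in Pu -> g \in Y -> h \in Y -> R \subset [set u] -> g v = h v ->
    u \notin vars p0 t -> cF g p0 t = cF h p0 t.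
  move=> p0P gY hY' Ru E un; apply: cF_ext => // e ev.
  case: (eqVneq e v) => [->//|nev]; apply: (offE u) => //.
  by rewrite !inE negb_or nev; apply: contraNneq un => <-.
have fixV u g h p0 : p0 \in Pu -> g \in Y -> h \in Y -> R \subset [set u] -> g v = h v ->
    u \in vars p0 t -> cF g p0 t = cF h p0 t -> g u = h u.
  move=> p0P gY hY' Ru E uv cE; have [e eb en] := third_base v u p0P.
  by apply: (cF_inj p0P _ cE uv); exists e => //; apply: (offE u).
have cE g : g \in Y -> cF g p t = cF g p' t by case/YP.
have ne1 u : R = [set u] -> (R == set0) = false.
  by move=> ->; apply/negP => /eqP/setP/(_ u); rewrite !inE eqxx.
have RE : R = link v (vars p t) (vars p' t) by [].
move: RE; rewrite {1}/link; case: pickP => [u|no1].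
  rewrite !inE => /and3P[uv u' u1] RE; rewrite (ne1 u) //; apply: byv => g h gY hY' E.
  apply: (Yeq g h u gY hY' (or_introl RE) E) => _.
  apply: (fixV u g h p) => //; first by rewrite RE.
  by rewrite cE // (fixE u g h p') -?cE // RE.
case: pickP => [u|no2].
  rewrite !inE => /and3P[uv u' u1] RE; rewrite (ne1 u) //; apply: byv => g h gY hY' E.
  apply: (Yeq g h u gY hY' (or_introl RE) E) => _.
  apply: (fixV u g h p') => //; first by rewrite RE.
  by rewrite -!cE // (fixE u g h p) // RE.
case: (boolP (v \in vars p' t)) => vv' => [|RE].
  case: pickP => [w wIn|no] RE; last first.
    have := card_vars_ge2 t pP; rewrite (cardsD1 v) vv.
    by rewrite (eq_card0 (A := vars p t :\ v) no).
  rewrite (ne1 w) //; apply: byv => g h gY hY' E.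
  apply: (Yeq g h w gY hY' (or_introl RE) E) => _.
  have aE : vars p t = vars p' t.
    apply/eqP; rewrite eqEsubset; apply/andP; split; apply/subsetP => x xa.
      case: (eqVneq x v) => [->//|xv]; apply: contraFT (no1 x) => xn.
      by rewrite !inE xv xn xa.
    case: (eqVneq x v) => [->//|xv]; apply: contraFT (no2 x) => xn.
    by rewrite !inE xv xn xa.
  move: wIn; rewrite in_setD1 => /andP[wv wa].
  apply: (swap_det pP pP' ne aE vv wa _ E (cE g gY) (cE h hY')).
  by rewrite eq_sym.
rewrite RE eqxx; apply: leq_trans (_ : #|[set tt]| <= _); last by rewrite cards1.
apply: (card_key_leq (key := fun=> tt)) => [g _|g h gY hY' _]; first by rewrite inE.
have off e : e != v -> g e = h e.
  move=> ev; have [[gX _] [hX' _]] := (YP g gY, YP h hY').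
  by apply: (frame_off gX hX'); rewrite RE !inE negb_or ev.
have cp : cF g p t = cF h p t.
  rewrite !cE //; apply: cF_ext => // e ev; apply: off.
  by apply: contraNneq vv' => <-.
have [e eb en] := third_base v v pP.
have E : g v = h v.
  apply: (cF_inj pP _ cp vv); exists e => //; apply: off.
  by apply: contra en; rewrite !inE => ->.
by apply/ffunP => x; case: (eqVneq x v) => [->|/off].
Qed.

(** * Weights summed over all reasons *)

Definition roles v := [set p in PT | v \in bases p].
Definition vtypes p v := [set t | v \in vars p t].
Definition mates p := [set p' in Pu | (p != p') && share p p'].

Lemma card_vtypes p v : p \in Pu -> v \in bases p -> #|vtypes p v| <= 3.
Proof.
move=> pP vb; have n2 x : (x == ~~ x) = false by case: x.
suff [t0 tv] : exists t0, v \notin vars p t0.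
  rewrite -ltnS; apply: leq_trans (_ : #|[set: bool * bool]| <= _); last first.
    by rewrite cardsT card_prod !card_bool.
  by apply/proper_card/properP; split=> //; exists t0; rewrite inE.
case/basesP: vb => ->.
- exists (~~ tR (bY p).1, ~~ tC (bX p).2); have [-> _ _] := vars_base
    (~~ tR (bY p).1, ~~ tC (bX p).2) pP.
  by rewrite /hY /hX /= !eqxx.
- exists (~~ tR (bY p).1, tC (bX p).2); have [_ -> _] := vars_base
    (~~ tR (bY p).1, tC (bX p).2) pP.
  by rewrite /hY /hX /= eqxx n2.
exists (tR (bY p).1, ~~ tC (bX p).2); have [_ _ ->] := vars_base
    (tR (bY p).1, ~~ tC (bX p).2) pP.
by rewrite /hY /hX /= eqxx n2.
Qed.

Lemma card_mates p : p \in Pu -> #|mates p| <= 6.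
Proof.
move=> pP; apply: leq_trans (_ : #|\bigcup_(e in bases p) (roles e :\ p)| <= _).
  apply/subset_leq_card/subsetP => p'; rewrite inE => /and3P[pP' ne].
  case/pred0Pn => e /andP[eb eb']; apply/bigcupP; exists e => //.
  by rewrite in_setD1 eq_sym ne inE (PuP pP').
apply: leq_trans (card_bigcup_leq _ _) _.
apply: leq_trans (_ : \sum_(e in bases p) 2 <= _); last first.
  by rewrite sum_nat_const card_bases.
apply: leq_sum => e eb; have := card_roles e; rewrite -/(roles e) (cardsD1 p).
by rewrite inE (PuP pP) eb.
Qed.

(** [A2], [A3] and [A4] index the reasons of nonzero weight of the last three kinds. The bound 9 is
    three entries with base [v] times the three types that depend on it; 54 is 9 times the six
    entries that can share a base with a given one. *)
Definition A2 v := [set x : triple q * (bool * bool) |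
  (x.1 \in Pu) && (v \in vars x.1 x.2)].
Definition A3 := [set x : triple q * (bool * bool) | x.1 \in Pu].
Definition A4 v := [set x : triple q * (bool * bool) * triple q |
  [&& x.1.1 \in Pu, x.2 \in Pu, x.1.1 != x.2, share x.1.1 x.2
    & v \in vars x.1.1 x.1.2]].

Lemma card_A2 v : #|A2 v| <= 9.
Proof.
apply: leq_trans (_ : #|\bigcup_(p in Pu :&: roles v)
   [set (p, t) | t in vtypes p v]| <= _).
  apply/subset_leq_card/subsetP => -[p t]; rewrite inE => /andP[/= pP vv].
  apply/bigcupP; exists p; last by apply: imset_f; rewrite inE.
  by rewrite in_setI pP inE PuP // (subsetP (vars_bases p t)).
apply: leq_trans (card_bigcup_leq _ _) _.
apply: leq_trans (_ : \sum_(p in Pu :&: roles v) 3 <= _).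
  apply: leq_sum => p; rewrite in_setI inE => /andP[pP]; rewrite inE => /andP[_ vb].
  by apply: leq_trans (leq_imset_card _ _) _; apply: card_vtypes; rewrite // inE.
rewrite sum_nat_const -[9]/(3 * 3) leq_mul2r; apply: leq_trans (card_roles v).
by apply/subset_leq_card/subsetIr.
Qed.

Lemma card_A3 : #|A3| <= 4 * #|PT|.
Proof.
have -> : A3 = setX Pu [set: bool * bool] by apply/setP => x; rewrite !inE andbT.
rewrite cardsX cardsT card_prod !card_bool mulnC leq_mul2l /=.
by apply/subset_leq_card/subsetP => p /PuP.
Qed.

Lemma card_A4 v : #|A4 v| <= 54.
Proof.
apply: leq_trans (_ : #|\bigcup_(x in A2 v) [set (x, p') | p' in mates x.1]| <= _).
  apply/subset_leq_card/subsetP => -[[p t] p']; rewrite inE /= => /and5P[h1 h2 h3 h4 h5].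
  apply/bigcupP; exists (p, t); first by rewrite inE h1 h5.
  by apply: imset_f; rewrite inE h2 h3 h4.
apply: leq_trans (card_bigcup_leq _ _) _.
apply: leq_trans (_ : \sum_(x in A2 v) 6 <= _).
  apply: leq_sum => x; rewrite inE => /andP[xP _].
  by apply: leq_trans (leq_imset_card _ _) _; apply: card_mates.
by rewrite sum_nat_const -[54]/(9 * 6) leq_mul2r card_A2 orbT.
Qed.

(** There are at most [m] intercalates at [v], each with three cells besides [v]. A base whose
    intercalate passes through such a cell is collinear with it, which leaves [3 * b] bases, and
    each of them does so for at most one value. *)
Lemma sum_meets v : v \in V0 ->
  \sum_e weight v (inl e) <= 9 * b * m.
Proof.
move=> vV; have vB : v \in Ball := subsetP V0_Ball v vV.
pose N := [set t | t != ctype v].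
pose W e t := [set a in D v | collinear e (cI v t a)].
apply: leq_trans (_ : \sum_(e in Ball) \sum_(t in N) #|W e t| <= _).
  rewrite [X in _ <= X]big_mkcond; apply: leq_sum => e _ /=.
  case: ifP => // /andP[eV ev]; have eB : e \in Ball := subsetP V0_Ball e eV.
  rewrite eB.
  pose Z t := [set x in setX (D v) (D e) | cI v t x.1 == cI e t x.2].
  have avoid u u' t a : u' \in Ball -> u' != u -> a \in D u -> cI u t a <> u'.
    move=> uB uu'; rewrite inE => /andP[_ /forallP/(_ t)] + E.
    by rewrite E uB orbF (negPf uu').
  apply: leq_trans (_ : #|\bigcup_(t in N) Z t| <= _).
    apply/subset_leq_card/subsetP => -[x y]; rewrite inE => /andP[xD /existsP[/= t E]].
    apply/bigcupP; exists t; last by rewrite inE xD E.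
    (* The common cell cannot have the type of [v]: it would be [v] itself, a base that the values
       in [D e] avoid. *)
    rewrite inE; apply: contraTneq E => ->; rewrite cI_self eq_sym; apply/eqP.
    move: xD; rewrite in_setX => /andP[_ yD].
    by apply: avoid yD; rewrite // eq_sym.
  apply: leq_trans (card_bigcup_leq _ _) _; apply: leq_sum => t _.
  have Zfst : {in Z t &, injective fst}.
    move=> [a x] [c y] /setIdP[]; rewrite in_setX /= => /andP[aD xD] /eqP E1.
    move=> /setIdP[]; rewrite in_setX /= => /andP[cD yD] /eqP E2 ac.
    rewrite -ac in E2 *.
    have te : t != ctype e.
      apply/eqP => tE; move: E1; rewrite tE cI_self; exact: avoid.
    by congr pair; apply: (cI_inj te); rewrite -E1.
  rewrite -(card_in_imset Zfst); apply/subset_leq_card/subsetP => _ /imsetP[[x y] + ->].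
  move=> /setIdP[]; rewrite in_setX /= => /andP[x1' x2] /eqP E.
  by rewrite inE x1' E cI_collinear // (D_type x2).
rewrite exchange_big /=; have cN : #|N| = 3.
  have -> : N = ~: [set ctype v] by apply/setP => t; rewrite !inE.
  by rewrite cardsC1 card_prod !card_bool.
apply: leq_trans (_ : \sum_(t in N) (3 * b * m) <= _); last first.
  by rewrite sum_nat_const cN; apply: eq_leq; ring.
apply: leq_sum => t _.
apply: leq_trans (_ : \sum_(a in D v) #|[set e in Ball | collinear e (cI v t a)]| <= _).
  under eq_bigr do rewrite -sum1_card big_mkcond /=.
  rewrite exchange_big /= [X in _ <= X]big_mkcond; apply: leq_sum => a _.
  case: (boolP (a \in D v)) => aD; last first.
    by rewrite big1 // => e _; rewrite inE (negPf aD).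
  rewrite -big_mkcondr sum1_card; apply/subset_leq_card/subsetP => e.
  by case/andP=> eB /setIdP[_ h]; rewrite inE eB.
apply: leq_trans (_ : \sum_(a in D v) (3 * b) <= _).
  by apply: leq_sum => a _; apply: card_Ball_collinear.
by rewrite sum_nat_const mulnC leq_mul2l card_D_le orbT.
Qed.

Lemma exists_placement : 0 < m ->
  42 * b * m + 176 * #|PT| + 288 * m <= m * m ->
  exists2 f, good V0 f & {in V0, forall v, f v \in D v}.
Proof.
(* A base supplies the default value that [exists_solution] asks for; without bases any function
   will do. *)
move=> m0 le; case: (set_0Vmem V0) => [V00|[[a0 a0'] _]].
  by exists [ffun e => e.1]; rewrite V00 ?good_set0 // => v; rewrite inE.
pose w (v : cell q) (j : reason) := (weight v j)%:R%R : rat.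
have M0 : (0 < m%:R / 2 :> rat)%R by rewrite divr_gt0 ?ltr0n.
apply: (@exists_solution rat _ _ _ a0 D good V0 bad res w (m%:R / 2)%R) => //.
- exact: good_set0.
- exact: good_eq_in.
- by move=> S' S f; apply: good_subset.
- exact: badP.
- move=> S v j f vSV0 vS rS; rewrite /w ler_nat.
  have -> : [set g : {ffun cell q -> 'I_q} | [&& [forall u in v |: S, g u \in D u],
      [forall u in ~: (v |: res v j), g u == f u] & bad S v j g]] =
    [set g in frame S v (res v j) f | bad S v j g].
    by apply/setP => g; rewrite !inE andbA.
  case: j rS => [e|[[p t]|[[p t]|[[p t] p']]]] rS.
  + by apply: count_meet; rewrite // -sub1set.
  + by apply: count_other; rewrite // -sub1set.
  + exact: count_pair.
  exact: count_link.
move=> v vV; rewrite big_sumType /= big_sumType /= big_sumType /=.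
set be := (m%:R / 2)%R in M0 *.
have mpos : (0 < m%:R :> rat)%R by rewrite ltr0n.
pose T := #|PT|.
have PuT : #|Pu| <= T by apply/subset_leq_card/subsetP => p /PuP.
have s1 : (\sum_e w v (inl e) / be ^+ #|[set e]| <= 18%:R * b%:R :> rat)%R.
  under eq_bigr do rewrite cards1 expr1.
  rewrite -mulr_suml /w -natr_sum ler_pdivrMr //.
  apply: le_trans (_ : (9 * b * m)%:R <= _)%R; first by rewrite ler_nat sum_meets.
  rewrite /be !natrM; move: (b%:R)%R (m%:R)%R => x y; lra.
have s2 : (\sum_x w v (inr (inl x)) / be ^+ #|res v (inr (inl x))|
    <= ((4 * T + 2 * m)%:R / be) *+ 9 :> rat)%R.
  apply: (sum_le_indicator (A := A2 v)) => [||[p t]]; rewrite ?card_A2 //.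
    by rewrite divr_ge0 // ltW.
  rewrite /w /= cards1 expr1.
  have -> : ((p, t) \in A2 v) = (p \in Pu) && (v \in vars p t) by rewrite [LHS]in_set.
  case: ifP => _; last by rewrite mul0r.
  rewrite ler_wpM2r ?invr_ge0 ?(ltW M0) // ler_nat.
  apply: leq_trans (leq_add (leq_add card_Ball (leqnn _)) PuT) _.
  rewrite -/T; move: (T) => x; lia.
have s3 : (\sum_x w v (inr (inr (inl x))) / be ^+ #|res v (inr (inr (inl x)))|
    <= (m%:R / be ^+ 2) *+ (4 * T) :> rat)%R.
  apply: (sum_le_indicator (A := A3)) => [||[p t]]; rewrite ?card_A3 //.
    by rewrite divr_ge0 // exprn_ge0 // ltW.
  rewrite /w /=; have -> : ((p, t) \in A3) = (p \in Pu) by rewrite [LHS]in_set.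
  case: ifP => [pP|_]; last by rewrite mul0r.
  by rewrite card_pair2.
have s4 : (\sum_x w v (inr (inr (inr x))) / be ^+ #|res v (inr (inr (inr x)))|
    <= 2 *+ 54 :> rat)%R.
  apply: (sum_le_indicator (A := A4 v)) => [||[[p t] p']]; rewrite ?card_A4 //.
  rewrite /w /=; have -> : ((p, t, p') \in A4 v) = [&& p \in Pu, p' \in Pu, p != p',
      share p p' & v \in vars p t] by rewrite [LHS]in_set.
  case: ifP => _; last by rewrite mul0r.
  case: eqP => [->|]; first by rewrite cards0 expr0 divr1.
  have [->|[u ->]] : link v (vars p t) (vars p' t) = set0 \/
      exists u, link v (vars p t) (vars p' t) = [set u].
    by rewrite /link; do 2?[case: pickP => [u _|_]]; try (by right; exists u);
      case: ifP => _; [case: pickP => [u _|_]|]; try (by right; exists u); left.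
    by [].
  rewrite cards1 expr1 /be ler_pdivrMr //; move: (m%:R)%R => x; lra.
have cD : (m%:R - 3 * b%:R <= #|D v|%:R :> rat)%R.
  by rewrite lerBlDr -natrM -natrD ler_nat card_D.
apply: le_trans (_ : be + (18%:R * b%:R + (((4 * T + 2 * m)%:R / be) *+ 9
  + ((m%:R / be ^+ 2) *+ (4 * T) + 2 *+ 54))) <= _)%R.
  by rewrite lerD2l !lerD.
apply: le_trans cD; exact: placement_budget.
Qed.

(** * Carrying out the two rounds of switches *)

Lemma in_blockI e a z : z \in block (e.1, a) (e.2, newC e a) ->
  exists t, z = cI e t a.
Proof.
have n x : (~~ x == x) = false by case: x.
case: z => x y; rewrite in_setX !inE /= => /andP[hx hy].
exists (if x == e.1 then tR e.1 else ~~ tR e.1, if y == e.2 then tC e.2 else ~~ tC e.2).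
rewrite /cI /=; congr pair.
  by case: eqP hx => [->|_] /=; rewrite ?eqxx // n => /eqP.
by case: eqP hy => [->|_] /=; rewrite ?eqxx // n => /eqP.
Qed.

Section Switching.

Variable f : {ffun cell q -> 'I_q}.
Hypothesis fgood : good V0 f.
Hypothesis fD : {in V0, forall e, f e \in D e}.

Let vf p := rowof L (x1 f p) (a1 f p).
Let wf p := colof L (y1 f p) (a1 f p).

(** The objects of the first round: [inl e] stands for the intercalate chosen at the base [e],
    [inr p] for the one induced by [p]. *)
Let R1 (o : cell q + triple q) : cell q :=
  match o with inl e => (e.1, f e) | inr p => (y1 f p, vf p) end.
Let C1 (o : cell q + triple q) : cell q :=
  match o with inl e => (e.2, newC e (f e)) | inr p => (x1 f p, wf p) end.
Let s1 := enum [set o : cell q + triple q |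
  match o with inl e => e \in V0 | inr p => p \in Pu end].

Let basesV p : p \in Pu -> bases p \subset V0.
Proof. by move=> pP; apply: (bigcup_sup p pP). Qed.

Let fT e : e \in V0 -> tR (f e) != tR e.1.
Proof. by move=> /fD/D_type. Qed.

Let fDp p t : p \in Pu -> {in vars p t, forall e, f e \in D e}.
Proof.
move=> pP e ev; apply: fD; apply: (subsetP (basesV pP)).
exact: subsetP (vars_bases p t) e ev.
Qed.

Let tcF p t : p \in Pu -> ctype (cF f p t) = t.
Proof. by move=> pP; apply: ctype_cF => //; apply: fDp. Qed.

Let in_blockF p z : z \in block (y1 f p, vf p) (x1 f p, wf p) ->
  exists t, z = cF f p t.
Proof.
have n x : (x == ~~ x) = false by case: x.
case: z => x y; rewrite in_setX !inE /= => /andP[hx hy].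
exists (if x == y1 f p then ~~ tR (bY p).1 else tR (bY p).1,
        if y == x1 f p then ~~ tC (bX p).2 else tC (bX p).2).
rewrite /cF /hY /hX; congr pair.
  by case: eqP hx => [->|_] /=; rewrite ?eqxx // n => /eqP.
by case: eqP hy => [->|_] /=; rewrite ?eqxx // n => /eqP.
Qed.

Let varsV p t : p \in Pu -> vars p t \subset V0.
Proof. by move=> pP; apply: subset_trans (basesV pP); apply: vars_bases. Qed.

Let s1_intercalate o : o \in s1 -> intercalate L (R1 o) (C1 o).
Proof.
rewrite mem_enum inE; case: o => [e /fT te|p pP].
  split=> /=; last by rewrite L_newC.
  - by apply: contraNneq te => ->.
  - by apply/eqP => E; have := tC_newC te; rewrite -E; case: (tC _).
  by rewrite L_newRC.
have := tcF (tR (bY p).1, tC (bX p).2) pP.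
have := tcF (~~ tR (bY p).1, ~~ tC (bX p).2) pP.
have n x : (x == ~~ x) = false by case: x.
rewrite /ctype /cF /hY /hX /= !eqxx !n => -[ty tx] [tv tw].
have Ew : L (y1 f p) (wf p) = a1 f p by apply: colofK.
have Ev : L (vf p) (x1 f p) = a1 f p by apply: rowofK.
split=> /=.
- by apply/eqP => E; move: ty; rewrite E /vf tv; case: (tR _).
- by apply/eqP => E; move: tx; rewrite E /wf tw; case: (tC _).
- case: richL => _ _ Q; apply/esym/Q; last by rewrite Ew Ev.
  by rewrite ty [tR (vf p)]tv; case: (tR _).
by rewrite Ew Ev.
Qed.

Let block_type o z : o \in s1 -> z \in block (R1 o) (C1 o) ->
  match o with inl e => z = cI e (ctype z) (f e) | inr p => z = cF f p (ctype z) end.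
Proof.
rewrite mem_enum inE; case: o => [e eV /in_blockI[t ->]|p pP /in_blockF[t ->]].
  by rewrite ctype_cI ?fT.
by rewrite tcF.
Qed.

Let s1_disjoint : {in s1 &, forall o o', o != o' ->
  [disjoint block (R1 o) (C1 o) & block (R1 o') (C1 o')]}.
Proof.
move=> o o' os os' ne; apply/pred0Pn => -[z /andP[/= go go']].
have := block_type os' go'; have := block_type os go.
have [h1 _ h3 h4] := goodP _ _ fgood.
move: os os' ne; rewrite !mem_enum !inE {go go'}.
case: o o' => [e|p] [e'|p'] os os' ne E E'.
- have := h1 e e' (ctype z) os os' ne; by rewrite -E -E' eqxx.
- by have := h3 p' (ctype z) e os' os (varsV _ os'); rewrite -E -E' eqxx.
- by have := h3 p (ctype z) e' os os' (varsV _ os); rewrite -E -E' eqxx.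
by have := h4 p p' (ctype z) os os' ne (varsV _ os) (varsV _ os'); rewrite -E -E' eqxx.
Qed.

Let same_object o o' z : o \in s1 -> o' \in s1 -> z \in block (R1 o) (C1 o) ->
  z \in block (R1 o') (C1 o') -> o = o'.
Proof.
move=> os os' go go'; apply/eqP; apply/negPn/negP => ne.
by rewrite (disjointFr (s1_disjoint os os' ne) go) in go'.
Qed.

(** The cell that the intercalate at a base contributes to the last switch: the base itself for
    [bA], its neighbour in the row for [bX], its neighbour in the column for [bY]. The position thus
    reveals the role of the base. *)
Let pos (j : option bool) e : cell q :=
  match j with
  | None => e | Some true => (e.1, newC e (f e)) | Some false => (f e, e.2)
  end.

Let base (j : option bool) p : cell q :=
  match j with None => bA p | Some true => bX p | Some false => bY p end.

Let sI e : e \in V0 -> inl e \in s1.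
Proof. by move=> eV; rewrite mem_enum inE. Qed.

Let sF p : p \in Pu -> inr p \in s1.
Proof. by move=> pP; rewrite mem_enum inE. Qed.

Let baseV j p : p \in Pu -> base j p \in V0.
Proof.
move=> pP; apply: (subsetP (basesV pP)); apply/basesP.
by case: j => [[]|]; [constructor 2|constructor 3|constructor 1].
Qed.

Let pos_block j e : pos j e \in block (R1 (inl e)) (C1 (inl e)).
Proof. by case: e j => x y [[]|] /=; rewrite in_setX !inE !eqxx ?orbT. Qed.

Let pos_inj j j' e e' : e \in V0 -> e' \in V0 -> pos j e = pos j' e' ->
  j = j' /\ e = e'.
Proof.
move=> eV eV' E; have [Ee] : inl e = inl e' :> cell q + triple q.
  apply: (same_object (sI eV) (sI eV') (pos_block j e)).
  by rewrite E pos_block.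
subst e'; split=> //.
have neC : e.2 <> newC e (f e).
  by move=> E'; have := tC_newC (fT eV); rewrite -E'; case: (tC _).
have neR : e.1 <> f e by move=> E'; have := fT eV; rewrite -E' eqxx.
move: E; rewrite /pos; case: e neC neR {eV eV'} => x y /= neC neR.
case: j j' => [[]|] [[]|] // E; have /= E1 := congr1 fst E; have /= E2 := congr1 snd E;
  by [case: (neR E1) | case: (neR (esym E1)) | case: (neC E2) | case: (neC (esym E2))].
Qed.

(** The last switch for [p] takes one cell from each of its three chosen intercalates and one from
    the induced one. As all of these are disjoint and positions reveal roles, the last switches of
    different entries are disjoint too. *)
Lemma completion_of_placement :
  exists L', latin L' /\ {in PT, forall p, L' p.1.1 p.1.2 = p.2}.
Proof.
have us1 : uniq s1 := enum_uniq _.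
have [L1 [latL1 sw1 same1]] := switch_disjoint latL us1 s1_intercalate s1_disjoint.
pose R2 p : cell q := (p.1.1, y1 f p).
pose C2 p : cell q := (p.1.2, x1 f p).
have corner p z : p \in Pu -> z \in block (R2 p) (C2 p) ->
    (exists j, z = pos j (base j p)) \/ z \in block (R1 (inr p)) (C1 (inr p)).
  move=> pP; case: z => x y; rewrite in_setX !inE /=.
  case/andP=> /orP[]/eqP-> /orP[]/eqP->.
  - by left; exists None; rewrite /= /bA; case: (p.1).
  - by left; exists (Some true).
  - by left; exists (Some false).
  by right; rewrite !eqxx.
have L1A p : p \in Pu -> L1 p.1.1 p.1.2 = a1 f p.
  by move=> pP; have [E _ _ _] := sw1 _ (sI (baseV None pP)); rewrite [LHS]E; exact: (L_newC (bA p)).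
have L1X p : p \in Pu -> L1 p.1.1 (x1 f p) = p.2.
  by move=> pP; have [_ E _ _] := sw1 _ (sI (baseV (Some true) pP)); rewrite [LHS]E /= colofK.
have L1Y p : p \in Pu -> L1 (y1 f p) p.1.2 = p.2.
  move=> pP; have [_ _ E _] := sw1 _ (sI (baseV (Some false) pP)); rewrite [LHS]E /=.
  by rewrite L_newRC ?rowofK // (fT (baseV (Some false) pP)).
have L1F p : p \in Pu -> L1 (y1 f p) (x1 f p) = a1 f p.
  by move=> pP; have [E _ _ _] := sw1 _ (sF pP); rewrite [LHS]E /= colofK.
have int2 p : p \in enum Pu -> intercalate L1 (R2 p) (C2 p).
  rewrite mem_enum => pP; split=> /=; rewrite ?L1A ?L1F ?L1X ?L1Y //.
    apply/eqP => E; have [] : None = Some false /\ bA p = bY p; last by [].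
    apply: pos_inj; rewrite ?(baseV None pP) ?(baseV (Some false) pP) //=.
    by rewrite /bA; case: p pP E => [[r c] s] _ /= ->.
  apply/eqP => E; have [] : None = Some true /\ bA p = bX p; last by [].
  apply: pos_inj; rewrite ?(baseV None pP) ?(baseV (Some true) pP) //=.
  by rewrite /bA; case: p pP E => [[r c] s] _ /= {1}->.
have dis2 : {in enum Pu &, forall p p', p != p' ->
    [disjoint block (R2 p) (C2 p) & block (R2 p') (C2 p')]}.
  move=> p p'; rewrite !mem_enum => pP pP' ne; apply/pred0Pn => -[z /andP[/= gp gp']].
  have mixed p0 p0' j : p0 \in Pu -> p0' \in Pu ->
      pos j (base j p0) \in block (R1 (inr p0')) (C1 (inr p0')) -> False.
    move=> p0P p0P' /(same_object (sI (baseV j p0P)) (sF p0P') (pos_block _ _)).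
    by [].
  case: (corner p z pP gp) (corner p' z pP' gp') => [[j E]|b1] [[j' E']|b2].
  - have [jj' E2] : j = j' /\ base j p = base j' p'.
      by apply: pos_inj; rewrite ?baseV // -E -E'.
    move/eqP: ne; apply; move: E2; rewrite -jj'.
    have [pT pT'] := (PuP pP, PuP pP').
    by case: (j) => [[]|]; [exact: bX_inj|exact: bY_inj|exact: bA_inj].
  - by rewrite E in b2; apply: mixed b2.
  - by rewrite E' in b1; apply: mixed b1.
  have [] : inr p = inr p' :> cell q + triple q by apply: same_object b1 b2; apply: sF.
  by move/eqP: ne.
have [L2 [latL2 sw2 same2]] := switch_disjoint latL1 (enum_uniq Pu) int2 dis2.
exists L2; split=> // p pP; case: (boolP (p \in Pu)) => pU.
  have [E _ _ _] : switched L1 L2 (R2 p) (C2 p) by apply: sw2; rewrite mem_enum.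
  by rewrite [LHS]E /= L1X.
have Lp : L p.1.1 p.1.2 = p.2 by move: pU; rewrite inE pP negbK => /eqP.
(* The cell of a satisfied entry lies in [Ball], so a chosen or induced intercalate could contain it
   only as a base of some [p0] still to be placed, and then [p] and [p0] would agree in two
   coordinates. *)
have out o : o \in s1 -> (p.1.1, p.1.2) \notin block (R1 o) (C1 o).
  have pB : (p.1.1, p.1.2) \in Ball.
    apply/bigcupP; exists p => //; apply/basesP; constructor 1.
    by rewrite /bA; case: (p.1).
  move=> os; apply/negP => zb; have := block_type os zb; move: os zb.
  rewrite mem_enum inE; case: o => [e eV _ E|p0 p0P _ E].
    have := fD eV; rewrite inE => /andP[_ /forallP/(_ (ctype (p.1.1, p.1.2)))].
    rewrite -E pB orbF => /eqP pe; case/bigcupP: eV => p0 p0P; rewrite -pe => pb.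
    have [p0T [prc prs pcs]] := (PuP p0P, plsPT).
    suff : p = p0 by move=> pp0; move: pU; rewrite pp0 p0P.
    case/basesP: pb => E0; have /= e1 := congr1 fst E0; have /= e2 := congr1 snd E0.
    - exact: prc pP p0T e1 e2.
    - by apply: (prs p p0 pP p0T e1); rewrite -Lp e2 e1 colofK.
    by apply: (pcs p p0 pP p0T e2); rewrite -Lp e2 e1 rowofK.
  have [_ h2 _ _] := goodP _ _ fgood.
  by have := h2 p0 (ctype (p.1.1, p.1.2)) p0P (varsV _ p0P); rewrite -E pB.
rewrite same2 ?same1 // => p0; rewrite mem_enum => p0P; apply/negP.
case/(corner p0 _ p0P) => [[j E]|zb].
  by have := out _ (sI (baseV j p0P)); rewrite [X in X \notin _]E pos_block.
by have := out _ (sF p0P); rewrite zb.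
Qed.

End Switching.

Theorem rich_completion : 0 < m ->
  42 * b * m + 176 * #|PT| + 288 * m <= m * m ->
  exists L', latin L' /\ {in PT, forall p, L' p.1.1 p.1.2 = p.2}.
Proof.
move=> m0 /(exists_placement m0)[f fg fD].
exact: completion_of_placement fg fD.
Qed.

End Placement.
End Gadgets.

Definition contains q (L : 'I_q -> 'I_q -> 'I_q) (PT : {set triple q}) : Prop :=
  {in PT, forall t, L t.1.1 t.1.2 = t.2}.

Theorem even_completion m k l (PT : {set triple m.*2}) :
  0 < m -> pls PT -> line_load PT l ->
  m.*2.*2 * 'C(#|PT|, k.+1) * (m.*2 - k.+1)`! < m.*2`! ->
  42 * (l.*2 + k) * m + 176 * #|PT| + 288 * m <= m * m ->
  exists L, latin L /\ contains L PT.
Proof.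
move=> m0 plsPT loadPT iso budget.
have [L [tR [tC [tS [richL cR [lY lX lA]]]]]] := exists_rich_low_load m0 plsPT iso.
exact: (rich_completion richL cR plsPT loadPT lY lX lA m0 budget).
Qed.

(* The second relation [b1] may look at the preimages of [S] under the
   permutation: these are fixed first, and the remaining values are then
   chosen again. *)
Lemma perm_avoid_anchored q d0 d1 (S I : {set 'I_q}) (b0 : rel 'I_q)
    (b1 : ('I_q -> 'I_q) -> rel 'I_q) :
  (forall i, #|[set x | b0 i x]| <= d0) -> (forall x, #|[set i | b0 i x]| <= d0) ->
  (forall g i, #|[set x | b1 g i x]| <= d1) ->
  (forall g x, #|[set i | b1 g i x]| <= d1) ->
  (forall g h i x, {in S, g =1 h} -> b1 g i x = b1 h i x) ->
  (forall g i x, b1 g i x -> i \in I) ->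
  (forall i x, i \in I -> x \in S -> b0 i x) ->
  #|S| + 2 * (d0 + d1) < q ->
  exists p : 'S_q, forall i, ~~ b0 i (p i) /\ ~~ b1 (p^-1)%g i (p i).
Proof.
move=> r0 c0 r1 c1 ext inI excl lt.
have [|p0 _ p0P] := @perm_avoid q d0 d0 set0 1%g b0 r0 c0.
  by rewrite cards0; lia.
have {}p0P i : ~~ b0 i (p0 i) by apply: p0P; rewrite inE.
pose Fx := [set i | p0 i \in S].
have cFx : #|Fx| <= #|S|.
  rewrite -(card_imset _ (@perm_inj _ p0)); apply/subset_leq_card/subsetP => x.
  by case/imsetP => i + ->; rewrite inE.
pose b i x := b0 i x || b1 (p0^-1)%g i x.
have cardU (A B : pred 'I_q) a c : #|[set x | A x]| <= a -> #|[set x | B x]| <= c ->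
    #|[set x | A x || B x]| <= a + c.
  move=> hA hB; have -> : [set x | A x || B x] = [set x | A x] :|: [set x | B x].
    by apply/setP => x; rewrite !inE.
  by apply: leq_trans (leq_card_setU _ _) _; apply: leq_add.
have [|||p pF pP] := @perm_avoid q (d0 + d1) (d0 + d1) Fx p0 b.
- by move=> i; apply: cardU.
- by move=> x; apply: (cardU (b0^~ x) (b1 (p0^-1)%g ^~ x)).
- by lia.
exists p => i.
have same : {in S, (p^-1)%g =1 (p0^-1)%g}.
  move=> x xS; apply: (@perm_inj _ p); rewrite permKV pF ?permKV //.
  by rewrite inE permKV.
rewrite (ext _ _ i (p i) same).
case: (boolP (i \in Fx)) => iF; last first.
  by have := pP i iF; rewrite /b negb_or => /andP[].
(* On [Fx] the second relation is void: by [excl] the first choice sends no index of [I] into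
   [S]. *)
rewrite pF //; split=> //; apply/negP => /inI iI.
by have := p0P i; rewrite excl //; move: iF; rewrite inE.
Qed.

(** * Clashing entries and auxiliary entries *)

Definition clash q (t u : triple q) : bool :=
  [|| (t.1.1 == u.1.1) && (t.1.2 == u.1.2), (t.1.1 == u.1.1) && (t.2 == u.2)
    | (t.1.2 == u.1.2) && (t.2 == u.2)].

Lemma clashC q (t u : triple q) : clash t u = clash u t.
Proof. by rewrite /clash !(eq_sym u.1.1) !(eq_sym u.1.2) (eq_sym u.2). Qed.

Lemma plsP q (Q : {set triple q}) :
  pls Q <-> {in Q &, forall t u, clash t u -> t = u}.
Proof.
split=> [[h1 h2 h3] t u tQ uQ|h].
  by case/or3P => /andP[/eqP e1 /eqP e2]; [exact: h1|exact: h2|exact: h3].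
by split=> t u tQ uQ e1 e2; apply: h => //; rewrite /clash e1 e2 !eqxx ?orbT.
Qed.

Lemma plsU q (Q X : {set triple q}) : pls Q -> pls X ->
  {in Q & X, forall t u, ~~ clash t u} -> pls (Q :|: X).
Proof.
move=> /plsP hQ /plsP hX c; apply/plsP => t u; rewrite !in_setU.
case/orP=> tP /orP[]uP; try by [apply: hQ|apply: hX].
  by move=> tu; have := c t u tP uP; rewrite tu.
by rewrite clashC => tu; have := c u t uP tP; rewrite tu.
Qed.

(** The conjugates of a Latin square: rotating the coordinates lets one lemma about auxiliary rows
    also provide auxiliary columns and symbols. *)
Definition rot3 q (t : triple q) : triple q := (t.1.2, t.2, t.1.1).

Lemma rot3K q : cancel (@rot3 q) (fun t => rot3 (rot3 t)).
Proof. by move=> [[r c] s]. Qed.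

Lemma rot3_inj q : injective (@rot3 q).
Proof. exact: can_inj (@rot3K q). Qed.

Lemma clash_rot3 q (t u : triple q) : clash (rot3 t) (rot3 u) = clash t u.
Proof. by rewrite /clash /=; case: eqP; case: eqP; case: eqP. Qed.

Lemma pls_rot3 q (Q : {set triple q}) : pls (@rot3 q @: Q) <-> pls Q.
Proof.
split=> /plsP h; apply/plsP.
  move=> t u tQ uQ; rewrite -clash_rot3 => /h E; apply: (@rot3_inj q).
  by apply: E; apply: imset_f.
move=> _ _ /imsetP[t tQ ->] /imsetP[u uQ ->]; rewrite clash_rot3.
by move=> /(h _ _ tQ uQ) ->.
Qed.

Definition matching q (G : {set cell q}) : Prop :=
  {in G &, forall x y, x.1 = y.1 -> x = y} /\
  {in G &, forall x y, x.2 = y.2 -> x = y}.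

(** Think of [ka] as the content of a singled out row, by columns. Row [ze x.1] receives its symbols
    [ka x.1] and [x.2] in exchanged places, which makes an intercalate; switching it brings [x.2] to
    column [x.1] of the singled out row. *)
Definition extras q (G : {set cell q}) (ka ze : 'S_q) : {set triple q} :=
  [set (ze x.1, x.1, x.2) | x in G] :|: [set (ze x.1, (ka^-1)%g x.2, ka x.1) | x in G].

Lemma extrasP q (G : {set cell q}) (ka ze : 'S_q) t : reflect
  (exists2 x, x \in G & t = (ze x.1, x.1, x.2) \/ t = (ze x.1, (ka^-1)%g x.2, ka x.1))
  (t \in extras G ka ze).
Proof.
rewrite in_setU; apply: (iffP orP) => [[]/imsetP[x xG ->]|[x xG []->]].
- by exists x => //; left.
- by exists x => //; right.
- by left; apply: imset_f.
by right; apply: (imset_f (fun x => (ze x.1, (ka^-1)%g x.2, ka x.1))).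
Qed.

(** A row is unsuitable for [x] if it is in [W] or already holds one of two columns or two symbols,
    whence [4 * la]. Taking [ze] to be a permutation gives different elements of [G] different
    rows. *)
Lemma exists_extras q l la (Q : {set triple q}) (G : {set cell q}) (ka : 'S_q)
    (W : {set 'I_q}) :
  pls Q -> (forall x, #|[set t in Q | t.1.2 == x]| <= la) ->
  (forall x, #|[set t in Q | t.2 == x]| <= la) ->
  matching G -> #|G| <= l -> {in G &, forall x y, ka x.1 != y.2} ->
  {in Q & G, forall t x, (t.1.2, t.2) != x /\ (t.1.2, t.2) != ((ka^-1)%g x.2, ka x.1)} ->
  #|W| + 4 * la + l < q ->
  exists ze : 'S_q, {in G, forall x, ze x.1 \notin W} /\ pls (Q :|: extras G ka ze).
Proof.
move=> plsQ colQ symQ [G1 G2] cG exc avoid lt.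
pose hit x z := [|| z \in W, [exists t in Q, (t.1.1 == z) && (t.1.2 == x.1)],
  [exists t in Q, (t.1.1 == z) && (t.1.2 == (ka^-1)%g x.2)],
  [exists t in Q, (t.1.1 == z) && (t.2 == x.2)]
  | [exists t in Q, (t.1.1 == z) && (t.2 == ka x.1)]].
pose bad c z := [exists x in G, (x.1 == c) && hit x z].
have hitle x : #|[set z | hit x z]| <= #|W| + 4 * la.
  pose A (b : pred (triple q)) := [set t.1.1 | t in [set t in Q | b t]].
  have Ale (b : pred (triple q)) : #|[set t in Q | b t]| <= la -> #|A b| <= la.
    exact: leq_trans (leq_imset_card _ _).
  have Ain (b : pred (triple q)) z : [exists t in Q, (t.1.1 == z) && b t] -> z \in A b.
    case/exists_inP => t tQ /andP[/eqP <- bt]; apply: imset_f; by rewrite inE tQ.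
  apply: leq_trans (_ : #|W :|: A (fun t => t.1.2 == x.1) :|:
     A (fun t => t.1.2 == (ka^-1)%g x.2) :|: A (fun t => t.2 == x.2) :|:
     A (fun t => t.2 == ka x.1)| <= _).
    apply/subset_leq_card/subsetP => z; rewrite inE !in_setU.
    by case/or4P => [->//|/Ain->|/Ain->|/orP[/Ain->|/Ain->]]; rewrite ?orbT.
  have -> : #|W| + 4 * la = #|W| + la + la + la + la by lia.
  by do 4![apply: leq_trans (leq_card_setU _ _) _; apply: leq_add; last exact: Ale].
have [|||ze _ zeP] := @perm_avoid q (#|W| + 4 * la) l set0 1%g bad.
- move=> c; case: (boolP [exists x in G, x.1 == c]) => [/exists_inP[x xG /eqP xc]|no].
    apply: leq_trans (hitle x); apply/subset_leq_card/subsetP => z; rewrite !inE.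
    case/exists_inP => y yG /andP[/eqP yc]; rewrite (G1 y x) //; by rewrite yc.
  rewrite (eq_card0 (A := [set _ | _])) // => z; rewrite inE.
  apply: contraNF no => /exists_inP[x xG /andP[xc _]].
  by apply/exists_inP; exists x.
- move=> z; apply: leq_trans (leq_trans (leq_imset_card fst G) cG).
  apply/subset_leq_card/subsetP => c; rewrite inE.
  by case/exists_inP => x xG /andP[/eqP <- _]; apply: imset_f.
- by rewrite cards0 add0n.
have {}zeP x : x \in G -> ~~ hit x (ze x.1).
  move=> xG; have := zeP x.1; rewrite inE => /(_ isT); apply: contra => h.
  by apply/exists_inP; exists x; rewrite // eqxx.
exists ze; split=> [x /zeP/norP[]//|].
apply: plsU => //.
  apply/plsP => t u /extrasP[x xG tE] /extrasP[y yG uE] tu.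
  case: (eqVneq x y) => [xy|xy].
    subst y; case: tE uE tu => -> [] -> //; rewrite /clash /= !eqxx /=.
      have n2 : x.2 != ka x.1 by rewrite eq_sym exc.
      have n1 : x.1 != (ka^-1)%g x.2.
        by rewrite -(inj_eq (@perm_inj _ ka)) permKV exc.
      by rewrite (negPf n1) (negPf n2).
    have n2 : ka x.1 != x.2 by rewrite exc.
    have n1 : (ka^-1)%g x.2 != x.1.
      by rewrite -(inj_eq (@perm_inj _ ka)) permKV eq_sym exc.
    by rewrite (negPf n1) (negPf n2).
  have n1 : x.1 != y.1 by apply: contraNneq xy => /(G1 x y xG yG)->.
  have n2 : x.2 != y.2 by apply: contraNneq xy => /(G2 x y xG yG)->.
  have nz : ze x.1 != ze y.1 by rewrite (inj_eq (@perm_inj _ ze)).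
  move: tu; case: tE uE => -> [] ->; rewrite /clash /= (negPf nz) /=.
  - by rewrite (negPf n1).
  - by rewrite [x.2 == _]eq_sym (negPf (exc _ _ yG xG)) andbF.
  - by rewrite (negPf (exc _ _ xG yG)) andbF.
  by rewrite (inj_eq (@perm_inj _ ka)) (negPf n1) andbF.
move=> t u tQ /extrasP[x xG uE].
have /norP[_ /norP[h1 /norP[h2 /norP[h3 h4]]]] := zeP x xG.
have [a1 a2] := avoid t x tQ xG.
have out (b : pred (triple q)) : ~~ [exists t0 in Q, (t0.1.1 == ze x.1) && b t0] ->
    (t.1.1 == ze x.1) && b t = false.
  by move=> no; apply: contraNF no => h; apply/exists_inP; exists t.
case: uE => ->; rewrite /clash /= !negb_or.
  rewrite (out _ h1 : _ && (t.1.2 == x.1) = false).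
  rewrite (out _ h3 : _ && (t.2 == x.2) = false) /=.
  by apply: contra a1 => /andP[/eqP-> /eqP->]; rewrite -surjective_pairing.
rewrite (out _ h2 : _ && (t.1.2 == (ka^-1)%g x.2) = false).
rewrite (out _ h4 : _ && (t.2 == ka x.1) = false) /=.
by apply: contra a2 => /andP[/eqP-> /eqP->].
Qed.

(** * Odd order *)

(** The classical prolongation. The transversal has symbol [ph i] in cell [(i, sg i)]; these symbols
    move to the new row and the new column, and [iy] takes their place. *)
Definition prolong q (L : 'I_q -> 'I_q -> 'I_q) (sg ph : 'S_q)
    (ir ic iy : 'I_q.+1) (r c : 'I_q.+1) : 'I_q.+1 :=
  match unlift ir r, unlift ic c with
  | Some i, Some j => if sg i == j then iy else lift iy (L i j)
  | Some i, None => lift iy (ph i)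
  | None, Some j => lift iy (ph ((sg^-1)%g j))
  | None, None => iy
  end.

Lemma latin_prolong q (L : 'I_q -> 'I_q -> 'I_q) (sg ph : 'S_q) ir ic iy :
  latin L -> (forall i, L i (sg i) = ph i) -> latin (prolong L sg ph ir ic iy).
Proof.
move=> latL LT; have nl j : iy = lift iy j -> False.
  by move/eqP; rewrite (negPf (neq_lift _ _)).
split=> [r c c'|c r r']; rewrite /prolong.
  case: (unliftP ir r) => [i _|_]; case: (unliftP ic c) => [j ->|->];
    case: (unliftP ic c') => [j' ->|->] //.
  - case: eqP => [<-|n1]; case: eqP => [<-|n2] //; try by [move/nl|move/esym/nl].
    by move/lift_inj/(latL.1 i) ->.
  - case: eqP => [_ /nl//|n1 /lift_inj]; rewrite -LT => /(latL.1 i) E.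
    by case: n1.
  - case: eqP => [_ /esym/nl//|n1 /lift_inj]; rewrite -LT => /(latL.1 i) E.
    by case: n1.
  - by move/lift_inj/perm_inj/perm_inj ->.
  - by move/esym/nl.
  by move/nl.
case: (unliftP ic c) => [j _|_]; case: (unliftP ir r) => [i ->|->];
  case: (unliftP ir r') => [i' ->|->] //.
- case: eqP => [e1|n1]; case: eqP => [e2|n2] //; try by [move/nl|move/esym/nl].
    by move=> _; rewrite (@perm_inj _ sg i i') // e1 e2.
  by move/lift_inj/(latL.2 j) ->.
- case: eqP => [_ /nl//|n1 /lift_inj]; rewrite -LT permKV => /(latL.2 j) E.
  by case: n1; rewrite E permKV.
- case: eqP => [_ /esym/nl//|n1 /lift_inj]; rewrite -LT permKV => /(latL.2 j) E.
  by case: n1; rewrite -E permKV.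
- by move/lift_inj/perm_inj ->.
- by move/esym/nl.
by move/nl.
Qed.

(** * Entries on and off the three singled out lines *)

Section OddOrder.

Variables (q l : nat) (PT : {set triple q.+1}) (ir ic iy : 'I_q.+1).
Hypothesis plsPT : pls PT.
Hypothesis loadPT : line_load PT l.
Hypothesis q_large : 14 * l + 20 < q.
Hypothesis no_rc : {in PT, forall t, t.1.1 = ir -> t.1.2 = ic -> False}.
Hypothesis no_rs : {in PT, forall t, t.1.1 = ir -> t.2 = iy -> False}.
Hypothesis no_cs : {in PT, forall t, t.1.2 = ic -> t.2 = iy -> False}.

Definition up (t : triple q) : triple q.+1 :=
  (lift ir t.1.1, lift ic t.1.2, lift iy t.2).
(** The two remaining coordinates are kept in cyclic order, (column, symbol), (symbol, row) and
    (row, column), so that [rot3] carries one case to the next. *)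
Definition up1 (x : cell q) : triple q.+1 := (ir, lift ic x.1, lift iy x.2).
Definition up2 (x : cell q) : triple q.+1 := (lift ir x.2, ic, lift iy x.1).
Definition up3 (x : cell q) : triple q.+1 := (lift ir x.1, lift ic x.2, iy).

Definition Pn := [set t | up t \in PT].
Definition G1 := [set x | up1 x \in PT].
Definition G2 := [set x | up2 x \in PT].
Definition G3 := [set x | up3 x \in PT].

Lemma PT_cases t : t \in PT ->
  [\/ exists2 u, u \in Pn & t = up u, exists2 x, x \in G1 & t = up1 x,
      exists2 x, x \in G2 & t = up2 x | exists2 x, x \in G3 & t = up3 x].
Proof.
case: t => [[r c] s] tP.
case: (unliftP ir r) tP => [i ->|->]; case: (unliftP ic c) => [j ->|->];
  case: (unliftP iy s) => [k ->|->] tP.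
- by constructor 1; exists (i, j, k); rewrite ?inE.
- by constructor 4; exists (i, j); rewrite ?inE.
- by constructor 3; exists (k, i); rewrite ?inE.
- by case: (no_cs tP).
- by constructor 2; exists (j, k); rewrite ?inE.
- by case: (no_rs tP).
- by case: (no_rc tP).
by case: (no_rs tP).
Qed.

Lemma up_inj : injective up.
Proof. move=> [[r c] s] [[r' c'] s'] [].
by do 3![move=> /(can_inj (bumpK _))/val_inj->]. Qed.
Lemma up1_inj : injective up1.
Proof. move=> [c s] [c' s'] [].
by do 2![move=> /(can_inj (bumpK _))/val_inj->]. Qed.
Lemma up2_inj : injective up2.
Proof. move=> [c s] [c' s'] [].
by do 2![move=> /(can_inj (bumpK _))/val_inj->]. Qed.
Lemma up3_inj : injective up3.
Proof. move=> [c s] [c' s'] [].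
by do 2![move=> /(can_inj (bumpK _))/val_inj->]. Qed.

Lemma clash_up t u : clash (up t) (up u) = clash t u.
Proof. by rewrite /clash /= !(inj_eq lift_inj). Qed.

Lemma pls_Pn : pls Pn.
Proof.
apply/plsP => t u; rewrite !inE => tP uP tu; apply/up_inj.
by move/plsP: plsPT; apply; rewrite // clash_up.
Qed.

Lemma matchG1 : matching G1.
Proof.
have [h1 h2 h3] := plsPT; split=> x y; rewrite !inE => xP yP E; apply/up1_inj.
  by apply: h1; rewrite //= E.
by apply: h2; rewrite //= E.
Qed.

Lemma matchG2 : matching G2.
Proof.
have [h1 h2 h3] := plsPT; split=> x y; rewrite !inE => xP yP E; apply/up2_inj.
  by apply: h3; rewrite //= E.
by apply: h1; rewrite //= E.
Qed.

Lemma matchG3 : matching G3.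
Proof.
have [h1 h2 h3] := plsPT; split=> x y; rewrite !inE => xP yP E; apply/up3_inj.
  by apply: h2; rewrite //= E.
by apply: h3; rewrite //= E.
Qed.

Lemma card_G : [/\ #|G1| <= l, #|G2| <= l & #|G3| <= l].
Proof.
have [h1 h2 h3] := loadPT; split.
- apply: leq_trans (h1 ir); rewrite -(card_imset _ up1_inj).
  apply/subset_leq_card/subsetP => t /imsetP[x + ->]; rewrite !inE /= => ->.
  exact: eqxx.
- apply: leq_trans (h2 ic); rewrite -(card_imset _ up2_inj).
  apply/subset_leq_card/subsetP => t /imsetP[x + ->]; rewrite !inE /= => ->.
  exact: eqxx.
apply: leq_trans (h3 iy); rewrite -(card_imset _ up3_inj).
apply/subset_leq_card/subsetP => t /imsetP[x + ->]; rewrite !inE /= => ->.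
exact: eqxx.
Qed.

Lemma load_Pn : line_load Pn l.
Proof.
have [h1 h2 h3] := loadPT; split=> x.
- apply: leq_trans (h1 (lift ir x)); rewrite -(card_imset _ up_inj).
  apply/subset_leq_card/subsetP => t /imsetP[y + ->].
  by rewrite !inE => /andP[-> /eqP <-] /=.
- apply: leq_trans (h2 (lift ic x)); rewrite -(card_imset _ up_inj).
  apply/subset_leq_card/subsetP => t /imsetP[y + ->].
  by rewrite !inE => /andP[-> /eqP <-] /=.
apply: leq_trans (h3 (lift iy x)); rewrite -(card_imset _ up_inj).
apply/subset_leq_card/subsetP => t /imsetP[y + ->].
by rewrite !inE => /andP[-> /eqP <-] /=.
Qed.

(** The content of the singled out row of the prolonged square, from columns to symbols. Its cyclic
    analogues are [ph^-1], from symbols to rows, and [sg], from rows to columns. *)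
Definition kap1 (sg ph : 'S_q) : 'S_q := (sg^-1 * ph)%g.

(** * Choice of the transversal *)

Definition rel2 (f g : triple q -> 'I_q) : rel 'I_q :=
  fun x y => [exists t in Pn, (f t == x) && (g t == y)].

Lemma card_rel2r f g x : #|[set t in Pn | f t == x]| <= l ->
  #|[set y | rel2 f g x y]| <= l.
Proof.
apply: leq_trans; apply: leq_trans (leq_imset_card g _).
apply/subset_leq_card/subsetP => y; rewrite inE => /exists_inP[t tY /andP[ft /eqP <-]].
by apply: imset_f; rewrite inE tY.
Qed.

Lemma card_rel2l f g y : #|[set t in Pn | g t == y]| <= l ->
  #|[set x | rel2 f g x y]| <= l.
Proof.
apply: leq_trans; apply: leq_trans (leq_imset_card f _).
apply/subset_leq_card/subsetP => x; rewrite inE => /exists_inP[t tY /andP[/eqP <- gt]].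
by apply: imset_f; rewrite inE tY.
Qed.

Definition dom1 (G : {set cell q}) : {set 'I_q} := [set x.1 | x in G].
Definition dom2 (G : {set cell q}) : {set 'I_q} := [set x.2 | x in G].

(* The partner [x.2] of [i = x.1] in [G] determines, through [g], a line; the
   values forbidden at [i] are those in relation with this line. *)
Definition anchored (G : {set cell q}) (e : rel 'I_q) (g : 'I_q -> 'I_q) :
    rel 'I_q :=
  fun i y => [exists x in G, (x.1 == i) && e (g x.2) y].

Lemma card_anchoredr G e g i k : matching G -> (forall r, #|[set c | e r c]| <= k) ->
  #|[set y | anchored G e g i y]| <= k.
Proof.
move=> [mG _] ek; case: (boolP [exists x in G, x.1 == i]) => [/exists_inP[x xG /eqP xi]|no].
  apply: leq_trans (ek (g x.2)); apply/subset_leq_card/subsetP => y; rewrite !inE.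
  by case/exists_inP => x' xG' /andP[/eqP x'i]; rewrite (mG x' x) // xi.
rewrite (eq_card0 (A := [set _ | _])) // => y; rewrite inE.
apply: contraNF no => /exists_inP[x xG /andP[xi _]].
by apply/exists_inP; exists x.
Qed.

Lemma card_anchoredl G e g y : #|[set i | anchored G e g i y]| <= #|G|.
Proof.
apply: leq_trans (leq_imset_card fst G); apply/subset_leq_card/subsetP => i.
by rewrite inE => /exists_inP[x xG /andP[/eqP <- _]]; apply: imset_f.
Qed.

Lemma anchored_ext G e g h i y : {in dom2 G, g =1 h} ->
  anchored G e g i y = anchored G e h i y.
Proof.
move=> gh; apply: eq_existsb => x; case: (boolP (x \in G)) => //= xG.
by rewrite gh // imset_f.
Qed.

Lemma anchored_dom G e g i y : anchored G e g i y -> i \in dom1 G.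
Proof. by case/exists_inP => x xG /andP[/eqP <- _]; apply: imset_f. Qed.

Lemma card_or (A B : pred 'I_q) a c : #|[set x | A x]| <= a ->
  #|[set x | B x]| <= c -> #|[set x | A x || B x]| <= a + c.
Proof.
move=> hA hB; have -> : [set x | A x || B x] = [set x | A x] :|: [set x | B x].
  by apply/setP => x; rewrite !inE.
by apply: leq_trans (leq_card_setU _ _) _; apply: leq_add.
Qed.

Lemma card_and (A : pred 'I_q) (Z : bool) a : #|[set x | A x]| <= a ->
  #|[set x | Z && A x]| <= a.
Proof.
by case: Z => //= _; rewrite (eq_card0 (A := [set _ | _])) // => x; rewrite inE.
Qed.

(** The last three conditions keep the second auxiliary entries off the pairs present in [Pn]. They
    involve preimages under the permutation being chosen, which is what [perm_avoid_anchored]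
    allows. *)
Lemma exists_transversal : exists sg ph : 'S_q,
  [/\ {in Pn, forall t i, ~~ clash t (i, sg i, ph i)},
    [/\ {in G1 &, forall x y, kap1 sg ph x.1 != y.2},
        {in G2 &, forall x y, (ph^-1)%g x.1 != y.2}
      & {in G3 &, forall x y, sg x.1 != y.2}]
    & [/\ {in Pn & G1, forall t x,
             (t.1.2, t.2) != (((kap1 sg ph)^-1)%g x.2, kap1 sg ph x.1)},
        {in Pn & G2, forall t x, (t.2, t.1.1) != (ph x.2, (ph^-1)%g x.1)}
      & {in Pn & G3, forall t x, (t.1.1, t.1.2) != ((sg^-1)%g x.2, sg x.1)}]].
Proof.
have [lr lc ls] := load_Pn; have [cG1 cG2 cG3] := card_G.
have [m11 m12] := matchG1; have [m21 m22] := matchG2; have [m31 m32] := matchG3.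
have c1 (G : {set cell q}) k : #|G| <= k -> #|dom1 G| <= k by apply: leq_trans; apply: leq_imset_card.
have c2 (G : {set cell q}) k : #|G| <= k -> #|dom2 G| <= k by apply: leq_trans; apply: leq_imset_card.
pose prc := rel2 (fun t => t.1.1) (fun t => t.1.2).
pose prs := rel2 (fun t => t.1.1) (fun t => t.2).
pose pcs := rel2 (fun t => t.1.2) (fun t => t.2).
have prc1 r : #|[set c | prc r c]| <= l by apply: card_rel2r.
have prc2 c : #|[set r | prc r c]| <= l by apply: card_rel2l.
have prs1 r : #|[set c | prs r c]| <= l by apply: card_rel2r.
have prs2 c : #|[set r | prs r c]| <= l by apply: card_rel2l.
have pcs1 r : #|[set c | pcs r c]| <= l by apply: card_rel2r.
have pcs2 c : #|[set r | pcs r c]| <= l by apply: card_rel2l.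
have inset (Z : {set 'I_q}) : [set x | x \in Z] = Z by apply/setP => x; rewrite inE.
have [||||||||sg sgP] := @perm_avoid_anchored q (2 * l) l (dom2 G3) (dom1 G3)
    (fun i y => prc i y || ((i \in dom1 G3) && (y \in dom2 G3))) (anchored G3 prc).
- move=> i; rewrite mul2n -addnn; apply: card_or => //; apply: card_and.
  by rewrite inset c2.
- move=> y; rewrite mul2n -addnn; apply: card_or => //.
  under eq_finset do rewrite andbC.
  by apply: card_and; rewrite inset c1.
- by move=> g i; apply: card_anchoredr.
- by move=> g y; apply: leq_trans (card_anchoredl _ _ _ _) cG3.
- by move=> g h i y; apply: anchored_ext.
- by move=> g i y; apply: anchored_dom.
- by move=> i y -> ->; rewrite orbT.
- by have := c2 _ _ cG3; lia.
have mG2' : matching [set (x.2, x.1) | x in G2].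
  split=> _ _ /imsetP[x xG ->] /imsetP[y yG ->] /= E; first by rewrite (m22 x y).
  by rewrite (m21 x y).
have mG1' : matching [set ((sg^-1)%g x.1, x.2) | x in G1].
  split=> _ _ /imsetP[x xG ->] /imsetP[y yG ->] /= E; last by rewrite (m12 x y).
  by rewrite (m11 x y) //; apply: perm_inj E.
set G2' := imset _ _ in mG2'; set G1' := imset _ _ in mG1'.
have cG2' : #|G2'| <= l := leq_trans (leq_imset_card _ _) cG2.
have cG1' : #|G1'| <= l := leq_trans (leq_imset_card _ _) cG1.
pose SS := dom2 G1' :|: dom2 G2'; pose II := dom1 G1' :|: dom1 G2'.
have cSS : #|SS| <= 2 * l.
  by rewrite mul2n -addnn; apply: leq_trans (leq_card_setU _ _) _; rewrite leq_add ?c2.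
have cII : #|II| <= 2 * l.
  by rewrite mul2n -addnn; apply: leq_trans (leq_card_setU _ _) _; rewrite leq_add ?c1.
(* The most demanding choice: [2 * l + 2 * (4 * l + 2 * l)] is the [14 * l] of [q_large]. *)
have [||||||||ph phP] := @perm_avoid_anchored q (4 * l) (2 * l) SS II
    (fun i y => prs i y || pcs (sg i) y || ((i \in II) && (y \in SS)))
    (fun g i y => anchored G1' (fun i' => pcs (sg i')) g i y || anchored G2' prs g i y).
- move=> i; have -> : 4 * l = l + l + 2 * l by lia.
  by apply: card_or; [exact: card_or|apply: card_and; rewrite inset].
- move=> y; have -> : 4 * l = l + l + 2 * l by lia.
  apply: card_or; last by under eq_finset do rewrite andbC; apply: card_and; rewrite inset.
  apply: card_or => //; apply: leq_trans (pcs2 y).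
  rewrite -(card_imset _ (@perm_inj _ sg)); apply/subset_leq_card/subsetP => c.
  by case/imsetP => i + ->; rewrite !inE.
- move=> g i; rewrite mul2n -addnn; apply: card_or; exact: card_anchoredr.
- move=> g y; rewrite mul2n -addnn; apply: card_or.
    by apply: leq_trans (card_anchoredl _ _ _ _) cG1'.
  by apply: leq_trans (card_anchoredl _ _ _ _) cG2'.
- move=> g h i y gh; congr (_ || _); apply: anchored_ext => u us; apply: gh;
    by rewrite in_setU us ?orbT.
- by move=> g i y /orP[]/anchored_dom iI; rewrite in_setU iI ?orbT.
- by move=> i y -> ->; rewrite !orbT.
- by lia.
exists sg, ph.
have sgc i : ~~ prc i (sg i) by have [+ _] := sgP i; rewrite negb_or => /andP[].
have sg3 i : i \in dom1 G3 -> sg i \notin dom2 G3.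
  by move=> iI; have [+ _] := sgP i; rewrite negb_or iI => /andP[].
have phr i : ~~ prs i (ph i).
  by have [+ _] := phP i; rewrite !negb_or => /andP[/andP[]].
have phc i : ~~ pcs (sg i) (ph i).
  by have [+ _] := phP i; rewrite !negb_or => /andP[/andP[]].
have phI i : i \in II -> ph i \notin SS.
  by move=> iI; have [+ _] := phP i; rewrite !negb_or iI => /andP[].
split.
- move=> t tP i; rewrite /clash /= !negb_or; apply/and3P; split.
  + by apply: contra (sgc i) => h; apply/exists_inP; exists t.
  + by apply: contra (phr i) => h; apply/exists_inP; exists t.
  by apply: contra (phc i) => h; apply/exists_inP; exists t.
- split=> x y xG yG.
  + rewrite /kap1 permM; have : (sg^-1)%g x.1 \in II.
      rewrite in_setU; apply/orP; left; apply/imsetP.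
      by exists ((sg^-1)%g x.1, x.2) => //; apply: (imset_f (fun x => ((sg^-1)%g x.1, x.2))).
    move/phI; apply: contraNneq => ->; rewrite in_setU; apply/orP; left.
    apply/imsetP; exists ((sg^-1)%g y.1, y.2) => //.
    exact: (imset_f (fun x => ((sg^-1)%g x.1, x.2))).
  + have : y.2 \in II.
      rewrite in_setU; apply/orP; right; apply/imsetP; exists (y.2, y.1) => //.
      exact: (imset_f (fun x => (x.2, x.1))).
    move/phI; apply: contraNneq => <-; rewrite permKV in_setU; apply/orP; right.
    apply/imsetP; exists (x.2, x.1) => //; exact: (imset_f (fun x => (x.2, x.1))).
  by apply: contraNneq (sg3 _ (imset_f fst xG)) => ->; apply: imset_f.
split=> t x tP xG; apply/eqP => -[e1 e2].
- have [_] := phP ((sg^-1)%g x.1); rewrite negb_or => /andP[+ _].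
  move/negP; apply; apply/exists_inP; exists ((sg^-1)%g x.1, x.2).
    exact: (imset_f (fun x => ((sg^-1)%g x.1, x.2))).
  rewrite eqxx /=; apply/exists_inP; exists t => //.
  by rewrite e1 e2 /kap1 invMg invgK !permM !eqxx.
- have [_] := phP x.2; rewrite negb_or => /andP[_].
  move/negP; apply; apply/exists_inP; exists (x.2, x.1).
    exact: (imset_f (fun x => (x.2, x.1))).
  by rewrite eqxx /=; apply/exists_inP; exists t; rewrite // e1 e2 !eqxx.
have [_] := sgP x.1; move/negP; apply; apply/exists_inP; exists x => //.
by rewrite eqxx /=; apply/exists_inP; exists t; rewrite // e1 e2 !eqxx.
Qed.

Definition lo (ka : 'S_q) (G : {set cell q}) : {set 'I_q} :=
  dom1 G :|: [set (ka^-1)%g x.2 | x in G].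
Definition hi (ka : 'S_q) (G : {set cell q}) : {set 'I_q} :=
  dom2 G :|: [set ka x.1 | x in G].

Lemma card_lo ka (G : {set cell q}) : #|G| <= l -> #|lo ka G| <= 2 * l.
Proof.
move=> Gl; rewrite mul2n -addnn; apply: leq_trans (leq_card_setU _ _) _.
by apply: leq_add; apply: leq_trans (leq_imset_card _ _) Gl.
Qed.

Lemma card_hi ka (G : {set cell q}) : #|G| <= l -> #|hi ka G| <= 2 * l.
Proof.
move=> Gl; rewrite mul2n -addnn; apply: leq_trans (leq_card_setU _ _) _.
by apply: leq_add; apply: leq_trans (leq_imset_card _ _) Gl.
Qed.

Lemma mem_lo ka (G : {set cell q}) x : x \in G ->
  x.1 \in lo ka G /\ (ka^-1)%g x.2 \in lo ka G.
Proof.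
move=> xG; rewrite /lo !in_setU (imset_f (fun x => (ka^-1)%g x.2) xG) orbT.
by rewrite imset_f.
Qed.

Lemma mem_hi ka (G : {set cell q}) x : x \in G ->
  x.2 \in hi ka G /\ ka x.1 \in hi ka G.
Proof.
move=> xG; rewrite /hi !in_setU (imset_f (fun x => ka x.1) xG) orbT.
by rewrite imset_f.
Qed.

(** * Loads of the auxiliary entries *)

Lemma card_matching1 (G : {set cell q}) y : matching G ->
  #|[set x in G | x.1 == y]| <= 1.
Proof.
move=> [mG _]; apply/card_le1P => x /setIdP[xG /eqP xy] x'.
rewrite inE [in RHS]inE; apply/andP/eqP => [[xG' /eqP xy']|->].
  by apply: mG; rewrite // xy.
by rewrite xG xy.
Qed.

Lemma card_matching2 (G : {set cell q}) y : matching G ->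
  #|[set x in G | x.2 == y]| <= 1.
Proof.
move=> [_ mG]; apply/card_le1P => x /setIdP[xG /eqP xy] x'.
rewrite inE [in RHS]inE; apply/andP/eqP => [[xG' /eqP xy']|->].
  by apply: mG; rewrite // xy.
by rewrite xG xy.
Qed.

Lemma card_extras ka ze (G : {set cell q}) : #|extras G ka ze| <= 2 * #|G|.
Proof.
rewrite mul2n -addnn; apply: leq_trans (leq_card_setU _ _) _.
by apply: leq_add; apply: leq_imset_card.
Qed.

Lemma card_extras_on ka ze (G : {set cell q}) (pr : triple q -> 'I_q) y :
  #|[set t in extras G ka ze | pr t == y]| <=
    #|[set x in G | pr (ze x.1, x.1, x.2) == y]| +
    #|[set x in G | pr (ze x.1, (ka^-1)%g x.2, ka x.1) == y]|.
Proof.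
apply: leq_trans (_ : #|[set (ze x.1, x.1, x.2) | x in
    [set x in G | pr (ze x.1, x.1, x.2) == y]] :|:
  [set (ze x.1, (ka^-1)%g x.2, ka x.1) | x in
    [set x in G | pr (ze x.1, (ka^-1)%g x.2, ka x.1) == y]]| <= _).
  apply/subset_leq_card/subsetP => t /setIdP[/extrasP[x xG tE] ty].
  rewrite in_setU; apply/orP; case: tE ty => -> ty; [left|right].
    by apply: (imset_f (fun x => (ze x.1, x.1, x.2))); rewrite inE xG.
  by apply: (imset_f (fun x => (ze x.1, (ka^-1)%g x.2, ka x.1))); rewrite inE xG.
apply: leq_trans (leq_card_setU _ _) _.
by apply: leq_add; apply: leq_imset_card.
Qed.

Lemma card_perm_pre1 (ka : 'S_q) (G : {set cell q}) y : matching G ->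
  #|[set x in G | ka x.1 == y]| <= 1.
Proof.
move=> mG; apply: leq_trans (card_matching1 ((ka^-1)%g y) mG).
apply/subset_leq_card/subsetP => x; rewrite !inE => /andP[-> /eqP <-] /=.
by rewrite permK.
Qed.

Lemma card_perm_pre2 (ka : 'S_q) (G : {set cell q}) y : matching G ->
  #|[set x in G | ka x.2 == y]| <= 1.
Proof.
move=> mG; apply: leq_trans (card_matching2 ((ka^-1)%g y) mG).
apply/subset_leq_card/subsetP => x; rewrite !inE => /andP[-> /eqP <-] /=.
by rewrite permK.
Qed.

Section ExtraLoads.
Variables (ka ze : 'S_q) (G : {set cell q}).
Hypothesis mG : matching G.

Lemma extras_row2 y : #|[set t in extras G ka ze | t.1.1 == y]| <= 2.
Proof.
apply: leq_trans (card_extras_on _ _ _ (fun t => t.1.1) _) _.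
by rewrite -[2]/(1 + 1) leq_add //; apply: card_perm_pre1.
Qed.

Lemma extras_row0 (W : {set 'I_q}) y : {in G, forall x, ze x.1 \notin W} ->
  y \in W -> #|[set t in extras G ka ze | t.1.1 == y]| = 0.
Proof.
move=> zW yW; apply: eq_card0 => t; rewrite inE; apply/andP => -[/extrasP[x xG tE]].
move/eqP => ty; have := zW x xG; suff -> : ze x.1 = y by rewrite yW.
by case: tE ty => ->.
Qed.

Lemma extras_col y : #|[set t in extras G ka ze | t.1.2 == y]| <=
  #|[set x in G | x.1 == y]| + 1.
Proof.
apply: leq_trans (card_extras_on _ _ _ (fun t => t.1.2) _) _.
by rewrite leq_add2l; apply: card_perm_pre2.
Qed.

Lemma extras_col0 y : y \notin lo ka G ->
  #|[set t in extras G ka ze | t.1.2 == y]| = 0.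
Proof.
move=> yl; apply: eq_card0 => t; rewrite inE; apply/andP => -[/extrasP[x xG tE]].
move=> /eqP ty; move/negP: yl; apply; have [h1 h2] := mem_lo ka xG.
by case: tE ty => -> /= <-.
Qed.

Lemma extras_sym y : #|[set t in extras G ka ze | t.2 == y]| <=
  #|[set x in G | x.2 == y]| + 1.
Proof.
apply: leq_trans (card_extras_on _ _ _ (fun t => t.2) _) _.
by rewrite leq_add2l; apply: card_perm_pre1.
Qed.

Lemma extras_sym0 y : y \notin hi ka G ->
  #|[set t in extras G ka ze | t.2 == y]| = 0.
Proof.
move=> yl; apply: eq_card0 => t; rewrite inE; apply/andP => -[/extrasP[x xG tE]].
move=> /eqP ty; move/negP: yl; apply; have [h1 h2] := mem_hi ka xG.
by case: tE ty => -> /= <-.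
Qed.

Lemma lo_sep x y : {in G &, forall x y, ka x.1 != y.2} -> x \in G -> y \in G ->
  x != y -> forall a, a \in [set x.1; (ka^-1)%g x.2] ->
  a \notin [set y.1; (ka^-1)%g y.2].
Proof.
move=> E xG yG xy a; have [m1 m2] := mG.
have n1 : x.1 != y.1 by apply: contraNneq xy => /(m1 x y xG yG)->.
have n2 : x.2 != y.2 by apply: contraNneq xy => /(m2 x y xG yG)->.
rewrite !inE negb_or => /orP[]/eqP->.
  by rewrite n1 -(inj_eq (@perm_inj _ ka)) permKV E.
rewrite (inj_eq (@perm_inj _ _)) n2 andbT.
by rewrite -(inj_eq (@perm_inj _ ka)) permKV eq_sym E.
Qed.

Lemma hi_sep x y : {in G &, forall x y, ka x.1 != y.2} -> x \in G -> y \in G ->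
  x != y -> forall a, a \in [set x.2; ka x.1] -> a \notin [set y.2; ka y.1].
Proof.
move=> E xG yG xy a; have [m1 m2] := mG.
have n1 : x.1 != y.1 by apply: contraNneq xy => /(m1 x y xG yG)->.
have n2 : x.2 != y.2 by apply: contraNneq xy => /(m2 x y xG yG)->.
rewrite !inE negb_or => /orP[]/eqP->; first by rewrite n2 eq_sym E.
by rewrite E ?(inj_eq (@perm_inj _ _)).
Qed.

End ExtraLoads.

Lemma card_disjoint3 (T : finType) (A B C Z : {set T}) : A \subset Z ->
  B \subset Z -> C \subset Z -> [disjoint A & B] -> [disjoint A & C] ->
  [disjoint B & C] -> #|A| + #|B| + #|C| <= #|Z|.
Proof.
move=> AZ BZ CZ /disjoint_setI0 AB /disjoint_setI0 AC /disjoint_setI0 BC.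
rewrite -cardsUI AB cards0 addn0 -cardsUI setIUl AC BC setU0 cards0 addn0.
by apply: subset_leq_card; rewrite !subUset AZ BZ.
Qed.

(** An entry on a singled out line already counts in the load of its other two lines, and its first
    auxiliary entry takes over this share. Hence the small increase in [seed_load]. *)
Lemma row_split x : #|[set t in Pn | t.1.1 == x]| + #|[set y in G2 | y.2 == x]| +
  #|[set y in G3 | y.1 == x]| <= l.
Proof.
have [h _ _] := loadPT; apply: leq_trans (h (lift ir x)).
rewrite -(card_imset _ up_inj) -(card_imset _ up2_inj) -(card_imset _ up3_inj).
apply: card_disjoint3.
- by apply/subsetP => t /imsetP[y + ->]; rewrite !inE => /andP[-> /eqP <-] /=.
- by apply/subsetP => t /imsetP[y + ->]; rewrite !inE => /andP[-> /eqP <-] /=.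
- by apply/subsetP => t /imsetP[y + ->]; rewrite !inE => /andP[-> /eqP <-] /=.
- apply/pred0Pn => -[t /andP[/imsetP[y _ ->] /imsetP[z _ E]]].
  by have /eqP := congr1 (fun t => t.1.2) E; rewrite eq_sym (negPf (neq_lift _ _)).
- apply/pred0Pn => -[t /andP[/imsetP[y _ ->] /imsetP[z _ E]]].
  by have /eqP := congr1 (fun t => t.2) E; rewrite eq_sym (negPf (neq_lift _ _)).
apply/pred0Pn => -[t /andP[/imsetP[y _ ->] /imsetP[z _ E]]].
by have /eqP := congr1 (fun t => t.2) E; rewrite eq_sym (negPf (neq_lift _ _)).
Qed.

Lemma col_split x : #|[set t in Pn | t.1.2 == x]| + #|[set y in G1 | y.1 == x]| +
  #|[set y in G3 | y.2 == x]| <= l.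
Proof.
have [_ h _] := loadPT; apply: leq_trans (h (lift ic x)).
rewrite -(card_imset _ up_inj) -(card_imset _ up1_inj) -(card_imset _ up3_inj).
apply: card_disjoint3.
- by apply/subsetP => t /imsetP[y + ->]; rewrite !inE => /andP[-> /eqP <-] /=.
- by apply/subsetP => t /imsetP[y + ->]; rewrite !inE => /andP[-> /eqP <-] /=.
- by apply/subsetP => t /imsetP[y + ->]; rewrite !inE => /andP[-> /eqP <-] /=.
- apply/pred0Pn => -[t /andP[/imsetP[y _ ->] /imsetP[z _ E]]].
  by have /eqP := congr1 (fun t => t.1.1) E; rewrite eq_sym (negPf (neq_lift _ _)).
- apply/pred0Pn => -[t /andP[/imsetP[y _ ->] /imsetP[z _ E]]].
  by have /eqP := congr1 (fun t => t.2) E; rewrite eq_sym (negPf (neq_lift _ _)).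
apply/pred0Pn => -[t /andP[/imsetP[y _ ->] /imsetP[z _ E]]].
by have /eqP := congr1 (fun t => t.2) E; rewrite eq_sym (negPf (neq_lift _ _)).
Qed.

Lemma sym_split x : #|[set t in Pn | t.2 == x]| + #|[set y in G1 | y.2 == x]| +
  #|[set y in G2 | y.1 == x]| <= l.
Proof.
have [_ _ h] := loadPT; apply: leq_trans (h (lift iy x)).
rewrite -(card_imset _ up_inj) -(card_imset _ up1_inj) -(card_imset _ up2_inj).
apply: card_disjoint3.
- by apply/subsetP => t /imsetP[y + ->]; rewrite !inE => /andP[-> /eqP <-] /=.
- by apply/subsetP => t /imsetP[y + ->]; rewrite !inE => /andP[-> /eqP <-] /=.
- by apply/subsetP => t /imsetP[y + ->]; rewrite !inE => /andP[-> /eqP <-] /=.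
- apply/pred0Pn => -[t /andP[/imsetP[y _ ->] /imsetP[z _ E]]].
  by have /eqP := congr1 (fun t => t.1.1) E; rewrite eq_sym (negPf (neq_lift _ _)).
- apply/pred0Pn => -[t /andP[/imsetP[y _ ->] /imsetP[z _ E]]].
  by have /eqP := congr1 (fun t => t.1.2) E; rewrite eq_sym (negPf (neq_lift _ _)).
apply/pred0Pn => -[t /andP[/imsetP[y _ ->] /imsetP[z _ E]]].
by have /eqP := congr1 (fun t => t.1.2) E; rewrite eq_sym (negPf (neq_lift _ _)).
Qed.

Lemma card_split : #|Pn| + #|G1| + #|G2| + #|G3| <= #|PT|.
Proof.
rewrite -(card_imset _ up_inj) -(card_imset _ up1_inj).
rewrite -(card_imset _ up2_inj) -(card_imset _ up3_inj) -[X in _ <= X](cardsID (up @: Pn)).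
have -> : PT :&: up @: Pn = up @: Pn.
  by apply/setIidPr/subsetP => t /imsetP[u + ->]; rewrite inE.
rewrite -!addnA leq_add2l addnA; apply: card_disjoint3.
- apply/subsetP => t /imsetP[y + ->]; rewrite !inE => ->; rewrite andbT.
  apply/imsetP => -[z _ E]; have /eqP := congr1 (fun t => t.1.1) E.
  by rewrite (negPf (neq_lift _ _)).
- apply/subsetP => t /imsetP[y + ->]; rewrite !inE => ->; rewrite andbT.
  apply/imsetP => -[z _ E]; have /eqP := congr1 (fun t => t.1.2) E.
  by rewrite (negPf (neq_lift _ _)).
- apply/subsetP => t /imsetP[y + ->]; rewrite !inE => ->; rewrite andbT.
  apply/imsetP => -[z _ E]; have /eqP := congr1 (fun t => t.2) E.
  by rewrite (negPf (neq_lift _ _)).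
- apply/pred0Pn => -[t /andP[/imsetP[y _ ->] /imsetP[z _ E]]].
  by have /eqP := congr1 (fun t => t.1.1) E; rewrite (negPf (neq_lift _ _)).
- apply/pred0Pn => -[t /andP[/imsetP[y _ ->] /imsetP[z _ E]]].
  by have /eqP := congr1 (fun t => t.1.1) E; rewrite (negPf (neq_lift _ _)).
apply/pred0Pn => -[t /andP[/imsetP[y _ ->] /imsetP[z _ E]]].
by have /eqP := congr1 (fun t => t.1.2) E; rewrite (negPf (neq_lift _ _)).
Qed.

(** * The partial square completed in even order *)

Definition diag (sg ph : 'S_q) : {set triple q} := [set (i, sg i, ph i) | i : 'I_q].

Lemma diagP (sg ph : {perm 'I_q}) (t : triple q) : reflect (exists i, t = (i, sg i, ph i)) (t \in diag sg ph).
Proof.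
apply: (iffP imsetP) => [[i _ ->]|[i ->]]; first by exists i.
by exists i.
Qed.

Lemma card_fiber_inj (T : finType) (X : finType) (A : {set T}) (f : T -> X) y :
  {in A &, injective f} -> #|[set t in A | f t == y]| <= 1.
Proof.
move=> fI; apply/card_le1P => t /setIdP[tA /eqP ty] u.
rewrite inE [in RHS]inE; apply/andP/eqP => [[uA /eqP uy]|->].
  by apply: fI; rewrite // ty.
by rewrite tA ty.
Qed.

Lemma diag_pls (sg ph : 'S_q) : pls (diag sg ph).
Proof.
split=> t u /diagP[i ->] /diagP[j ->] /=; first by move=> ->.
  by move=> ->.
by move=> /perm_inj->.
Qed.

Lemma diag_load (sg ph : 'S_q) : line_load (diag sg ph) 1.
Proof.
split=> y; apply: card_fiber_inj => t u /diagP[i ->] /diagP[j ->] /=.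
- by move=> ->.
- by move=> /perm_inj->.
by move=> /perm_inj->.
Qed.

Lemma card_setU_le (T : finType) (A B : {set T}) x y :
  #|A| <= x -> #|B| <= y -> #|A :|: B| <= x + y.
Proof.
by move=> hA hB; apply: leq_trans (leq_card_setU _ _) _; apply: leq_add.
Qed.

Lemma card_setIdU (T : finType) (A B : {set T}) (b : pred T) x y :
  #|[set t in A | b t]| <= x -> #|[set t in B | b t]| <= y ->
  #|[set t in A :|: B | b t]| <= x + y.
Proof.
by move=> hA hB; rewrite setIdE setIUl -!setIdE; apply: card_setU_le.
Qed.

Lemma card_setId_imset (T U : finType) (A : {set T}) (f : T -> U) (b : pred U) :
  injective f -> #|[set u in f @: A | b u]| = #|[set t in A | b (f t)]|.
Proof.
move=> fI; rewrite -(card_imset _ fI); apply: eq_card => u; rewrite inE.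
apply/andP/imsetP => [[/imsetP[t tA ->] bt]|[t /setIdP[tA bt] ->]].
  by exists t; rewrite // inE tA.
by rewrite imset_f.
Qed.

Definition unrot (t : triple q) : triple q := rot3 (rot3 t).

Lemma unrot_inj : injective unrot.
Proof. by move=> t u /rot3_inj/rot3_inj. Qed.

Lemma unrotK : cancel unrot (@rot3 q).
Proof. by move=> [[r c] s]. Qed.

(* The seed contains the [P]-entries off the three extra lines, a transversal,
   and, for every [P]-entry in an extra line, the two entries that make an
   intercalate of the prolonged square out of it. *)
Definition seed (sg ph z1 z2 z3 : 'S_q) : {set triple q} :=
  Pn :|: diag sg ph :|: extras G1 (kap1 sg ph) z1
    :|: unrot @: extras G2 (ph^-1)%g z2 :|: @rot3 q @: extras G3 sg z3.

(** The rows met by the intercalates of the second and third groups. Auxiliary rows of the first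
    group avoid them, for disjointness and to keep the loads low; columns and symbols are treated
    alike. *)
Definition rows_used (sg ph : 'S_q) := hi (ph^-1)%g G2 :|: lo sg G3.
Definition cols_used (sg ph : 'S_q) := lo (kap1 sg ph) G1 :|: hi sg G3.
Definition syms_used (sg ph : 'S_q) := hi (kap1 sg ph) G1 :|: lo (ph^-1)%g G2.

Definition fresh (sg ph z1 z2 z3 : 'S_q) : Prop :=
  [/\ {in G1, forall x, z1 x.1 \notin rows_used sg ph},
      {in G2, forall x, z2 x.1 \notin cols_used sg ph}
    & {in G3, forall x, z3 x.1 \notin syms_used sg ph}].

Lemma Pn_G1 t x : t \in Pn -> x \in G1 -> (t.1.2, t.2) != x.
Proof.
rewrite !inE => tP xP; apply/eqP => E; have [_ _ h] := plsPT.
have /(congr1 (fun t => t.1.1)) /esym/eqP : up t = up1 x by apply: h; rewrite // -E.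
by rewrite (negPf (neq_lift _ _)).
Qed.

Lemma Pn_G2 t x : t \in Pn -> x \in G2 -> (t.2, t.1.1) != x.
Proof.
rewrite !inE => tP xP; apply/eqP => E; have [_ h _] := plsPT.
have /(congr1 (fun t => t.1.2)) /esym/eqP : up t = up2 x by apply: h; rewrite // -E.
by rewrite (negPf (neq_lift _ _)).
Qed.

Lemma Pn_G3 t x : t \in Pn -> x \in G3 -> (t.1.1, t.1.2) != x.
Proof.
rewrite !inE => tP xP; apply/eqP => E; have [h _ _] := plsPT.
have /(congr1 (fun t => t.2)) /esym/eqP : up t = up3 x by apply: h; rewrite // -E.
by rewrite (negPf (neq_lift _ _)).
Qed.

Section Seed.
Variables (sg ph : 'S_q).
Hypothesis no_clash : {in Pn, forall t i, ~~ clash t (i, sg i, ph i)}.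
Hypothesis E1 : {in G1 &, forall x y, kap1 sg ph x.1 != y.2}.
Hypothesis E2 : {in G2 &, forall x y, (ph^-1)%g x.1 != y.2}.
Hypothesis E3 : {in G3 &, forall x y, sg x.1 != y.2}.
Hypothesis p1 : {in Pn & G1, forall t x,
             (t.1.2, t.2) != (((kap1 sg ph)^-1)%g x.2, kap1 sg ph x.1)}.
Hypothesis p2 : {in Pn & G2, forall t x, (t.2, t.1.1) != (ph x.2, (ph^-1)%g x.1)}.
Hypothesis p3 : {in Pn & G3, forall t x, (t.1.1, t.1.2) != ((sg^-1)%g x.2, sg x.1)}.

Lemma kap1_sg i : kap1 sg ph (sg i) = ph i.
Proof. by rewrite /kap1 permM permK. Qed.

Lemma card_used : [/\ #|rows_used sg ph| <= 4 * l, #|cols_used sg ph| <= 4 * l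
  & #|syms_used sg ph| <= 4 * l].
Proof.
have [c1 c2 c3] := card_G; have -> : 4 * l = 2 * l + 2 * l by lia.
by split; apply: leq_trans (leq_card_setU _ _) _; apply: leq_add;
  rewrite ?card_lo ?card_hi.
Qed.

Lemma extras_load ka ze (G : {set cell q}) : matching G -> line_load (extras G ka ze) 2.
Proof.
move=> mG; split=> y; first exact: extras_row2.
  by apply: leq_trans (extras_col _ _ mG _) _; rewrite -[2]/(1 + 1) leq_add2r card_matching1.
by apply: leq_trans (extras_sym _ _ mG _) _; rewrite -[2]/(1 + 1) leq_add2r card_matching2.
Qed.

(** The groups are added in turn, rotated so that auxiliary lines become rows. At the last one the
    load has grown by 1 + 2 + 2, and [4 * l + 4 * (l + 5) + l = 9 * l + 20] must stay below [q]. *)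
Lemma exists_fresh : exists z1 z2 z3, fresh sg ph z1 z2 z3 /\ pls (seed sg ph z1 z2 z3).
Proof.
have [cG1 cG2 cG3] := card_G; have [cW1 cW2 cW3] := card_used.
have [lr lc ls] := load_Pn; have [dr dc ds] := diag_load sg ph.
pose Q0 := Pn :|: diag sg ph.
have pQ0 : pls Q0.
  apply: plsU; [exact: pls_Pn|exact: diag_pls|].
  by move=> t u tP /diagP[i ->]; apply: no_clash.
have r0 x : #|[set t in Q0 | t.1.1 == x]| <= l + 1 by apply: card_setIdU.
have c0 x : #|[set t in Q0 | t.1.2 == x]| <= l + 1 by apply: card_setIdU.
have s0 x : #|[set t in Q0 | t.2 == x]| <= l + 1 by apply: card_setIdU.
have [||z1 [zW1 pQ1]] :=
    @exists_extras q l (l + 1) Q0 G1 (kap1 sg ph) (rows_used sg ph) pQ0 c0 s0 matchG1 cG1 E1.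
- move=> t x + xG; rewrite in_setU => /orP[tP|/diagP[i ->]] /=.
    by rewrite Pn_G1 // p1.
  split; apply/eqP => E.
    by have /eqP := E1 xG xG; apply; rewrite -E /= kap1_sg.
  case: E => e1 e2; have /eqP := E1 xG xG; apply.
  by rewrite -e2 -kap1_sg e1 permKV.
- by lia.
set X1 := extras _ _ _ in pQ1; set Q1 := Q0 :|: X1 in pQ1.
have [xr1 xc1 xs1] : line_load X1 2 by apply: extras_load matchG1.
have r1 x : #|[set t in Q1 | t.1.1 == x]| <= l + 1 + 2 by apply: card_setIdU.
have c1 x : #|[set t in Q1 | t.1.2 == x]| <= l + 1 + 2 by apply: card_setIdU.
have s1 x : #|[set t in Q1 | t.2 == x]| <= l + 1 + 2 by apply: card_setIdU.
have [|||||z2 [zW2 pQ2]] := @exists_extras q l (l + 1 + 2) (@rot3 q @: Q1) G2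
   (ph^-1)%g (cols_used sg ph) _ _ _ matchG2 cG2 E2.
- exact/pls_rot3.
- by move=> x; rewrite card_setId_imset; [exact: s1|exact: rot3_inj].
- by move=> x; rewrite card_setId_imset; [exact: r1|exact: rot3_inj].
- move=> _ x /imsetP[t + ->] xG; rewrite /= invgK.
  move/setUP => [/setUP[tP|/diagP[i ->]]|/extrasP[y yG tE]] /=.
  + by rewrite Pn_G2 // p2.
  + split; apply/eqP => E.
      by have /eqP := E2 xG xG; apply; rewrite -E /= permK.
    case: E => /perm_inj e1 e2; have /eqP := E2 xG xG; apply.
    by rewrite -e2 e1.
  have := zW1 y yG; rewrite in_setU negb_or => /andP[+ _].
  have [h1 h2] := mem_hi (ph^-1)%g xG.
  have -> : t.1.1 = z1 y.1 by case: tE => ->.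
  move=> nz; split; apply: contraNneq nz; first by move=> E; rewrite -E in h1.
  by case=> _ ->.
- by lia.
set X2 := extras _ _ _ in pQ2.
have [xr2 xc2 xs2] : line_load X2 2 by apply: extras_load matchG2.
pose Q2 := Q1 :|: unrot @: X2.
have rQ2 : @rot3 q @: Q2 = @rot3 q @: Q1 :|: X2.
  rewrite /Q2 imsetU -imset_comp; congr (_ :|: _); rewrite -[RHS]imset_id.
  exact/eq_imset/unrotK.
have {}pQ2 : pls Q2 by apply/pls_rot3; rewrite rQ2.
have r2 x : #|[set t in Q2 | t.1.1 == x]| <= l + 1 + 2 + 2.
  by apply: card_setIdU => //; rewrite card_setId_imset; [exact: xs2|exact: unrot_inj].
have c2 x : #|[set t in Q2 | t.1.2 == x]| <= l + 1 + 2 + 2.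
  by apply: card_setIdU => //; rewrite card_setId_imset; [exact: xr2|exact: unrot_inj].
have [|||||z3 [zW3 pQ3]] := @exists_extras q l (l + 1 + 2 + 2) (unrot @: Q2) G3
   sg (syms_used sg ph) _ _ _ matchG3 cG3 E3.
- by rewrite (imset_comp (@rot3 q) (@rot3 q)); apply/pls_rot3/pls_rot3.
- by move=> x; rewrite card_setId_imset; [exact: r2|exact: unrot_inj].
- by move=> x; rewrite card_setId_imset; [exact: c2|exact: unrot_inj].
- move=> _ x /imsetP[t + ->] xG; rewrite /=.
  move/setUP => [/setUP[/setUP[tP|/diagP[i ->]]|/extrasP[y yG tE]]|
    /imsetP[u /extrasP[y yG uE] tu]] /=.
  + by rewrite Pn_G3 // p3.
  + split; apply/eqP => E.
      by have /eqP := E3 xG xG; apply; rewrite -E.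
    case: E => e1 e2; have /eqP := E3 xG xG; apply.
    by rewrite -e2 e1 permKV.
  + have := zW1 y yG; rewrite in_setU negb_or => /andP[_].
    have [h1 h2] := mem_lo sg xG.
    have -> : t.1.1 = z1 y.1 by case: tE => ->.
    move=> nz; split; apply: contraNneq nz; first by move=> E; rewrite -E in h1.
    by case=> -> _.
  have := zW2 y yG; rewrite in_setU negb_or => /andP[_].
  have [h1 h2] := mem_hi sg xG.
  have -> : t.1.2 = z2 y.1 by rewrite tu; case: uE => ->.
  move=> nz; split; apply: contraNneq nz; first by move=> E; rewrite -E in h1.
  by case=> _ ->.
- by lia.
set X3 := extras _ _ _ in pQ3.
exists z1, z2, z3; split; first by split.
suff -> : seed sg ph z1 z2 z3 = @rot3 q @: (unrot @: Q2 :|: X3) by apply/pls_rot3.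
rewrite imsetU -imset_comp; congr (_ :|: _); rewrite -[LHS]imset_id.
by apply/eq_imset => t; rewrite /= unrotK.
Qed.

Variables z1 z2 z3 : 'S_q.
Hypothesis zW : fresh sg ph z1 z2 z3.
Local Notation Q := (seed sg ph z1 z2 z3).

(** The transversal adds 1. On a row in [rows_used] the first group is absent, and the other two add
    2 beyond the entries they stand for; on any other row only the first group is present, and it
    adds at most 2. *)
Lemma seed_load : line_load Q (l + 3).
Proof.
have [w1 w2 w3] := zW; have [dr dc ds] := diag_load sg ph.
have unr (b : pred (triple q)) : #|[set t in unrot @: extras G2 (ph^-1)%g z2 | b t]| =
    #|[set t in extras G2 (ph^-1)%g z2 | b (unrot t)]|.
  by apply: card_setId_imset; apply: unrot_inj.
have rot (b : pred (triple q)) : #|[set t in @rot3 q @: extras G3 sg z3 | b t]| =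
    #|[set t in extras G3 sg z3 | b (rot3 t)]|.
  by apply: card_setId_imset; apply: rot3_inj.
split=> y.
- have := row_split y.
  case: (boolP (y \in rows_used sg ph)) => yW ls.
    apply: (@leq_trans (#|[set t in Pn | t.1.1 == y]| + 1 + 0 +
      (#|[set y0 in G2 | y0.2 == y]| + 1) + (#|[set y0 in G3 | y0.1 == y]| + 1))); last by lia.
    apply: (card_setIdU (card_setIdU (card_setIdU (card_setIdU (leqnn _) (dr y)) _) _) _).
    + by rewrite (extras_row0 _ w1 yW).
    + by rewrite unr; exact: (extras_sym _ _ matchG2).
    by rewrite rot; exact: (extras_col _ _ matchG3).
  move: yW; rewrite in_setU negb_or => /andP[y2 y3].
  apply: (@leq_trans (#|[set t in Pn | t.1.1 == y]| + 1 + 2 + 0 + 0)); last by lia.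
  apply: (card_setIdU (card_setIdU (card_setIdU (card_setIdU (leqnn _) (dr y)) _) _) _).
  + exact: extras_row2 matchG1 _.
  + by rewrite unr; have /= -> := extras_sym0 z2 y2.
  by rewrite rot; have /= -> := extras_col0 z3 y3.
- have := col_split y.
  case: (boolP (y \in cols_used sg ph)) => yW ls.
    apply: (@leq_trans (#|[set t in Pn | t.1.2 == y]| + 1 +
      (#|[set y0 in G1 | y0.1 == y]| + 1) + 0 + (#|[set y0 in G3 | y0.2 == y]| + 1))); last by lia.
    apply: (card_setIdU (card_setIdU (card_setIdU (card_setIdU (leqnn _) (dc y)) _) _) _).
    + exact: (extras_col _ _ matchG1).
    + by rewrite unr; have /= -> := extras_row0 (ph^-1)%g w2 yW.
    by rewrite rot; exact: (extras_sym _ _ matchG3).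
  move: yW; rewrite in_setU negb_or => /andP[y1 y3].
  apply: (@leq_trans (#|[set t in Pn | t.1.2 == y]| + 1 + 0 + 2 + 0)); last by lia.
  apply: (card_setIdU (card_setIdU (card_setIdU (card_setIdU (leqnn _) (dc y)) _) _) _).
  + by rewrite (extras_col0 z1 y1).
  + by rewrite unr; exact: (extras_row2 _ _ matchG2).
  by rewrite rot; have /= -> := extras_sym0 z3 y3.
have := sym_split y.
case: (boolP (y \in syms_used sg ph)) => yW ls.
  apply: (@leq_trans (#|[set t in Pn | t.2 == y]| + 1 +
    (#|[set y0 in G1 | y0.2 == y]| + 1) + (#|[set y0 in G2 | y0.1 == y]| + 1) + 0)); last by lia.
  apply: (card_setIdU (card_setIdU (card_setIdU (card_setIdU (leqnn _) (ds y)) _) _) _).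
  + exact: (extras_sym _ _ matchG1).
  + by rewrite unr; exact: (extras_col _ _ matchG2).
  by rewrite rot; have /= -> := extras_row0 sg w3 yW.
move: yW; rewrite in_setU negb_or => /andP[y1 y2].
apply: (@leq_trans (#|[set t in Pn | t.2 == y]| + 1 + 0 + 0 + 2)); last by lia.
apply: (card_setIdU (card_setIdU (card_setIdU (card_setIdU (leqnn _) (ds y)) _) _) _).
+ by rewrite (extras_sym0 z1 y1).
+ by rewrite unr; have /= -> := extras_col0 z2 y2.
by rewrite rot; exact: (extras_row2 _ _ matchG3).
Qed.

Lemma seed_card : #|Q| <= #|PT| + q + 3 * l.
Proof.
have [c1 c2 c3] := card_G; have cs := card_split.
have e1 := card_extras (kap1 sg ph) z1 G1.
have e2 := card_extras (ph^-1)%g z2 G2; have e3 := card_extras sg z3 G3.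
have cd : #|diag sg ph| <= q by apply: leq_trans (leq_imset_card _ _) _; rewrite card_ord.
apply: (@leq_trans (#|Pn| + q + 2 * #|G1| + 2 * #|G2| + 2 * #|G3|)); last by lia.
have cdP := card_setU_le (card_setU_le (leqnn #|Pn|) cd) e1.
apply: card_setU_le; first apply: (card_setU_le cdP).
  exact: leq_trans (leq_imset_card _ _) e2.
exact: leq_trans (leq_imset_card _ _) e3.
Qed.

Lemma seed_Pn t : t \in Pn -> t \in Q.
Proof. by move=> h; do 4![apply/setUP; left]. Qed.

Lemma seed_diag i : (i, sg i, ph i) \in Q.
Proof. by do 3![apply/setUP; left]; apply/setUP; right; apply/diagP; exists i. Qed.

Lemma seed_G1 x : x \in G1 -> (z1 x.1, x.1, x.2) \in Q /\
  (z1 x.1, ((kap1 sg ph)^-1)%g x.2, kap1 sg ph x.1) \in Q.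
Proof.
move=> xG; split; do 2![apply/setUP; left]; apply/setUP; right;
  by apply/extrasP; exists x; auto.
Qed.

Lemma seed_G2 x : x \in G2 -> (x.2, z2 x.1, x.1) \in Q /\
  ((ph^-1)%g x.1, z2 x.1, ph x.2) \in Q.
Proof.
move=> xG; split; apply/setUP; left; apply/setUP; right.
  apply: (imset_f unrot (x := (z2 x.1, x.1, x.2))).
  by apply/extrasP; exists x; auto.
apply: (imset_f unrot (x := (z2 x.1, ph x.2, (ph^-1)%g x.1))).
by apply/extrasP; exists x; rewrite ?invgK; auto.
Qed.

Lemma seed_G3 x : x \in G3 -> (x.1, x.2, z3 x.1) \in Q /\
  ((sg^-1)%g x.2, sg x.1, z3 x.1) \in Q.
Proof.
move=> xG; split; apply/setUP; right.
  apply: (imset_f (@rot3 q) (x := (z3 x.1, x.1, x.2))).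
  by apply/extrasP; exists x; auto.
apply: (imset_f (@rot3 q) (x := (z3 x.1, (sg^-1)%g x.2, sg x.1))).
by apply/extrasP; exists x; auto.
Qed.

(** * Switching in the prolonged square *)

Hypothesis plsQ : pls Q.
Variable L : 'I_q -> 'I_q -> 'I_q.
Hypothesis latL : latin L.
Hypothesis LQ : contains L Q.

Local Notation Lp := (prolong L sg ph ir ic iy).

Lemma prolong_seed t : t \in Q -> ph t.1.1 != t.2 ->
  Lp (lift ir t.1.1) (lift ic t.1.2) = lift iy t.2.
Proof.
move=> tQ ne; rewrite /prolong !liftK; case: eqP => [e|_]; last by rewrite LQ.
have [h _ _] := plsQ; case/eqP: ne.
by have -> : t = (t.1.1, sg t.1.1, ph t.1.1) by apply: h; rewrite ?seed_diag.
Qed.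

Lemma prolong_row c : Lp ir (lift ic c) = lift iy (kap1 sg ph c).
Proof. by rewrite /prolong unlift_none liftK /kap1 permM. Qed.

Lemma prolong_col r : Lp (lift ir r) ic = lift iy (ph r).
Proof. by rewrite /prolong unlift_none liftK. Qed.

Lemma prolong_diag r : Lp (lift ir r) (lift ic (sg r)) = iy.
Proof. by rewrite /prolong !liftK eqxx. Qed.

Lemma prolong_Pn t : t \in Pn -> Lp (lift ir t.1.1) (lift ic t.1.2) = lift iy t.2.
Proof.
move=> tP; apply: prolong_seed; first exact: seed_Pn.
have := no_clash tP t.1.1; rewrite /clash /= !negb_or eqxx /= => /and3P[_ + _].
by rewrite eq_sym.
Qed.

(** The first row and the first column are always those of the prescribed entry that the switch puts
    in place. *)
Definition int_rows (j : cell q + (cell q + cell q)) : cell q.+1 :=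
  match j with
  | inl x => (ir, lift ir (z1 x.1))
  | inr (inl x) => (lift ir x.2, lift ir ((ph^-1)%g x.1))
  | inr (inr x) => (lift ir x.1, lift ir ((sg^-1)%g x.2))
  end.

Definition int_cols (j : cell q + (cell q + cell q)) : cell q.+1 :=
  match j with
  | inl x => (lift ic x.1, lift ic (((kap1 sg ph)^-1)%g x.2))
  | inr (inl x) => (ic, lift ic (z2 x.1))
  | inr (inr x) => (lift ic x.2, lift ic (sg x.1))
  end.

Definition in_groups (j : cell q + (cell q + cell q)) : bool :=
  match j with
  | inl x => x \in G1
  | inr (inl x) => x \in G2
  | inr (inr x) => x \in G3
  end.

Lemma lift_eq (h : 'I_q.+1) (i j : 'I_q) : (lift h i == lift h j) = (i == j).
Proof. exact/inj_eq/lift_inj. Qed.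

Lemma int_intercalate j : in_groups j -> intercalate Lp (int_rows j) (int_cols j).
Proof.
case: j => [x|[x|x]] /= xG.
- have [q1 q2] := seed_G1 xG.
  have v1 : Lp (lift ir (z1 x.1)) (lift ic x.1) = lift iy x.2.
    apply: (prolong_seed q1); apply/eqP => /= e; have [_ h _] := plsQ.
    have /(congr1 (fun t => t.1.2)) /= e1 := h _ _ q1 (seed_diag (z1 x.1)) erefl (esym e).
    by have /eqP := E1 xG xG; apply; rewrite {1}e1 kap1_sg.
  have v2 : Lp (lift ir (z1 x.1)) (lift ic (((kap1 sg ph)^-1)%g x.2)) = lift iy (kap1 sg ph x.1).
    apply: (prolong_seed q2); apply/eqP => /= e; have [_ h _] := plsQ.
    have /(congr1 (fun t => t.1.2)) /= e1 := h _ _ q2 (seed_diag (z1 x.1)) erefl (esym e).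
    by have /eqP := E1 xG xG; apply; rewrite -e -kap1_sg -e1 permKV.
  split=> /=; rewrite ?neq_lift // ?lift_eq.
  + by rewrite -(inj_eq (@perm_inj _ (kap1 sg ph))) permKV E1.
  + by rewrite prolong_row v2.
  by rewrite prolong_row v1 permKV.
- have [q1 q2] := seed_G2 xG.
  have v1 : Lp (lift ir x.2) (lift ic (z2 x.1)) = lift iy x.1.
    apply: (prolong_seed q1); apply/eqP => /= e.
    by have /eqP := E2 xG xG; apply; rewrite -e permK.
  have v2 : Lp (lift ir ((ph^-1)%g x.1)) (lift ic (z2 x.1)) = lift iy (ph x.2).
    apply: (prolong_seed q2); rewrite /= permKV; apply/eqP => e.
    by have /eqP := E2 xG xG; apply; rewrite e permK.
  split=> /=; rewrite ?neq_lift // ?lift_eq.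
  + by rewrite eq_sym E2.
  + by rewrite prolong_col v2.
  by rewrite prolong_col v1 permKV.
have [q1 q2] := seed_G3 xG.
have ne : (sg^-1)%g x.2 != x.1.
  by rewrite -(inj_eq (@perm_inj _ sg)) permKV eq_sym E3.
have v1 : Lp (lift ir x.1) (lift ic x.2) = lift iy (z3 x.1).
  rewrite /prolong !liftK (negPf (E3 xG xG)); congr lift; exact: (LQ q1).
have v2 : Lp (lift ir ((sg^-1)%g x.2)) (lift ic (sg x.1)) = lift iy (z3 x.1).
  rewrite /prolong !liftK permKV eq_sym (negPf (E3 xG xG)); congr lift; exact: (LQ q2).
split=> /=; rewrite ?neq_lift // ?lift_eq.
- by rewrite eq_sym.
- by rewrite eq_sym E3.
- by rewrite v1 v2.
by rewrite prolong_diag -{2}[x.2](permKV sg) prolong_diag.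
Qed.

Lemma block_disjoint n (R C R' C' : cell n) :
  (forall a, a \in [set R.1; R.2] -> a \notin [set R'.1; R'.2]) \/
  (forall a, a \in [set C.1; C.2] -> a \notin [set C'.1; C'.2]) ->
  [disjoint block R C & block R' C'].
Proof.
move=> h; apply/pred0Pn => -[[r c] /andP[/setXP[r1 c1] /setXP[r2 c2]]].
by case: h => h; [move: (h r r1); rewrite r2|move: (h c c1); rewrite c2].
Qed.

Lemma set2_lift (h : 'I_q.+1) a b x : x \in [set lift h a; lift h b] ->
  exists2 y, x = lift h y & y \in [set a; b].
Proof.
by rewrite !inE => /orP[]/eqP->; [exists a|exists b]; rewrite // !inE eqxx ?orbT.
Qed.

Lemma set2_liftP (h : 'I_q.+1) a b y :
  (lift h y \in [set lift h a; lift h b]) = (y \in [set a; b]).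
Proof. by rewrite !inE !lift_eq. Qed.

Lemma set2_sub (A : {set 'I_q}) a b y : a \in A -> b \in A -> y \in [set a; b] -> y \in A.
Proof. by move=> aA bA; rewrite !inE => /orP[]/eqP->. Qed.

Lemma anchor_notin (A : {set 'I_q}) (h : 'I_q.+1) z a b x : z \notin A ->
  a \in A -> b \in A -> x \in [set lift h a; lift h b] -> x \notin [set h; lift h z].
Proof.
move=> zA aA bA /set2_lift[y -> /(set2_sub aA bA) yA].
rewrite !inE negb_or lift_eq eq_sym neq_lift /=.
by apply: contraNneq zA => <-.
Qed.

(** Between two groups, the singled out line and the fresh line of one are both missed by the other.
    Within a group, [lo_sep] or [hi_sep] separates the rows or the columns. *)
Lemma int_disjoint i j : in_groups i -> in_groups j -> i != j ->
  [disjoint block (int_rows i) (int_cols i) & block (int_rows j) (int_cols j)].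
Proof.
have [w1 w2 w3] := zW.
have D12 x y : x \in G1 -> y \in G2 -> [disjoint
    block (int_rows (inl x)) (int_cols (inl x)) &
    block (int_rows (inr (inl y))) (int_cols (inr (inl y)))].
  move=> xG yG; rewrite disjoint_sym; apply: block_disjoint; left => a /= aP.
  have := w1 x xG; rewrite in_setU negb_or => /andP[nz _].
  have [h1 h2] := mem_hi (ph^-1)%g yG.
  exact: anchor_notin nz h1 h2 aP.
have D13 x y : x \in G1 -> y \in G3 -> [disjoint
    block (int_rows (inl x)) (int_cols (inl x)) &
    block (int_rows (inr (inr y))) (int_cols (inr (inr y)))].
  move=> xG yG; rewrite disjoint_sym; apply: block_disjoint; left => a /= aP.
  have := w1 x xG; rewrite in_setU negb_or => /andP[_ nz].
  have [h1 h2] := mem_lo sg yG.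
  exact: anchor_notin nz h1 h2 aP.
have D23 x y : x \in G2 -> y \in G3 -> [disjoint
    block (int_rows (inr (inl x))) (int_cols (inr (inl x))) &
    block (int_rows (inr (inr y))) (int_cols (inr (inr y)))].
  move=> xG yG; rewrite disjoint_sym; apply: block_disjoint; right => a /= aP.
  have := w2 x xG; rewrite in_setU negb_or => /andP[_ nz].
  have [h1 h2] := mem_hi sg yG.
  exact: anchor_notin nz h1 h2 aP.
case: i j => [x|[x|x]] [y|[y|y]] xG yG ne.
- apply: block_disjoint;right => a /set2_lift[c -> cx]; rewrite set2_liftP.
  apply: (lo_sep matchG1 E1 xG yG _ cx).
  by apply: contraNneq ne => ->.
- exact: (D12 x y).
- exact: (D13 x y).
- by rewrite disjoint_sym; exact: (D12 y x).
- apply: block_disjoint;left => a /set2_lift[c -> cx]; rewrite set2_liftP.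
  apply: (hi_sep matchG2 E2 xG yG _ cx).
  by apply: contraNneq ne => ->.
- exact: (D23 x y).
- by rewrite disjoint_sym; exact: (D13 y x).
- by rewrite disjoint_sym; exact: (D23 y x).
- apply: block_disjoint;left => a /set2_lift[c -> cx]; rewrite set2_liftP.
apply: (lo_sep matchG3 E3 xG yG _ cx).
by apply: contraNneq ne => ->.
Qed.

Lemma int_avoid t j : t \in Pn -> in_groups j ->
  (lift ir t.1.1, lift ic t.1.2) \notin block (int_rows j) (int_cols j).
Proof.
move=> tP; have tQ := seed_Pn tP; have [h _ _] := plsQ.
have same u : u \in Q -> t.1.1 = u.1.1 -> t.1.2 = u.1.2 -> t = u by apply: h.
rewrite /block in_setX; case: j => [x|[x|x]] /= xG; apply/negP; rewrite !inE !lift_eq.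
- have [q1 q2] := seed_G1 xG; rewrite eq_sym (negPf (neq_lift _ _)) /=.
  case/andP=> /eqP er /orP[]/eqP ec.
    by have := Pn_G1 tP xG; rewrite (same _ q1 er ec) /= -surjective_pairing eqxx.
  by have := p1 tP xG; rewrite (same _ q2 er ec) eqxx.
- have [q1 q2] := seed_G2 xG; rewrite [lift ic _ == ic]eq_sym (negPf (neq_lift _ _)) /=.
  case/andP=> /orP[]/eqP er /eqP ec.
    by have := Pn_G2 tP xG; rewrite (same _ q1 er ec) /= -surjective_pairing eqxx.
  by have := p2 tP xG; rewrite (same _ q2 er ec) eqxx.
have [q1 q2] := seed_G3 xG.
have nd : sg t.1.1 != t.1.2.
  have := no_clash tP t.1.1; rewrite /clash /= !negb_or eqxx /= => /and3P[+ _ _].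
  by rewrite eq_sym.
case/andP=> /orP[]/eqP er /orP[]/eqP ec.
- by have := Pn_G3 tP xG; rewrite (same _ q1 er ec) /= -surjective_pairing eqxx.
- by case/eqP: nd; rewrite er ec.
- by case/eqP: nd; rewrite er ec permKV.
by have := p3 tP xG; rewrite (same _ q2 er ec) eqxx.
Qed.

Lemma seed_completion : exists L', latin L' /\ contains L' PT.
Proof.
have latp : latin Lp.
  by apply: latin_prolong => // i; have := LQ (seed_diag i).
have inE' j : (j \in enum in_groups) = in_groups j by rewrite mem_enum.
have [|||L' [latL' sw same]] := @switch_disjoint _ _ (enum in_groups) int_rows int_cols Lp latp.
- exact: enum_uniq.
- by move=> j; rewrite inE'; apply: int_intercalate.
- by move=> i j; rewrite !inE'; apply: int_disjoint.
exists L'; split=> // t /PT_cases[[u uP ->]|[x xG ->]|[x xG ->]|[x xG ->]] /=.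
- rewrite same; first exact: prolong_Pn.
  by move=> j; rewrite inE'; apply: int_avoid.
- have jG : inl x \in enum in_groups by rewrite inE'.
  have [+ _ _ _] := sw _ jG; rewrite /= => ->.
  by rewrite prolong_row permKV.
- have jG : inr (inl x) \in enum in_groups by rewrite inE'.
  have [_ _ _ e4] := int_intercalate (xG : in_groups (inr (inl x))).
  have [+ _ _ _] := sw _ jG; rewrite /= e4 => ->.
  by rewrite /= prolong_col permKV.
have jG : inr (inr x) \in enum in_groups by rewrite inE'.
have [+ _ _ _] := sw _ jG; rewrite /= => ->.
exact: prolong_diag.
Qed.
End Seed.

Lemma odd_completion :
  (forall Q : {set triple q}, pls Q -> line_load Q (l + 3) ->
     #|Q| <= #|PT| + q + 3 * l -> exists L, latin L /\ contains L Q) ->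
  exists L, latin L /\ contains L PT.
Proof.
move=> even; have [sg [ph [nc [E1 E2 E3] [p1 p2 p3]]]] := exists_transversal.
have [z1 [z2 [z3 [zW pQ]]]] := exists_fresh nc E1 E2 E3 p1 p2 p3.
have [|L [latL LQ]] := even _ pQ (seed_load zW); first exact: seed_card.
exact: seed_completion nc E1 E2 E3 p1 p2 p3 _ _ _ zW pQ L latL LQ.
Qed.

End OddOrder.

(** * Numerical estimates *)

Lemma ffact_le_exp t k : t ^_ k <= t ^ k.
Proof.
rewrite ffact_prod -[X in t ^ X]card_ord -prod_nat_const; apply: leq_prod => i _.
exact: leq_subr.
Qed.

Lemma exp_le_ffact q k : (q - k) ^ k <= q ^_ k.
Proof.
rewrite ffact_prod -[X in _ ^ X]card_ord -prod_nat_const; apply: leq_prod => i _.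
by rewrite leq_sub2l // ltnW.
Qed.

(** A cheap form of Stirling's bound: [k ^ k] is at most the falling factorial of [2 * k], and the
    central binomial coefficient is at most [4 ^ k]. *)
Lemma exp_le_fact k : k ^ k <= 4 ^ k * k`!.
Proof.
have b : 'C(k.*2, k) <= 4 ^ k.
  rewrite -[4]/(2 ^ 2) -expnM mul2n -[2]/(1 + 1) expnDn.
  have ko : k < (k.*2).+1 by lia.
  rewrite (bigD1 (Ordinal ko)) //= !exp1n !muln1; exact: leq_addr.
apply: leq_trans (_ : k.*2 ^_ k <= _); last by rewrite -bin_ffact leq_mul2r b orbT.
by have := exp_le_ffact k.*2 k; have -> : k.*2 - k = k by lia.
Qed.

(** By [exp_le_fact] a line is overloaded with probability at most [(4 * t / (k * (q - k))) ^ k],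
    which the second hypothesis bounds by [(2 / 5) ^ k]. *)
Lemma few_bad_isotopisms q t k : 0 < k < q -> 10 * t <= k * (q - k) ->
  q.*2 * 2 ^ k < 5 ^ k -> q.*2 * 'C(t, k) * (q - k)`! < q`!.
Proof.
move=> /andP[k0 kq] tk large.
rewrite -(ffact_fact (ltnW kq)) ltn_mul2r fact_gt0 /=.
apply: leq_trans (exp_le_ffact q k).
have qk : 0 < (q - k) ^ k by rewrite expn_gt0 subn_gt0 kq.
rewrite -(ltn_pmul2r (fact_gt0 k)) -mulnA bin_ffact.
rewrite -(ltn_pmul2l (_ : 0 < 10 ^ k)) ?expn_gt0 //.
apply: leq_ltn_trans (_ : q.*2 * (4 ^ k * k`!) * (q - k) ^ k < _).
  rewrite mulnCA -!mulnA leq_mul2l; apply/orP; right.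
  apply: leq_trans (_ : (10 * t) ^ k <= _).
    by rewrite expnMn leq_mul2l ffact_le_exp orbT.
  apply: leq_trans (_ : (k * (q - k)) ^ k <= _); first by rewrite leq_exp2r.
  by rewrite expnMn mulnA leq_mul2r exp_le_fact orbT.
have -> : q.*2 * (4 ^ k * k`!) * (q - k) ^ k = (q.*2 * 2 ^ k) * (2 ^ k * (k`! * (q - k) ^ k)).
  by rewrite -[4]/(2 * 2) expnMn; ring.
have -> : 10 ^ k * ((q - k) ^ k * k`!) = 5 ^ k * (2 ^ k * (k`! * (q - k) ^ k)).
  by rewrite -[10]/(5 * 2) expnMn; ring.
by rewrite ltn_pmul2r // !muln_gt0 expn_gt0 fact_gt0.
Qed.

(** Applied to [k.+1] with [k = q %/ 270], where [q.*2] is less than [540 * k.+1]. *)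
Lemma exp_growth k : 11 <= k -> 540 * k * 2 ^ k < 5 ^ k.
Proof.
elim: k => // k IH; rewrite leq_eqVlt => /predU1P[<-|]; first by lia.
rewrite ltnS => k11; have := IH k11; rewrite !expnS; move: (2 ^ k) (5 ^ k) => x y.
nia.
Qed.

(* [q] is [n] or [n - 1]; the padding of [l] and [t] is what the reduction from
   [q.+1] to [q] costs.  Literals are split into factors because [nat] numerals
   are unary. *)
Lemma numerics n q l t : 0 < l -> q <= n <= q.+1 ->
  72 * 72 * t + 2185 * n + 850 * 900 * l + 1256 * 1256 * l ^ 2 <= n ^ 2 ->
  let k := q %/ 270 in
  [/\ 14 * l + 20 < q, 10 * (t + q + 3 * l) <= k.+1 * (q - k.+1),
      q.*2 * 2 ^ k.+1 < 5 ^ k.+1 &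
      168 * (l + 3) * q + 84 * k * q + 704 * (t + q + 3 * l) + 576 * q <= q ^ 2].
Proof.
move=> l0 /andP[qn nq] H k.
have {}H : 72 * 72 * t + 2185 * n + 850 * 900 * l + 1256 * 1256 * (l * l) <= n * n.
  by rewrite !mulnn.
have n0 : 2186 <= n.
  rewrite leqNgt; apply/negP => lt; have : n * n <= 2185 * n by rewrite leq_mul2r; lia.
  by move: (n * n) (l * l) H => nn ll H; lia.
(* For smaller [n], the product [n * (n - 2185)] would fall short of the terms in [l] and
   [l * l]. *)
have n2 : 1256 * l + 1390 <= n.
  rewrite leqNgt; apply/negP => lt.
  have : n * (n - 2185) <= (1256 * l + 1389) * (1256 * l + 1389 - 2185).
    by apply: leq_mul; lia.
  by nia.
(* Hence [q >= 2969] and [k.+1 >= 11], as [exp_growth] requires. *)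
have n1 : 2970 <= n by nia.
have kq : 270 * k <= q by rewrite mulnC leq_trunc_div.
have qk : q < 270 * k.+1 by rewrite mulnC ltn_ceil.
split=> //.
- by lia.
- have big : 270 * 270 * (10 * (t + q + 3 * l)) <= q * (269 * q - 270).
    have [x qx] : exists x, q = 2969 + x by exists (q - 2969); lia.
    have ll : l <= l * l by rewrite leq_pmull.
    have hn : n * n <= q * q + 2 * q + 1 by nia.
    move: (l * l) ll H => z ll H.
    clear kq qk n0 n1 n2; subst q; nia.
  have := leq_mul (ltnW qk) (_ : 269 * q - 270 <= 270 * (q - k.+1)).
  by move=> /(_ _)/(leq_trans big) => h; nia.
- have k11 : 11 <= k.+1 by lia.
  apply: leq_ltn_trans (exp_growth k11); rewrite leq_mul2r; apply/orP; right; lia.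
(* The remaining claim is four times the budget of [even_completion] for [q = 2 * m], load [l + 3]
   and [t + q + 3 * l] entries. *)
rewrite -mulnn; have kqq : 270 * (k * q) <= q * q by rewrite mulnA leq_mul2r kq orbT.
have hn : n * n <= q * q + 2 * q + 1 by nia.
have [|l2] := leqP l 1.
  move=> l1; have {}l1 : l = 1 by lia.
  have q1 : 2969 <= q by lia.
  rewrite l1 in H *; clear kq qk; nia.
have [x qx] : exists x, q = 1256 * l + 1389 + x by exists (q - (1256 * l + 1389)); lia.
have [y ly] : exists y, l = y + 2 by exists (l - 2); lia.
clear kq qk n0 n1 n2 l0 l2.
have : 72 * 72 * t + 2184 * q + 850 * 900 * l + 1256 * 1256 * (l * l) <= q * q + 2 * q by lia.
move=> {}H; clear hn qn nq.
subst q l; nia.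
Qed.

Lemma padded_completion m n l t (PT : {set triple m.*2}) :
  0 < l -> m.*2 <= n <= m.*2.+1 ->
  72 * 72 * t + 2185 * n + 850 * 900 * l + 1256 * 1256 * l ^ 2 <= n ^ 2 ->
  pls PT -> line_load PT (l + 3) -> #|PT| <= t + m.*2 + 3 * l ->
  exists L, latin L /\ contains L PT.
Proof.
move=> l0 nm H plsPT load cPT.
have [q0 tk large budget] := numerics l0 nm H.
set k := m.*2 %/ 270 in tk large budget.
have kq : k <= m.*2 by apply: leq_div.
apply: (even_completion (k := k)) plsPT load _ _; first by lia.
  apply: few_bad_isotopisms => //; last by apply: leq_trans tk; rewrite leq_mul2l cPT orbT.
  have : 270 * k <= m.*2 by rewrite mulnC leq_trunc_div.
  by lia.
move: (#|PT|) k cPT budget {tk large kq} => p k; rewrite -!mul2n; nia.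
Qed.

Lemma exists_notin (T : finType) (A : {set T}) : #|A| < #|T| -> exists x, x \notin A.
Proof.
move=> lt; apply/existsP; rewrite -negb_forall; apply: contraL lt => /forallP h.
by rewrite -leqNgt; apply/subset_leq_card/subsetP.
Qed.

Lemma triples_completion n l (PT : {set triple n}) :
  0 < l -> pls PT -> line_load PT l ->
  72 * 72 * #|PT| + 2185 * n + 850 * 900 * l + 1256 * 1256 * l ^ 2 <= n ^ 2 ->
  exists L, latin L /\ contains L PT.
Proof.
move=> l0 plsPT load H; have [lr lc ls] := load.
have [on|/even_halfK en] := boolP (odd n); last first.
  move: PT plsPT load H lr lc ls; rewrite -en => PT plsPT load H lr lc ls.
  apply: (padded_completion l0 _ H) => //; rewrite ?leqnSn ?leqnn //.
    by split=> x; apply: leq_trans (leq_addr _ _); [exact: lr|exact: lc|exact: ls].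
  by lia.
have nE : n = (n./2).*2.+1 by have := odd_double_half n; rewrite on; lia.
move: (n./2) nE => m nE; subst n.
have nm : m.*2 <= m.*2.+1 <= m.*2.+1 by rewrite leqnSn leqnn.
have [q0 _ _ _] := numerics l0 nm H.
(* The lines are chosen so that no entry lies on two of them: [ic] avoids the columns of the entries
   in row [ir], and [iy] the symbols in row [ir] and in column [ic]. *)
pose ir : 'I_m.*2.+1 := ord0.
pose A x := [set t in PT | t.1.1 == x]; pose B x := [set t in PT | t.1.2 == x].
have [|ic icP] := @exists_notin _ [set t.1.2 | t in A ir].
  by rewrite card_ord; apply: leq_ltn_trans (leq_trans (leq_imset_card _ _) (lr ir)) _; lia.
have [|iy iyP] := @exists_notin _ ([set t.2 | t in A ir] :|: [set t.2 | t in B ic]).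
  rewrite card_ord; apply: leq_ltn_trans (_ : l + l < _); last by lia.
  apply: card_setU_le; apply: leq_trans (leq_imset_card _ _) _; [exact: lr|exact: lc].
move: iyP; rewrite in_setU negb_or => /andP[iy1 iy2].
apply: (odd_completion (ir := ir) (ic := ic) (iy := iy) plsPT load q0).
- move=> t tP er ec; case/negP: icP; apply/imsetP; exists t => //.
  by rewrite inE tP er eqxx.
- move=> t tP er ey; case/negP: iy1; apply/imsetP; exists t => //.
  by rewrite inE tP er eqxx.
- move=> t tP ec ey; case/negP: iy2; apply/imsetP; exists t => //.
  by rewrite inE tP ec eqxx.
by move=> Q; apply: (padded_completion l0 nm H).
Qed.

(** * From arrays to sets of triples *)

Definition triples n (P : 'M[option 'I_n]_n) : {set triple n} :=
  [set t | P t.1.1 t.1.2 == Some t.2].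

Lemma triplesP n (P : 'M[option 'I_n]_n) t :
  reflect (P t.1.1 t.1.2 = Some t.2) (t \in triples P).
Proof. by rewrite inE; apply: eqP. Qed.

Lemma pls_triples n (P : 'M[option 'I_n]_n) :
  partial_latin_square P -> pls (triples P).
Proof.
move=> [Prow Pcol]; split=> -[[r c] s] [[r' c'] s'] /triplesP /= e /triplesP /= e'.
- by move=> ??; subst r' c'; move: e'; rewrite e => -[->].
- move=> ??; subst r' s'; rewrite (Prow r c c') ?e //.
- move=> ??; subst c' s'; rewrite (Pcol c r r') ?e //.
Qed.

Lemma card_triples n (P : 'M[option 'I_n]_n) : #|triples P| <= #|filled_cells P|.
Proof.
rewrite -(@card_in_imset _ _ fst (mem (triples P))).
  apply/subset_leq_card/subsetP => c /imsetP[t /triplesP tP ->].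
  by rewrite inE tP.
move=> [c s] [c' s'] /triplesP /= e /triplesP /= e' E; subst c'.
by move: e'; rewrite e => -[->].
Qed.

Lemma load_triples n l (P : 'M[option 'I_n]_n) :
  (forall i, #|[set j | P i j]| <= l) -> (forall j, #|[set i | P i j]| <= l) ->
  (forall s, #|[set c in filled_cells P | P c.1 c.2 == Some s]| <= l) ->
  line_load (triples P) l.
Proof.
move=> hr hc hs; split=> x.
- apply: leq_trans (hr x); rewrite -(@card_in_imset _ _ (fun t => t.1.2)).
    apply/subset_leq_card/subsetP => c /imsetP[t /setIdP[/triplesP tP /eqP <-] ->].
    by rewrite inE tP.
  move=> [[r c] s] [[r' c'] s'] /setIdP[/triplesP /= e /eqP r1] /setIdP[/triplesP /= e' /eqP r2] /=.
  by move=> ?; subst r r' c'; move: e'; rewrite e => -[->].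
- apply: leq_trans (hc x); rewrite -(@card_in_imset _ _ (fun t => t.1.1)).
    apply/subset_leq_card/subsetP => c /imsetP[t /setIdP[/triplesP tP /eqP <-] ->].
    by rewrite inE tP.
  move=> [[r c] s] [[r' c'] s'] /setIdP[/triplesP /= e /eqP r1] /setIdP[/triplesP /= e' /eqP r2] /=.
  by move=> ?; subst c c' r'; move: e'; rewrite e => -[->].
apply: leq_trans (hs x); rewrite -(@card_in_imset _ _ fst).
  apply/subset_leq_card/subsetP => c /imsetP[t /setIdP[/triplesP tP /eqP <-] ->].
  by rewrite !inE tP eqxx.
move=> [c s] [c' s'] /setIdP[_ /eqP /= ->] /setIdP[_ /eqP /= ->] /= ->.
by [].
Qed.

Lemma completable_triples n (P : 'M[option 'I_n]_n) L :
  latin L -> contains L (triples P) -> completable P.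
Proof.
move=> [Lr Lc] LP; exists (\matrix_(i, j) L i j)%R; split.
  by split=> [i j1 j2|j i1 i2]; rewrite !mxE; [exact: Lr|exact: Lc].
move=> i j; case E : (P i j) => [s|] // _; rewrite mxE.
by have -> : s = L i j by rewrite (LP (i, j, s)) //; apply/triplesP.
Qed.

Lemma exists_latin n : exists L : 'I_n -> 'I_n -> 'I_n, latin L.
Proof.
case: n => [|n]; first by exists (fun i _ => i); split=> -[].
exists (fun i j => (i + j)%R); split=> [i j j' /addrI //|j i i' /= /addIr //].
Qed.

Local Open Scope ring_scope.

(** The square root is at most 1/12. Squaring and multiplying by [144 * n ^ 2] gives the
    coefficients [72 ^ 2] at [t], 2185.92 at [n], 769824 at [l] and 1577664 at [l ^ 2]; the last
    three are rounded down to 2185, [850 * 900] and [1256 ^ 2]. *)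
Lemma hypothesis_cleared (R : realType) (eps delta : R) (n : nat) (l t : R) :
  0 <= eps -> 0 <= delta -> (0 < n)%N ->
  12 <= n%:R
       - 12 * n%:R * Num.sqrt (36 * delta + 198 * delta / n%:R
                               + 5346 * eps / n%:R + 1518 / (100 * n%:R)
                               + 10956 * eps ^+ 2)
       - 12 * eps * n%:R ->
  0 <= l <= eps * n%:R -> t <= delta * n%:R ^+ 2 ->
  72 * 72 * t + 2185 * n%:R + 850 * 900 * l + 1256 * 1256 * l ^+ 2 <= n%:R ^+ 2.
Proof.
move=> e0 d0 n0 large /andP[l0 le] td.
have N0 : 0 < n%:R :> R by rewrite ltr0n.
move: (n%:R) N0 large le td => N N0 large le td.
set X := (X in Num.sqrt X) in large.
have X0 : 0 <= X.
  rewrite /X; do ?[exact: ler0n|exact: ltW|exact: exprn_ge0|apply: addr_ge0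
    |apply: divr_ge0|apply: mulr_ge0|by []].
have s0 := sqrtr_ge0 X; have sX := sqr_sqrtr X0.
have sl : Num.sqrt X <= 1 / 12.
  rewrite -(ler_pM2l N0); move: (Num.sqrt X) s0 large {sX} => s s0 large.
  have : 0 <= eps * N by rewrite mulr_ge0 // ltW.
  by lra.
have Xl : X <= 1 / 144 by rewrite -sX; nra.
have XN : X * N ^+ 2 = 36 * (delta * N ^+ 2) + 198 * delta * N + 5346 * (eps * N)
    + 1518 / 100 * N + 10956 * (eps * N) ^+ 2.
  by rewrite /X; field; rewrite gt_eqF.
have XNl : X * N ^+ 2 <= 1 / 144 * N ^+ 2 by rewrite ler_wpM2r // exprn_ge0 // ltW.
rewrite {}XN in XNl.
have dN : 0 <= delta * N by rewrite mulr_ge0 // ltW.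
have l2 : l ^+ 2 <= (eps * N) ^+ 2 by rewrite ler_sqr // nnegrE // (le_trans l0).
have := sqr_ge0 l; clear X X0 s0 sX sl Xl large.
move: (N ^+ 2) (l ^+ 2) ((eps * N) ^+ 2) l2 td XNl => N2 L2 E2 l2 td XNl L0.
lra.
Qed.

Theorem theorem4p1p2 (R : realType) (eps delta : R) (n : nat)
  (eps_ge0 : 0 <= eps) (delta_ge0 : 0 <= delta) (n_gt0 : (0 < n)%N)
  (n_large : 12 <= n%:R
       - 12 * n%:R * Num.sqrt (36 * delta + 198 * delta / n%:R
                               + 5346 * eps / n%:R + 1518 / (100 * n%:R)
                               + 10956 * eps ^+ 2)
       - 12 * eps * n%:R)
  (P : 'M[option 'I_n]_n) (P_pls : partial_latin_square P)
  (P_dense : eps_dense eps P)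
  (P_filled : #|filled_cells P|%:R <= delta * n%:R ^+ 2) :
  completable P.
Proof.
have x0 : 0 <= eps * n%:R by rewrite mulr_ge0 ?ler0n.
have [P_row P_col P_sym] := P_dense.
(* The empty array is treated apart so that the integral load [l] below is positive, as [numerics]
   requires. *)
have [empty|[i [j Pij]]] : (forall i j, ~~ P i j) \/ exists i j, P i j.
  case: (boolP [exists i, exists j, isSome (P i j)]) => [/existsP[i /existsP[j Pij]]|no].
    by right; exists i, j.
  left=> i j; apply: contra no => Pij; apply/existsP; exists i.
  by apply/existsP; exists j.
- have [L latL] := exists_latin n; apply: (completable_triples latL) => t.
  by move/triplesP => E; have := empty t.1.1 t.1.2; rewrite E.
pose l := Num.trunc (eps * n%:R).
have le_l m : m%:R <= eps * n%:R -> (m <= l)%N by rewrite truncn_ge_nat.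
have l0 : (0 < l)%N.
  by apply: leq_trans (le_l _ (P_row i)); apply/card_gt0P; exists j; rewrite inE.
have loadP : line_load (triples P) l by apply: load_triples => x; apply: le_l.
have [|L [latL LP]] := triples_completion l0 (pls_triples P_pls) loadP; last first.
  exact: completable_triples LP.
rewrite -(ler_nat R) !(natrD, natrM, natrX).
apply: hypothesis_cleared eps_ge0 delta_ge0 n_gt0 n_large _ _.
  by rewrite ler0n /l truncn_le.
by apply: le_trans P_filled; rewrite ler_nat card_triples.
Qed.
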